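(* Let $G$ be a complex semisimple Lie group. Then $G$ can be equipped with an incomplete left-invariant holomorphic metric.
   Context: Complex Lie groups are assumed connected; semisimple means that the Lie algebra is non-zero and semisimple. A holomorphic (Riemannian) metric on a complex manifold $M$ is a holomorphic section of the symmetric square of the holomorphic cotangent bundle that is non-degenerate (as a complex bilinear form) at every point. It has a unique torsion-free metric holomorphic Levi-Civita connection $\nabla$; a geodesic is a holomorphic curve $\gamma:A\to M$, $A\subseteq\mathbb{C}$ open, with $\nabla_{\dot\gamma}\dot\gamma=0$. The metric is complete if for every $p\in M$ and every holomorphic tangent vector $v$ at $p$ there is a geodesic $\gamma:\mathbb{C}\to M$ defined on all of $\mathbb{C}$ with $\gamma(0)=p$, $\dot\gamma(0)=v$; otherwise it is incomplete. *)

(* Defs.v *)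
From HB Require Import structures.
From mathcomp Require Import all_boot all_order all_algebra.
From mathcomp Require Import all_classical all_reals all_analysis.
From mathcomp Require Import complex ring.

Set Implicit Arguments.
Unset Strict Implicit.
Unset Printing Implicit Defensive.

Import Order.TTheory GRing.Theory Num.Theory numFieldNormedType.Exports.

Local Open Scope classical_set_scope.
Local Open Scope ring_scope.

(* R[i], sealed as a numClosedFieldType so that it inherits the norm topology
   and the C-normed-module structure that MathComp-Analysis gives to every
   numClosedFieldType.  With K := Cplx R, [differentiable] is therefore complex
   Frechet differentiability; "holomorphic" below means complex differentiable
   at every point of an open set. *)
Definition Cplx (R : realType) : numClosedFieldType := complex R.

(** * Complex manifolds *)

(* [cmap] and [cinv] are total; only their restrictions to [cdom] and to
   [cmap @` cdom] are meaningful. *)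
Record chart (R : realType) (n : nat) (M : topologicalType) := Chart {
  cdom : set M;
  cmap : M -> 'rV[Cplx R]_n;
  cinv : 'rV[Cplx R]_n -> M;
  cdom_open : open cdom;
  cimg_open : open (cmap @` cdom);
  cmapK : forall p, cdom p -> cinv (cmap p) = p;
  cmap_continuous : forall p, cdom p -> {for p, continuous cmap};
  cinv_continuous : forall p, cdom p -> {for cmap p, continuous cinv} }.

(* [chart_at p] is an arbitrary preferred chart at p.  It serves to represent
   the holomorphic tangent space T_p M by 'rV[C]_n: a tangent vector at p is
   its coordinate vector in the chart [chart_at p]. *)
HB.mixin Record isComplexManifold (R : realType) (n : nat) M of Topological M := {
  atlas : set (chart R n M);
  chart_at : M -> chart R n M;
  chart_at_atlas : forall p, atlas (chart_at p);
  chart_at_dom : forall p, cdom (chart_at p) p;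
  transition_holomorphic : forall c d p, atlas c -> atlas d ->
    cdom c p -> cdom d p -> differentiable (cmap d \o cinv c) (cmap c p);
  manifold_hausdorff : hausdorff_space M;
  manifold_second_countable : @second_countable M }.

#[short(type="complexManifoldType")]
HB.structure Definition ComplexManifold (R : realType) (n : nat) :=
  {M of Topological M & isComplexManifold R n M}.

Definition holomorphic (R : realType) (m n : nat)
    (M : complexManifoldType R m) (N : complexManifoldType R n) (f : M -> N) :=
  continuous f /\
  forall (c : chart R m M) (d : chart R n N) p,
    atlas c -> atlas d -> cdom c p -> cdom d (f p) ->
    differentiable (cmap d \o f \o cinv c) (cmap c p).

(* Holomorphy of f : M x M -> N in the product charts of M x M. *)
Definition holomorphic2 (R : realType) (m n : nat)
    (M : complexManifoldType R m) (N : complexManifoldType R n)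
    (f : M * M -> N) :=
  continuous f /\
  forall (c1 c2 : chart R m M) (d : chart R n N) p1 p2,
    atlas c1 -> atlas c2 -> atlas d ->
    cdom c1 p1 -> cdom c2 p2 -> cdom d (f (p1, p2)) ->
    differentiable
      (fun u : 'rV[Cplx R]_m * 'rV[Cplx R]_m =>
         cmap d (f (cinv c1 u.1, cinv c2 u.2)))
      (cmap c1 p1, cmap c2 p2).

Section Manifold.
Context {R : realType} {n : nat} {M : complexManifoldType R n}.
Local Notation C := (Cplx R).
Local Notation E := 'rV[C]_n.
Implicit Types (c d : chart R n M) (p : M).

Definition chart_change c d p : E -> E := 'd (cmap d \o cinv c) (cmap c p).

Lemma diff_near_id (h : E -> E) (x : E) :
  (\forall y \near x, h y = y) -> 'd h x = id :> (E -> E).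
Proof.
move=> hx; apply: (@diff_unique _ _ _ h idfun) => //; first by move=> ?; exact.
apply/eqaddoP => e e0; have -> : h x = x by exact: nbhs_singleton hx.
have : \forall y \near (0 : E), h (y + x) = y + x.
  by move: hx; rewrite (near_shift 0) subr0.
apply: filterS => y /=; rewrite !fctE /= => ->.
by rewrite [x + y]addrC subrr normr0 mulr_ge0 // ltW.
Qed.

Lemma chart_changeK c d p v : atlas c -> atlas d -> cdom c p -> cdom d p ->
  chart_change d c p (chart_change c d p v) = v.
Proof.
move=> ac ad cp dp; rewrite /chart_change.
have dcd := transition_holomorphic _ _ _ ac ad cp dp.
have ddc := transition_holomorphic _ _ _ ad ac dp cp.
have e : (cmap d \o cinv c) (cmap c p) = cmap d p by rewrite /= cmapK.
have := diff_comp dcd; rewrite e => /(_ _ _ ddc) eq_d.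
rewrite -[LHS]/(('d (cmap c \o cinv d) (cmap d p) \o
                 'd (cmap d \o cinv c) (cmap c p)) v) -eq_d diff_near_id //.
have nc : \forall y \near cmap c p, (cmap c @` cdom c) y.
  by apply: open_nbhs_nbhs; split; [exact: cimg_open | exists p].
have nd : \forall y \near cmap c p, cdom d (cinv c y).
  apply: (cinv_continuous cp); rewrite cmapK //.
  by apply: open_nbhs_nbhs; split; [exact: cdom_open | ].
near=> y; have [q cq qy] : (cmap c @` cdom c) y by near: y.
have /= : cdom d (cinv c y) by near: y.
by rewrite -qy /= cmapK // => dq; rewrite cmapK.
Unshelve. all: by end_near. Qed.

(* The differential T_p M -> T_(f p) M. *)
Definition tangent_map (f : M -> M) p : E -> E :=
  'd (cmap (chart_at (f p)) \o f \o cinv (chart_at p)) (cmap (chart_at p) p).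

(* A vector field is X : M -> E with X p in T_p M; [vf_coord c X] is its
   expression in the chart c. *)
Definition vf_coord c (X : M -> E) (u : E) : E :=
  let p := cinv c u in chart_change (chart_at p) c p (X p).

Definition vf_bracket (X Y : M -> E) p : E :=
  let c := chart_at p in
  'd (vf_coord c Y) (cmap c p) (X p) - 'd (vf_coord c X) (cmap c p) (Y p).

(** * Holomorphic metrics *)

Definition mxform (A : 'M[C]_n) (v w : E) : C := (v *m A *m w^T) 0 0.

(* The matrix at u of the tensor field g in the chart c. *)
Definition metric_mx (g : M -> 'M[C]_n) c (u : E) : 'M[C]_n :=
  let p := cinv c u in
  let J := 'J (cmap (chart_at p) \o cinv c) u in
  J *m g p *m J^T.

(* u |-> g(v, w), for the constant coordinate fields v and w of the chart c. *)
Definition metric_coord (g : M -> 'M[C]_n) c (v w u : E) : C :=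
  mxform (metric_mx g c u) v w.

Record holo_metric := HoloMetric {
  metric_at :> M -> 'M[C]_n;
  metric_sym : forall p v w,
    mxform (metric_at p) v w = mxform (metric_at p) w v;
  metric_nondegenerate : forall p v,
    (forall w, mxform (metric_at p) v w = 0) -> v = 0;
  metric_holomorphic : forall c p, atlas c -> cdom c p ->
    forall v w, differentiable (metric_coord metric_at c v w) (cmap c p) }.

Implicit Type g : holo_metric.

(** ** The Levi-Civita connection, in a chart *)

(* The Christoffel map of the chart c at u: z := christoffel g c u v w is the
   solution of Koszul's identity
     2 g(z, y) = D_v g(w, y) + D_w g(v, y) - D_y g(v, w)   for all y.
   In this chart nabla_v Y = D_v Y + christoffel v Y.  [christoffel_sym]
   (torsion-freeness), [christoffel_metric] (compatibility with g, for constant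
   coordinate fields) and [christoffel_unique] below show that this is the
   unique torsion-free metric connection. *)
Definition koszul g c (u v w y : E) : C :=
  2^-1 * ('D_v (metric_coord g c w y) u + 'D_w (metric_coord g c v y) u
        - 'D_y (metric_coord g c v w) u).

Definition christoffel g c (u v w : E) : E :=
  (\row_k koszul g c u v w (delta_mx 0 k)) *m invmx (metric_mx g c u).

Lemma mxform_metric_mx (h : M -> 'M[C]_n) c u v w :
  mxform (metric_mx h c u) v w =
  mxform (h (cinv c u)) ('d (cmap (chart_at (cinv c u)) \o cinv c) u v)
                        ('d (cmap (chart_at (cinv c u)) \o cinv c) u w).
Proof.
by rewrite /mxform /metric_mx /jacobian -!mul_rV_lin1 trmx_mul !mulmxA.
Qed.

Lemma mxform_metric_mx_sym g c u v w :
  mxform (metric_mx g c u) v w = mxform (metric_mx g c u) w v.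
Proof. by rewrite !mxform_metric_mx metric_sym. Qed.

Lemma metric_mx_unit g c p : atlas c -> cdom c p ->
  metric_mx g c (cmap c p) \in unitmx.
Proof.
move=> ac cp; rewrite -row_free_unit; apply: inj_row_free => v vA.
have [ap dp] := (chart_at_atlas p, chart_at_dom p).
rewrite -(chart_changeK v ac ap cp dp).
suff -> : chart_change c (chart_at p) p v = 0 by rewrite /chart_change linear0.
apply: (@metric_nondegenerate g p) => w.
rewrite -(chart_changeK w ap ac dp cp).
have := mxform_metric_mx g c (cmap c p) v (chart_change (chart_at p) c p w).
by rewrite cmapK // => <-; rewrite /mxform vA mul0mx mxE.
Qed.

Section Christoffel.
Context (g : holo_metric) (c : chart R n M) (p : M).
Context (ac : atlas c) (cp : cdom c p).
Let u := cmap c p.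
Local Notation B := (metric_coord g c).

Let dB v w : differentiable (B v w) u.
Proof. exact: metric_holomorphic. Qed.

Lemma mxform_sumr (A : 'M[C]_n) v w :
  mxform A v w = \sum_k w 0 k * mxform A v (delta_mx 0 k).
Proof.
rewrite {1}[w]row_sum_delta /mxform linear_sum mulmx_sumr summxE.
by apply: eq_bigr => k _; rewrite linearZ -scalemxAr mxE.
Qed.

Let koszulE v w y : koszul g c u v w y =
  2^-1 * ('D_v (B w y) u + 'D_w (B v y) u - 'D_y (B v w) u).
Proof. by []. Qed.

Let Bsym v w : B v w = B w v.
Proof. by apply/funext => x; exact: mxform_metric_mx_sym. Qed.

Let koszul_sum v w y :
  koszul g c u v w y = \sum_k y 0 k * koszul g c u v w (delta_mx 0 k).
Proof.
have B1 z x : B z x = \sum_k x 0 k *: B z (delta_mx 0 k).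
  apply/funext => t; rewrite fct_sumE.
  by rewrite [LHS]/metric_coord [LHS]mxform_sumr; apply: eq_bigr.
have D1 z x a : 'D_a (B z x) u = \sum_k x 0 k * 'D_a (B z (delta_mx 0 k)) u.
  rewrite B1 derive_sum => [|k]; last exact/derivableZ/diff_derivable.
  by apply: eq_bigr => k _; rewrite deriveZ //; exact/diff_derivable.
have D2 z x a : 'D_a (B z x) u = \sum_k a 0 k * 'D_(delta_mx 0 k) (B z x) u.
  rewrite deriveE // {1}[a]row_sum_delta linear_sum.
  by apply: eq_bigr => k _; rewrite linearZ deriveE.
rewrite koszulE (D1 w y v) (D1 v y w) (D2 v w y).
rewrite -big_split -sumrB mulr_sumr; apply: eq_bigr => k _ /=.
by rewrite koszulE [RHS]mulrCA [y 0 k * (_ - _)]mulrBr [y 0 k * (_ + _)]mulrDr.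
Qed.

Lemma christoffelP v w y :
  mxform (metric_mx g c u) (christoffel g c u v w) y = koszul g c u v w y.
Proof.
rewrite /mxform /christoffel mulmxKV ?metric_mx_unit // koszul_sum mxE.
by apply: eq_bigr => k _; rewrite !mxE mulrC.
Qed.

(* Hides the derivatives of the metric from unification. *)
Let koszul_abs : exists F : E -> E -> E -> C,
  [/\ forall z v w, 'D_z (B v w) u = F z v w, forall z v w, F z v w = F z w v &
      forall v w y, koszul g c u v w y = 2^-1 * (F v w y + F w v y - F y v w)].
Proof.
exists (fun z v w => 'D_z (B v w) u); split.
- by move=> z v w; reflexivity.
- by move=> z v w; rewrite (Bsym v w).
- exact: koszulE.
Qed.

Let koszul_sym v w y : koszul g c u v w y = koszul g c u w v y.
Proof.
by have [F [_ Fs FE]] := koszul_abs; rewrite !FE (Fs y v w) (addrC (F v w y)).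
Qed.

Lemma christoffel_sym v w : christoffel g c u v w = christoffel g c u w v.
Proof.
have row_ext (f1 f2 : 'I_n -> C) (A : 'M[C]_n) : f1 =1 f2 ->
    (\row_k f1 k) *m A = (\row_k f2 k) *m A by move=> /funext ->.
exact: row_ext (fun k => koszul_sym v w (delta_mx 0 k)).
Qed.

Lemma christoffel_metric z v w :
  'D_z (B v w) u = mxform (metric_mx g c u) (christoffel g c u z v) w
                 + mxform (metric_mx g c u) v (christoffel g c u z w).
Proof.
have [F [DF Fs FE]] := koszul_abs; rewrite DF.
have bs := mxform_metric_mx_sym g c u.
have GF x y k : mxform (metric_mx g c u) (christoffel g c u x y) k =
    2^-1 * (F x y k + F y x k - F k x y) by rewrite -FE; exact: christoffelP.
move: (christoffel g c u) (mxform (metric_mx g c u)) bs GF => Ga b bs GF.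
rewrite (bs v) !GF -mulrDr.
rewrite (Fs z w v).
have -> : F z v w + F v z w - F w z v + (F z v w + F w z v - F v z w) =
          2 * F z v w by ring.
by rewrite mulKf // pnatr_eq0.
Qed.

Lemma christoffel_unique (Gam : E -> E -> E) :
  (forall v w, Gam v w = Gam w v) ->
  (forall z v w, 'D_z (B v w) u = mxform (metric_mx g c u) (Gam z v) w
                                + mxform (metric_mx g c u) v (Gam z w)) ->
  forall v w, Gam v w = christoffel g c u v w.
Proof.
move=> Gs Gm v w.
have GE y : mxform (metric_mx g c u) (Gam v w) y = koszul g c u v w y.
  have [F [DF _ FE]] := koszul_abs; rewrite FE.
  have bs := mxform_metric_mx_sym g c u.
  have {DF}Gm z a e : F z a e = mxform (metric_mx g c u) (Gam z a) e
                        + mxform (metric_mx g c u) a (Gam z e).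
    by rewrite -DF; exact: Gm.
  move: (mxform (metric_mx g c u)) bs Gm => b bs Gm.
  rewrite !Gm (Gs w v) (Gs y v) (Gs y w) (bs w) (bs v (Gam w y)) (bs (Gam v y)).
  set a1 := b (Gam v w) y; set a2 := b w _; set a3 := b _ _.
  have -> : a1 + a2 + (a1 + a3) - (a2 + a3) = 2 * a1 by ring.
  by rewrite mulKf // pnatr_eq0.
apply: (can_inj (mulmxK (metric_mx_unit g ac cp))).
apply/rowP => k.
have pick x : mxform (metric_mx g c u) x (delta_mx 0 k) =
              (x *m metric_mx g c u) 0 k.
  have dE i : ((delta_mx 0 k : E)^T : 'cV[C]_n) i 0 = (i == k)%:R by rewrite !mxE.
  rewrite /mxform mxE (bigD1 k) //= dE eqxx mulr1 big1 ?addr0 // => i ik.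
  by rewrite dE (negPf ik) mulr0.
apply: etrans (pick _); apply: etrans (esym (pick _)) _.
by apply: etrans (GE _) _; exact/esym/christoffelP.
Qed.

End Christoffel.

(** ** Geodesics *)

Definition holo_curve (A : set C) (gam : C -> M) :=
  forall t, A t -> {for t, continuous gam} /\
    forall c, atlas c -> cdom c (gam t) -> differentiable (cmap c \o gam) t.

(* The covariant derivative along gam of the vector field V along gam, with V
   given by its coordinates in the chart c. *)
Definition nabla_along g c (gam : C -> M) (V : C -> E) (t : C) : E :=
  derive1 V t +
  christoffel g c (cmap c (gam t)) (derive1 (cmap c \o gam) t) (V t).

Definition geodesic g (A : set C) (gam : C -> M) :=
  [/\ open A, holo_curve A gam &
    forall t c, A t -> atlas c -> cdom c (gam t) ->
      nabla_along g c gam (derive1 (cmap c \o gam)) t = 0].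

Definition velocity (gam : C -> M) (t : C) : E :=
  derive1 (cmap (chart_at (gam t)) \o gam) t.

Definition complete_metric g :=
  forall (p : M) (v : E), exists gam : C -> M,
    [/\ geodesic g setT gam, gam 0 = p & velocity gam 0 = v].

Definition incomplete_metric g := ~ complete_metric g.

End Manifold.

Arguments holo_metric {R n} M.

(** * Lie algebras *)

Section LieAlgebra.
Context {K : fieldType} {V : vectType K} (br : V -> V -> V).

Definition is_subspace (A : set V) :=
  [/\ A 0, (forall x y, A x -> A y -> A (x + y)) &
      forall (a : K) x, A x -> A (a *: x)].

(* [A, A], the linear span of the brackets of elements of A. *)
Definition lie_derived (A : set V) : set V :=
  smallest is_subspace [set z | exists x y, [/\ A x, A y & z = br x y]].

Definition lie_solvable (A : set V) :=
  exists k, iter k lie_derived A `<=` [set 0].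

Definition lie_ideal (I : {vspace V}) :=
  forall x y, y \in I -> br x y \in I.

(* The radical is zero, i.e. every solvable ideal is zero. *)
Definition lie_semisimple :=
  forall I : {vspace V}, lie_ideal I -> lie_solvable [set` I] -> I = 0%VS.

End LieAlgebra.

(** * Complex Lie groups *)

HB.mixin Record isComplexLieGroup (R : realType) (n : nat) G
    of ComplexManifold R n G & Group G := {
  mulg_holomorphic : holomorphic2 (fun xy : G * G => (xy.1 * xy.2)%g : G);
  invg_holomorphic : holomorphic (fun x : G => (x^-1)%g : G);
  lie_group_connected : connected [set: G] }.

#[short(type="complexLieGroupType")]
HB.structure Definition ComplexLieGroup (R : realType) (n : nat) :=
  {G of ComplexManifold R n G & Group G & isComplexLieGroup R n G}.

Section LieGroup.
Context {R : realType} {n : nat} {G : complexLieGroupType R n}.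
Local Notation E := 'rV[Cplx R]_n.

Definition left_translation (a : G) : G -> G := fun x => (a * x)%g.

(* The left-invariant vector field with value v at the identity. *)
Definition left_invariant_field (v : E) (a : G) : E :=
  tangent_map (left_translation a) (1%g : G) v.

(* The Lie algebra of G is T_1 G with this bracket. *)
Definition lie_group_bracket (v w : E) : E :=
  vf_bracket (left_invariant_field v) (left_invariant_field w) (1%g : G).

Definition left_invariant (g : holo_metric G) :=
  forall (a p : G) (v w : E),
    mxform (g (left_translation a p))
      (tangent_map (left_translation a) p v)
      (tangent_map (left_translation a) p w) = mxform (g p) v w.

End LieGroup.

Definition semisimple (R : realType) (n : nat) (G : complexLieGroupType R n) :=
  (exists v : 'rV[Cplx R]_n, v != 0) /\
  lie_semisimple (@lie_group_bracket R n G).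

(* Main.v *)
Require Import Defs.
From HB Require Import structures.
From mathcomp Require Import all_boot all_order all_algebra.
From mathcomp Require Import all_classical all_reals all_analysis.
From mathcomp Require Import complex ring lra.

(* By Engel's theorem some ad_x is not nilpotent, so phi o ad_x = lam phi for a
   linear form phi != 0 and some lam != 0; then phi x = 0, and there is a
   symmetric nondegenerate bilinear form S with S(x, .) = phi.  For a geodesic
   gam of the left-invariant metric defined by S, the curve xi in the Lie
   algebra obtained by left-translating gam' to 1 satisfies the Euler-Arnold
   equation S(xi, w)' = S(xi, [xi, w]).  Its solution with xi(0) = x is
   x / (1 - lam t), which blows up at t = 1 / lam, so gam is not defined on
   the whole of C.

   A [differentiable] function is only assumed to have a complex derivative at
   each point.  That its derivatives are again differentiable, with symmetric
   second derivatives, comes from Goursat's theorem on rectangles and Cauchy's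
   formula on a square; it is needed for the Jacobi identity and to
   differentiate the left-invariant vector fields. *)

Set Implicit Arguments.
Unset Strict Implicit.
Unset Printing Implicit Defensive.
Import Order.TTheory GRing.Theory Num.Theory numFieldNormedType.Exports.
Local Open Scope classical_set_scope.
Local Open Scope ring_scope.

(** * The real norm of a complex normed space *)

Section RealNorm.
Context {R : realType}.
Local Notation C := (Cplx R).
Local Notation re := (@complex.Re R).
Local Notation im := (@complex.Im R).

(** The condition phi o ad_x = lam phi is what makes the explicit solution work: for xi = x / (1 -
    lam t) both sides of the Euler-Arnold equation are lam phi(w) / (1 - lam t)^2. No existence or
    uniqueness theorem for differential equations is invoked. Completeness would provide an entire
    curve xi; the difference (1 - lam t) xi(t) - x then solves a linear system that degenerates only
    at t = 1 / lam, and a real Gronwall estimate along the segment from 0 to 1 / lam makes it vanish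
    there, end point included, where it equals -x.

    On the analytic side, contours are squares with sides parallel to the axes, so that a contour
    integral is a combination of four real integrals over intervals. The value 2 pi i of the
    integral of 1 / z is never computed: Cauchy's formula keeps that integral as a denominator, and
    a lower bound 1/2 for its absolute value is enough for every estimate. Several variables are
    reached by restricting a function to complex lines, where the one-variable bounds apply with
    constants uniform in the base point. *)

Definition rc (x : R) : C := (x%:C)%C.
Definition ic : C := ('i)%C.

(* The norm of a C-normed space takes its values in C; [nm] is its real value. *)
Definition nm (V : normedModType C) (v : V) : R := re `|v|.

Lemma ge0_rc (z : C) : 0 <= z -> z = rc (re z).
Proof. by case: z => a b; rewrite lecE /= => /andP[/eqP -> _]. Qed.

Lemma nmE (V : normedModType C) (v : V) : `|v| = rc (nm v).
Proof. by rewrite /nm -ge0_rc. Qed.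

Lemma rc_le (x y : R) : (rc x <= rc y) = (x <= y).
Proof. exact: lecR. Qed.

Lemma rc_lt (x y : R) : (rc x < rc y) = (x < y).
Proof. exact: ltcR. Qed.

Lemma rcD (x y : R) : rc (x + y) = rc x + rc y.
Proof. exact: (raddfD (real_complex R)). Qed.

Lemma rcN (x : R) : rc (- x) = - rc x.
Proof. exact: (raddfN (real_complex R)). Qed.

Lemma rcB (x y : R) : rc (x - y) = rc x - rc y.
Proof. by rewrite rcD rcN. Qed.

Lemma rcM (x y : R) : rc (x * y) = rc x * rc y.
Proof. exact: (rmorphM (real_complex R)). Qed.

Lemma rcV (x : R) : rc x^-1 = (rc x)^-1.
Proof. exact: (fmorphV (real_complex R)). Qed.

Lemma rc0 : rc 0 = 0. Proof. by []. Qed.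
Lemma rc1 : rc 1 = 1. Proof. by []. Qed.

Lemma rc_inj : injective rc.
Proof. exact: complexI. Qed.

Lemma gt0_rc (z : C) : 0 < z -> exists2 e : R, 0 < e & z = rc e.
Proof.
by move=> z0; have zE := ge0_rc (ltW z0); exists (re z) => //;
  rewrite -rc_lt -zE.
Qed.

Section Module.
Context {V : normedModType C}.
Implicit Types u v : V.

Lemma nm_ge0 v : 0 <= nm v.
Proof. by rewrite -rc_le -nmE; exact: normr_ge0. Qed.

Lemma nm0 : nm (0 : V) = 0.
Proof. by rewrite /nm normr0. Qed.

Lemma nm_eq0 v : (nm v == 0) = (v == 0).
Proof. by rewrite -(inj_eq rc_inj) -nmE normr_eq0. Qed.

Lemma nm_gt0 v : (0 < nm v) = (v != 0).
Proof. by rewrite lt_neqAle nm_ge0 andbT eq_sym nm_eq0. Qed.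

Lemma nmD u v : nm (u + v) <= nm u + nm v.
Proof. by rewrite -rc_le rcD -!nmE ler_normD. Qed.

Lemma nmN v : nm (- v) = nm v.
Proof. by rewrite /nm normrN. Qed.

Lemma nmB u v : nm (u - v) <= nm u + nm v.
Proof. by rewrite -(nmN v) nmD. Qed.

Lemma nmZ a v : nm (a *: v) = nm a * nm v.
Proof. by apply: rc_inj; rewrite rcM -!nmE normrZ. Qed.

Lemma nm_sum (I : finType) (F : I -> V) : nm (\sum_i F i) <= \sum_i nm (F i).
Proof.
apply: (big_ind2 (fun x y => nm x <= y)) => //; first by rewrite nm0.
by move=> x y x' y' h h'; apply: le_trans (nmD _ _) _; exact: lerD.
Qed.

Lemma near_nmP (x : V) (P : set V) :
  nbhs x P <-> exists2 d : R, 0 < d & forall y, nm (y - x) < d -> P y.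
Proof.
split=> [/nbhs_normP[e /= e0 eP]|[d d0 dP]].
  have [d d0 ed] := gt0_rc e0; exists d => // y yd; apply: eP => /=.
  by rewrite distrC nmE ed rc_lt.
apply/nbhs_normP; exists (rc d); first by rewrite /= -rc0 rc_lt.
by move=> y /=; rewrite distrC nmE rc_lt => /dP.
Qed.

End Module.

Lemma nmM (a b : C) : nm (a * b) = nm a * nm b.
Proof. by apply: rc_inj; rewrite rcM -!nmE normrM. Qed.

Lemma nm1 : nm (1 : C) = 1.
Proof. by rewrite /nm normr1. Qed.

Lemma nmV (a : C) : nm a^-1 = (nm a)^-1.
Proof. by apply: rc_inj; rewrite rcV -!nmE normfV. Qed.

Lemma nm_sqrt (z : C) : nm z = Num.sqrt (re z ^+ 2 + im z ^+ 2).
Proof. by case: z => a b; apply: rc_inj; rewrite -nmE; exact: normc_def. Qed.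

Lemma nm_rc (x : R) : nm (rc x) = `|x|.
Proof. by rewrite nm_sqrt /= expr0n /= addr0 sqrtr_sqr. Qed.

Lemma nm_rc_ge0 (x : R) : 0 <= x -> nm (rc x) = x.
Proof. by move=> x0; rewrite nm_rc ger0_norm. Qed.

Lemma nm_ic : nm ic = 1.
Proof. by rewrite nm_sqrt /= expr0n expr1n /= add0r sqrtr1. Qed.

Lemma complex_split (z : C) : z = rc (re z) + ic * rc (im z).
Proof. exact: complexE. Qed.

Lemma re_le_nm (z : C) : `|re z| <= nm z.
Proof. by rewrite -rc_le -nmE; exact: normc_ge_Re. Qed.

Lemma im_le_nm (z : C) : `|im z| <= nm z.
Proof.
rewrite nm_sqrt -sqrtr_sqr ler_sqrt ?lerDr ?sqr_ge0 //.
by rewrite addr_ge0 ?sqr_ge0.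
Qed.

Lemma nm_le_re_im (z : C) : nm z <= `|re z| + `|im z|.
Proof.
rewrite {1}[z]complex_split; apply: le_trans (nmD _ _) _.
by rewrite nmM nm_ic mul1r !nm_rc.
Qed.

Lemma reD (z w : C) : re (z + w) = re z + re w.
Proof. by case: z w => [a b] [c d]. Qed.
Lemma imD (z w : C) : im (z + w) = im z + im w.
Proof. by case: z w => [a b] [c d]. Qed.
Lemma reN (z : C) : re (- z) = - re z.
Proof. by case: z. Qed.
Lemma imN (z : C) : im (- z) = - im z.
Proof. by case: z. Qed.
Lemma reM (z w : C) : re (z * w) = re z * re w - im z * im w.
Proof. by case: z w => [a b] [c d]. Qed.
Lemma imM (z w : C) : im (z * w) = re z * im w + im z * re w.
Proof. by case: z w => [a b] [c d]. Qed.
Lemma re_rc x : re (rc x) = x. Proof. by []. Qed.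
Lemma im_rc x : im (rc x) = 0. Proof. by []. Qed.
Lemma re_ic : re ic = 0. Proof. by []. Qed.
Lemma im_ic : im ic = 1. Proof. by []. Qed.
Definition reim := (reD, imD, reN, imN, reM, imM, re_rc, im_rc, re_ic, im_ic).

Lemma complex_ext (z w : C) : re z = re w -> im z = im w -> z = w.
Proof. by case: z w => [a b] [c d] /= -> ->. Qed.

End RealNorm.

(** * Contour integrals *)

Section ComplexIntegral.
Context {R : realType}.
Local Notation C := (Cplx R).
Local Notation re := (@complex.Re R).
Local Notation im := (@complex.Im R).
Local Notation mu := (@lebesgue_measure R).

(** Continuity in the ambient space at each point of [A], not for the subspace topology.
    Differentiable functions provide this, and it passes to the sides and pieces of a rectangle
    without further argument. *)
Definition cts_on (U V : topologicalType) (A : set U) (g : U -> V) :=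
  forall t, A t -> {for t, continuous g}.

Definition rint (g : R -> R) (a b : R) : R := (\int[mu]_(x in `[a, b]) g x)%R.

Lemma cts_on_integrable (g : R -> R) (a b : R) :
  cts_on `[a, b] g -> mu.-integrable `[a, b] (EFin \o g).
Proof.
move=> gc; apply: continuous_compact_integrable; first exact: segment_compact.
apply: continuous_in_subspaceT => t; rewrite inE => tab; exact: gc.
Qed.

Lemma rint_cat (g : R -> R) (a b c : R) : a <= b -> b <= c ->
  cts_on `[a, c] g -> rint g a c = rint g a b + rint g b c.
Proof.
move=> ab bc gc; apply/eqP; rewrite addrC -subr_eq; apply/eqP.
rewrite /rint Rintegral_itvB ?bnd_simp //; last exact: cts_on_integrable.
rewrite Rintegral_itv_obnd_cbnd //.
apply: integrableS (cts_on_integrable gc) => //.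
by apply: subset_itvr; rewrite bnd_simp.
Qed.

Lemma rint_cst (k a b : R) : a <= b -> rint (fun=> k) a b = k * (b - a).
Proof.
move=> ab; rewrite /rint Rintegral_cst //; congr (_ * _).
have := @lebesgue_measure_itv R `[a, b]; rewrite /= => ->; rewrite lte_fin.
by move: ab; rewrite le_eqVlt => /predU1P[->|->] //; rewrite ltxx subrr.
Qed.

Lemma rint_le (g h : R -> R) (a b : R) : cts_on `[a, b] g -> cts_on `[a, b] h ->
  (forall t, a <= t <= b -> g t <= h t) -> rint g a b <= rint h a b.
Proof.
move=> gc hc gh; apply: le_Rintegral => //; exact: cts_on_integrable.
Qed.

Lemma cts_cst (U V : topologicalType) (A : set U) (k : V) : cts_on A (fun=> k).
Proof. by move=> t _; exact: cst_continuous. Qed.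

Lemma rint_bound (g : R -> R) (a b M : R) : a <= b -> cts_on `[a, b] g ->
  (forall t, a <= t <= b -> `|g t| <= M) -> `|rint g a b| <= M * (b - a).
Proof.
move=> ab gc gM; rewrite ler_norml -mulNr -!rint_cst //.
by apply/andP; split; apply: rint_le => //; (try exact: cts_cst) => t /gM;
  rewrite ler_norml => /andP[].
Qed.

Lemma rintD (g h : R -> R) (a b : R) : cts_on `[a, b] g -> cts_on `[a, b] h ->
  rint (fun t => g t + h t) a b = rint g a b + rint h a b.
Proof. by move=> gc hc; apply: RintegralD => //; exact: cts_on_integrable. Qed.

Lemma rintZ (k : R) (g : R -> R) (a b : R) : cts_on `[a, b] g ->
  rint (fun t => k * g t) a b = k * rint g a b.
Proof. by move=> gc; apply: RintegralZl => //; exact: cts_on_integrable. Qed.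

Lemma rint_id (a b : R) : a <= b -> rint id a b = (b ^+ 2 - a ^+ 2) / 2.
Proof.
rewrite le_eqVlt => /orP[/eqP ->|ab].
  by rewrite subrr mul0r /rint set_itv1 Rintegral_set1.
pose F : R -> R := 2^-1 *: (@id R ^+ 2).
have dF (x : R) : is_derive x 1 F x.
  apply: is_derive_eq; rewrite /GRing.scale /= expr1 -mulr_natl ?mulr1 mulrA.
  by rewrite mulVf ?mul1r // pnatr_eq0.
rewrite /rint /Rintegral (@continuous_FTC2 _ id F) //=.
- by rewrite /F /GRing.scale /= !fctE -mulrBr mulrC.
- by apply: continuous_subspaceT => x; exact: cvg_id.
- have d (x : R) : {for x, continuous F}.
    by apply: differentiable_continuous; apply/derivable1_diffP; exact: ex_derive.
  split=> //.
  + by apply: cvg_at_right_filter; exact: d.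
  + by apply: cvg_at_left_filter; exact: d.
- by move=> x _; rewrite derive1E derive_val.
Qed.

(** The complex integral is locked so that conversion and [ring] treat it as an atom instead of
    unfolding it to real integrals. *)
Fact cint_key : unit. Proof. by []. Qed.
Definition cint (g : R -> C) (a b : R) : C :=
  locked_with cint_key
    (rc (rint (re \o g) a b) + ic * rc (rint (im \o g) a b)).

Lemma re_cint g a b : re (cint g a b) = rint (re \o g) a b.
Proof. by rewrite /cint unlock !reim mul0r mulr0 subrr addr0. Qed.
Lemma im_cint g a b : im (cint g a b) = rint (im \o g) a b.
Proof. by rewrite /cint unlock !reim mul0r mul1r !add0r. Qed.

Lemma eq_rint (g h : R -> R) (a b : R) :
  (forall t, a <= t <= b -> g t = h t) -> rint g a b = rint h a b.
Proof.
by move=> gh; apply: eq_Rintegral => x; rewrite inE /= in_itv; exact: gh.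
Qed.

Lemma eq_cint (g h : R -> C) (a b : R) :
  (forall t, a <= t <= b -> g t = h t) -> cint g a b = cint h a b.
Proof.
by move=> gh; rewrite /cint !unlock; congr (rc _ + ic * rc _); apply: eq_rint => t /gh /= ->.
Qed.

Lemma re_continuous : continuous (re : C -> R).
Proof.
move=> z; apply/(@cvgrPdist_lt _ _ _ (nbhs z)) => e e0; apply/near_nmP; exists e => // y yz.
rewrite -[re z - re y]/(re z + - re y) -reN -reD; apply: le_lt_trans (re_le_nm _) _.
by rewrite -nmN opprB.
Qed.

Lemma im_continuous : continuous (im : C -> R).
Proof.
move=> z; apply/(@cvgrPdist_lt _ _ _ (nbhs z)) => e e0; apply/near_nmP; exists e => // y yz.
rewrite -[im z - im y]/(im z + - im y) -imN -imD; apply: le_lt_trans (im_le_nm _) _.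
by rewrite -nmN opprB.
Qed.

Lemma cvg_nmP (T : Type) (F : set_system T) {FF : Filter F} (V : normedModType C)
    (g : T -> V) (l : V) :
  g @ F --> l <-> forall e : R, 0 < e -> \forall t \near F, nm (g t - l) < e.
Proof.
split=> [gl e e0|gl].
  by apply: (gl [set y | nm (y - l) < e]); apply/near_nmP; exists e.
apply/cvgrPdist_lt => e /gt0_rc[d d0 ->]; move: (gl _ d0); apply: filterS => t.
by rewrite distrC nmE rc_lt.
Qed.

Lemma rc_continuous : continuous (@rc R).
Proof.
move=> x; apply/cvg_nmP => e e0.
have := @cvg_id _ (nbhs x); move/cvgrPdist_lt => /(_ _ e0); apply: filterS => t.
by rewrite -rcB nm_rc distrC.
Qed.

Lemma cts_re (g : R -> C) A : cts_on A g -> cts_on A (re \o g).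
Proof. by move=> gc t /gc g1; apply: continuous_comp => //; exact: re_continuous. Qed.
Lemma cts_im (g : R -> C) A : cts_on A g -> cts_on A (im \o g).
Proof. by move=> gc t /gc g1; apply: continuous_comp => //; exact: im_continuous. Qed.

Lemma ctsD (V : normedModType C) (U : topologicalType) (g h : U -> V) A :
  cts_on A g -> cts_on A h -> cts_on A (fun t => g t + h t).
Proof. by move=> gc hc t At; apply: continuousD; [exact: gc|exact: hc]. Qed.

Lemma ctsM (U : topologicalType) (g h : U -> C) A :
  cts_on A g -> cts_on A h -> cts_on A (fun t => g t * h t).
Proof. by move=> gc hc t At; apply: continuousM; [exact: gc|exact: hc]. Qed.

Lemma ctsrM (U : topologicalType) (g h : U -> R) A :
  cts_on A g -> cts_on A h -> cts_on A (fun t => g t * h t).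
Proof. by move=> gc hc t At; apply: continuousM; [exact: gc|exact: hc]. Qed.

Lemma cint_cat (g : R -> C) (a b c : R) : a <= b -> b <= c ->
  cts_on `[a, c] g -> cint g a c = cint g a b + cint g b c.
Proof.
move=> ab bc gc; apply: complex_ext; rewrite ?(reD, imD) ?re_cint ?im_cint.
  exact: rint_cat (cts_re gc).
exact: rint_cat (cts_im gc).
Qed.

Lemma cintD (g h : R -> C) (a b : R) : cts_on `[a, b] g -> cts_on `[a, b] h ->
  cint (fun t => g t + h t) a b = cint g a b + cint h a b.
Proof.
move=> gc hc; apply: complex_ext.
  rewrite [RHS]reD !re_cint -(rintD (cts_re gc) (cts_re hc)).
  by apply: eq_rint => t _; exact: reD.
rewrite [RHS]imD !im_cint -(rintD (cts_im gc) (cts_im hc)).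
by apply: eq_rint => t _; exact: imD.
Qed.

Lemma cintZ (k : C) (g : R -> C) (a b : R) : cts_on `[a, b] g ->
  cint (fun t => k * g t) a b = k * cint g a b.
Proof.
move=> gc; have [rgc igc] := (cts_re gc, cts_im gc).
have kc (l : R) (h : R -> R) : cts_on `[a, b] h -> cts_on `[a, b] (fun t => l * h t).
  by move=> hc; apply: ctsrM => //; exact: cts_cst.
apply: complex_ext.
  rewrite [RHS]reM re_cint re_cint im_cint -mulNr -(rintZ (re k) rgc).
  rewrite -(rintZ (- im k) igc) -(rintD (kc _ _ rgc) (kc _ _ igc)).
  by apply: eq_rint => t _; rewrite [LHS]reM mulNr.
rewrite [RHS]imM im_cint re_cint im_cint -(rintZ (re k) igc).
rewrite -(rintZ (im k) rgc) -(rintD (kc _ _ igc) (kc _ _ rgc)).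
by apply: eq_rint => t _; exact: imM.
Qed.

(** The factor 2 comes from bounding the real and imaginary parts separately. It is harmless: all
    later uses allow any absolute constant. *)
Lemma cint_bound (g : R -> C) (a b M : R) : a <= b -> cts_on `[a, b] g ->
  (forall t, a <= t <= b -> nm (g t) <= M) -> nm (cint g a b) <= 2 * M * (b - a).
Proof.
move=> ab gc gM; apply: le_trans (nm_le_re_im _) _.
rewrite re_cint im_cint -mulrA mulr2n mulrDl mul1r; apply: lerD.
  apply: rint_bound => //; [exact: cts_re|move=> t /gM; exact/le_trans/re_le_nm].
apply: rint_bound => //; [exact: cts_im|move=> t /gM; exact/le_trans/im_le_nm].
Qed.

Lemma cint1 (a b : R) : a <= b -> cint (fun=> 1) a b = rc (b - a).
Proof.
move=> ab; apply: complex_ext; rewrite ?re_cint ?im_cint /=.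
  by rewrite (@eq_rint _ (fun=> 1)) // rint_cst // mul1r.
by rewrite (@eq_rint _ (fun=> 0)) // rint_cst // mul0r.
Qed.

Lemma cint_rc (a b : R) : a <= b -> cint (@rc R) a b = rc ((b ^+ 2 - a ^+ 2) / 2).
Proof.
move=> ab; apply: complex_ext; rewrite ?re_cint ?im_cint /=.
  by rewrite (@eq_rint _ id) // rint_id.
by rewrite (@eq_rint _ (fun=> 0)) // rint_cst // mul0r.
Qed.

Lemma cint_affine (k l : C) (a b : R) : a <= b ->
  cint (fun t => k + l * rc t) a b =
  k * rc (b - a) + l * rc ((b ^+ 2 - a ^+ 2) / 2).
Proof.
move=> ab; have rcc : cts_on `[a, b] (@rc R) by move=> t _; exact: rc_continuous.
have kc (c : C) : cts_on `[a, b] (fun=> c) by exact: cts_cst.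
have lc : cts_on `[a, b] (fun t => l * rc t) by exact: ctsM (kc l) rcc.
rewrite (cintD (kc k) lc) (cintZ l rcc) cint_rc //; congr (_ + _).
by rewrite -cint1 // -(cintZ k (kc 1)); apply: eq_cint => t _; rewrite mulr1.
Qed.

End ComplexIntegral.

(** * Complex differentiability through the real-valued norm *)

Section RealDifferentiability.
Context {R : realType} {V W : normedModType (Cplx R)}.

Lemma diff_nm (F : V -> W) (x : V) : differentiable F x ->
  forall e : R, 0 < e -> exists2 d : R, 0 < d &
    forall h, nm h < d -> nm (F (x + h) - F x - 'd F x h) <= e * nm h.
Proof.
move=> /diff_locally dF e e0.
have /eqaddoP/(_ (rc e)) := dF; rewrite -{1}rc0 rc_lt => /(_ e0).
move=> /near_nmP[d d0 dP]; exists d => // h hd.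
have := dP h; rewrite subr0 => /(_ hd) /=.
by rewrite !nmE -rcM rc_le (addrC x) -addrA -opprD.
Qed.

(** The way in which differentials are produced below: [L] is a bare function, given for instance by
    an integral or by a row of partial derivatives. Linearity and the bound [K] make it a continuous
    linear map, which uniqueness of the differential identifies with ['d F x]. *)
Lemma nm_diff (F : V -> W) (L : V -> W) (x : V) (K : R) :
  (forall (a : Cplx R) u v, L (a *: u + v) = a *: L u + L v) ->
  (forall h, nm (L h) <= K * nm h) ->
  (forall e : R, 0 < e -> exists2 d : R, 0 < d &
     forall h, nm h < d -> nm (F (x + h) - F x - L h) <= e * nm h) ->
  differentiable F x /\ 'd F x = L :> (V -> W).
Proof.
move=> Ll LK FL.
pose L' : {linear V -> W} := HB.pack L (GRing.isLinear.Build _ _ _ _ L Ll).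
have Lc : continuous (L' : V -> W).
  move=> u; apply/cvg_nmP => e e0; apply/near_nmP.
  have K0 : 0 < `|K| + 1 by rewrite ltr_wpDl.
  exists (e / (`|K| + 1)) => [|y]; first by rewrite divr_gt0.
  rewrite ltr_pdivlMr // => yu.
  rewrite -[L' y - L' u](raddfB L'); apply: le_lt_trans (LK _) _.
  apply: le_lt_trans _ yu; rewrite mulrC ler_wpM2l ?nm_ge0 //.
  by apply: le_trans (ler_norm K) _; rewrite lerDl.
have Lo : F \o shift x = cst (F x) + (L' : V -> W) +o_ 0 id.
  apply/eqaddoP => _ /gt0_rc[e e0 ->].
  have [d d0 dP] := FL e e0; apply/near_nmP; exists d => // h.
  rewrite subr0 => /dP; rewrite !nmE -rcM rc_le (addrC x) -addrA -opprD.
  by [].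
have dE := diff_unique Lc Lo; split=> //.
by apply/diff_locallyP; rewrite dE.
Qed.

End RealDifferentiability.

(** * Integrals over the boundary of a rectangle *)

Section Contour.
Context {R : realType}.
Local Notation C := (Cplx R).
Local Notation re := (@complex.Re R).
Local Notation im := (@complex.Im R).
Implicit Types (f g : C -> C) (a b c d : R).

Lemma rc_nat n : rc (n%:R : R) = n%:R.
Proof. exact: (rmorph_nat (real_complex R)). Qed.

Definition pt (x y : R) : C := rc x + ic * rc y.

Lemma re_pt x y : re (pt x y) = x.
Proof. by rewrite /pt !reim mul0r mulr0 subrr addr0. Qed.
Lemma im_pt x y : im (pt x y) = y.
Proof. by rewrite /pt !reim mul0r mul1r !add0r. Qed.
Definition box a b c d : set C := [set z | a <= re z <= b /\ c <= im z <= d].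

Definition bdry a b c d : set C :=
  box a b c d `&` [set z | [\/ re z = a, re z = b, im z = c | im z = d]].

(** The anticlockwise boundary integral: bottom and right sides, minus top and left sides. *)
Definition rect_cint f a b c d : C :=
  cint (fun x => f (pt x c)) a b + ic * cint (fun y => f (pt b y)) c d
  - (cint (fun x => f (pt x d)) a b + ic * cint (fun y => f (pt a y)) c d).

Lemma cts_ptx y : continuous (pt^~ y).
Proof.
by move=> x; apply: (@continuousD _ _ _ (@rc R) (fun=> ic * rc y)); [exact: rc_continuous|exact: cst_continuous].
Qed.

Lemma cts_pty x : continuous (pt x).
Proof.
move=> y; apply: (@continuousD _ _ _ (fun=> rc x) (fun y => ic * rc y)).
  exact: cst_continuous.
by apply: (@continuousM _ _ (fun=> ic)); [exact: cst_continuous|exact: rc_continuous].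
Qed.

Lemma cts_hor f (A : set C) a b y : cts_on A f ->
  (forall x, a <= x <= b -> A (pt x y)) -> cts_on `[a, b] (fun x => f (pt x y)).
Proof.
move=> fA abA t; rewrite /= in_itv /= => /abA /fA fc.
exact: continuous_comp (@cts_ptx y t) fc.
Qed.

Lemma cts_ver f (A : set C) c d x : cts_on A f ->
  (forall y, c <= y <= d -> A (pt x y)) -> cts_on `[c, d] (fun y => f (pt x y)).
Proof.
move=> fA abA t; rewrite /= in_itv /= => /abA /fA fc.
exact: continuous_comp (@cts_pty x t) fc.
Qed.

Lemma bdry_sides a b c d (P : set C) : a <= b -> c <= d ->
  bdry a b c d `<=` P ->
  [/\ forall x, a <= x <= b -> P (pt x c), forall x, a <= x <= b -> P (pt x d),
      forall y, c <= y <= d -> P (pt a y) & forall y, c <= y <= d -> P (pt b y)].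
Proof.
move=> ab cd sP; split=> t tt; apply: sP; split; rewrite /box /mkset ?re_pt ?im_pt ?lexx //.
- by constructor 3.
- by rewrite cd.
- by constructor 4.
- by constructor 1.
- by rewrite ab.
- by constructor 2.
Qed.

Lemma eq_rect f g a b c d : a <= b -> c <= d ->
  (forall z, bdry a b c d z -> f z = g z) -> rect_cint f a b c d = rect_cint g a b c d.
Proof.
move=> ab cd fg; have [h1 h2 h3 h4] := bdry_sides ab cd fg.
by rewrite /rect_cint (eq_cint h1) (eq_cint h2) (eq_cint h3) (eq_cint h4).
Qed.

Section Linear.
Context (a b c d : R) (ab : a <= b) (cd : c <= d).
Lemma cts_sides f : cts_on (bdry a b c d) f ->
  [/\ cts_on `[a, b] (fun x => f (pt x c)), cts_on `[a, b] (fun x => f (pt x d)),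
      cts_on `[c, d] (fun y => f (pt a y)) & cts_on `[c, d] (fun y => f (pt b y))].
Proof.
have [h1 h2 h3 h4] := bdry_sides ab cd (@subset_refl _ (bdry a b c d)).
by move=> fc; split; [exact: cts_hor fc h1|exact: cts_hor fc h2|
  exact: cts_ver fc h3|exact: cts_ver fc h4].
Qed.

Lemma rectD f g : cts_on (bdry a b c d) f -> cts_on (bdry a b c d) g ->
  rect_cint (fun z => f z + g z) a b c d = rect_cint f a b c d + rect_cint g a b c d.
Proof.
move=> /cts_sides[f1 f2 f3 f4] /cts_sides[g1 g2 g3 g4].
rewrite /rect_cint (cintD f1 g1) (cintD f2 g2) (cintD f3 g3) (cintD f4 g4).
move: (cint _ _ _) (cint _ _ _) (cint _ _ _) (cint _ _ _) (cint _ _ _)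
  (cint _ _ _) (cint _ _ _) (cint _ _ _) => *; ring.
Qed.

Lemma rectZ (k : C) f : cts_on (bdry a b c d) f ->
  rect_cint (fun z => k * f z) a b c d = k * rect_cint f a b c d.
Proof.
move=> /cts_sides[f1 f2 f3 f4].
rewrite /rect_cint (cintZ k f1) (cintZ k f2) (cintZ k f3) (cintZ k f4).
move: (cint _ _ _) (cint _ _ _) (cint _ _ _) (cint _ _ _) => *; ring.
Qed.

Lemma rect_bound f (M : R) : cts_on (bdry a b c d) f ->
  (forall z, bdry a b c d z -> nm (f z) <= M) ->
  nm (rect_cint f a b c d) <= 4 * M * ((b - a) + (d - c)).
Proof.
move=> /cts_sides[f1 f2 f3 f4] fM.
have [h1 h2 h3 h4] := bdry_sides ab cd fM.
have := cint_bound ab f1 h1; have := cint_bound ab f2 h2.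
have := cint_bound cd f3 h3; have := cint_bound cd f4 h4.
move=> b4 b3 b2 b1; apply: le_trans (nmB _ _) _.
have := nmD (cint (fun x => f (pt x c)) a b) (ic * cint (fun y => f (pt b y)) c d).
have := nmD (cint (fun x => f (pt x d)) a b) (ic * cint (fun y => f (pt a y)) c d).
rewrite !nmM !nm_ic !mul1r.
move: (nm _) (nm _) (nm _) (nm _) (nm _) (nm _) b1 b2 b3 b4 => *; lra.
Qed.

End Linear.

(** Terms quadratic in the end points cancel between opposite sides. What remains is [l * ic] times
    (b - a)(c - d) from the horizontal sides and times (b - a)(d - c) from the vertical ones. *)
Lemma rect_affine (k l : C) a b c d : a <= b -> c <= d ->
  rect_cint (fun z => k + l * z) a b c d = 0.
Proof.
move=> ab cd; rewrite /rect_cint.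
have hE y : cint (fun x => k + l * pt x y) a b =
    (k + l * (ic * rc y)) * rc (b - a) + l * rc ((b ^+ 2 - a ^+ 2) / 2).
  by rewrite -cint_affine //; apply: eq_cint => t _; rewrite /pt; ring.
have vE x : cint (fun y => k + l * pt x y) c d =
    (k + l * rc x) * rc (d - c) + (l * ic) * rc ((d ^+ 2 - c ^+ 2) / 2).
  by rewrite -cint_affine //; apply: eq_cint => t _; rewrite /pt; ring.
have i2 : ic * ic = -1 :> C by exact: sqr_i.
have split2 (x y : R) : rc ((y ^+ 2 - x ^+ 2) / 2) = (rc y ^+ 2 - rc x ^+ 2) / 2.
  by rewrite rcM rcV rcB !expr2 !rcM rc_nat.
rewrite !hE !vE !split2 !rcB.
have n2 : (2 : C) != 0 by rewrite pnatr_eq0.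
move: (rc a) (rc b) (rc c) (rc d) => A B D E.
transitivity (l * (ic * ic + 1) * 0 : C); last by rewrite mulr0.
by field.
Qed.

Lemma cts_on_itvU (U : topologicalType) (g : R -> U) a m b : a <= m -> m <= b ->
  cts_on `[a, m] g -> cts_on `[m, b] g -> cts_on `[a, b] g.
Proof.
move=> am mb g1 g2 t; rewrite /= in_itv /= => /andP[at_ tb].
have [tm|mt] := leP t m.
  by apply: g1; rewrite /= in_itv /= at_.
by apply: g2; rewrite /= in_itv /= (ltW mt).
Qed.

Lemma rect_catx f a m b c d : a <= m -> m <= b -> c <= d ->
  cts_on (bdry a m c d) f -> cts_on (bdry m b c d) f ->
  rect_cint f a b c d = rect_cint f a m c d + rect_cint f m b c d.
Proof.
move=> am mb cd /(cts_sides am cd)[f1 f2 f3 f4] /(cts_sides mb cd)[g1 g2 g3 g4].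
rewrite /rect_cint (cint_cat am mb (cts_on_itvU am mb f1 g1)).
rewrite (cint_cat am mb (cts_on_itvU am mb f2 g2)).
move: (cint _ _ _) (cint _ _ _) (cint _ _ _) (cint _ _ _) (cint _ _ _)
  (cint _ _ _) (cint _ _ _) => *; ring.
Qed.

Lemma rect_caty f a b c m d : a <= b -> c <= m -> m <= d ->
  cts_on (bdry a b c m) f -> cts_on (bdry a b m d) f ->
  rect_cint f a b c d = rect_cint f a b c m + rect_cint f a b m d.
Proof.
move=> ab cm md /(cts_sides ab cm)[f1 f2 f3 f4] /(cts_sides ab md)[g1 g2 g3 g4].
rewrite /rect_cint (cint_cat cm md (cts_on_itvU cm md f3 g3)).
rewrite (cint_cat cm md (cts_on_itvU cm md f4 g4)).
move: (cint _ _ _) (cint _ _ _) (cint _ _ _) (cint _ _ _) (cint _ _ _)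
  (cint _ _ _) (cint _ _ _) => *; ring.
Qed.

End Contour.

(** * Goursat's theorem and Cauchy's formula *)

Section Goursat.
Context {R : realType}.
Local Notation C := (Cplx R).
Local Notation re := (@complex.Re R).
Local Notation im := (@complex.Im R).
Implicit Types (f g : C -> C) (a b c d : R).

Lemma diff1E f (p h : C) : 'd f p h = h * 'd f p 1.
Proof. by rewrite -{1}[h]mulr1 -[h * 1]/(h *: 1) linearZ. Qed.

Lemma differentiable_cts f (A : set C) :
  (forall z, A z -> differentiable f z) -> cts_on A f.
Proof. by move=> df z /df/differentiable_continuous. Qed.

Lemma ctsZ (k : C) (U : topologicalType) (g : U -> C) (A : set U) :
  cts_on A g -> cts_on A (fun z => k * g z).
Proof. by move=> gc; exact: (ctsM (@cts_cst _ _ A k) gc). Qed.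

Lemma box_nm a b c d z p : box a b c d z -> box a b c d p ->
  nm (z - p) <= (b - a) + (d - c).
Proof.
move=> [/andP[h1 h2] /andP[h3 h4]] [/andP[k1 k2] /andP[k3 k4]].
apply: le_trans (nm_le_re_im _) _.
by apply: lerD; rewrite ?(reD, imD) ?(reN, imN) ler_norml; apply/andP; split; lra.
Qed.

(** The affine part of [f] at [p] integrates to 0. On the boundary the remainder is at most [e / 4]
    times the semiperimeter, and [rect_bound] contributes the factor 4 and another semiperimeter. *)
Lemma goursat_local f (p : C) : differentiable f p -> forall e : R, 0 < e ->
  exists2 del, 0 < del & forall a b c d, a <= b -> c <= d -> box a b c d p ->
    (b - a) + (d - c) < del -> cts_on (bdry a b c d) f ->
    nm (rect_cint f a b c d) <= e * ((b - a) + (d - c)) ^+ 2.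
Proof.
move=> df e e0; have e4 : 0 < e / 4 by rewrite divr_gt0.
have [del d0 dP] := diff_nm df e4; exists del => // a b c d ab cd bp sd fc.
pose l := 'd f p 1; pose k := f p - l * p.
pose aff := fun z : C => k + l * z; pose rem := fun z : C => f z + -1 * aff z.
have ac : cts_on (bdry a b c d) aff.
  apply: (@ctsD _ _ _ (fun=> k) (fun z => l * z)); first exact: cts_cst.
  by apply: ctsZ => t _; exact: cvg_id.
have nac : cts_on (bdry a b c d) (fun z => -1 * aff z).
  exact: ctsZ ac.
have rc : cts_on (bdry a b c d) rem by exact: ctsD fc nac.
have -> : rect_cint f a b c d = rect_cint rem a b c d.
  rewrite (rectD ab cd fc nac) (rectZ ab cd (-1) ac) rect_affine //.
  by rewrite mulr0 addr0.
set s := _ + _ in sd *.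
have s0 : 0 <= s by rewrite /s; lra.
have -> : e * s ^+ 2 = 4 * (e / 4 * s) * s by field.
apply: rect_bound => // z [bz _].
have e1 : p + (z - p) = z by rewrite addrC subrK.
have zP := dP (z - p); rewrite e1 in zP.
have zs := box_nm bz bp.
have -> : rem z = f z - f p - 'd f p (z - p).
  by rewrite diff1E -/l /rem /aff /k; ring.
apply: le_trans (zP (le_lt_trans zs sd)) _.
by rewrite ler_wpM2l // ltW.
Qed.

Lemma sub_bdry a b c d a' b' c' d' : a <= a' -> b' <= b -> c <= c' -> d' <= d ->
  bdry a' b' c' d' `<=` box a b c d.
Proof.
move=> h1 h2 h3 h4 z [[/andP[k1 k2] /andP[k3 k4]] _].
by split; apply/andP; split; lra.
Qed.

(** Compactness of the rectangle in the form that Goursat's argument needs: were [P] to fail, it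
    would fail on a nested sequence of quarters shrinking to a point, against the local hypothesis
    there. A rectangle is given by its corner, width and height, so that passing to a quarter halves
    the last two parameters. *)
Lemma quadrisection (P : R -> R -> R -> R -> Prop) a b c d : a <= b -> c <= d ->
  (forall x y w h, 0 <= w -> 0 <= h -> a <= x -> x + w <= b -> c <= y -> y + h <= d ->
     P x y (w / 2) (h / 2) -> P (x + w / 2) y (w / 2) (h / 2) ->
     P x (y + h / 2) (w / 2) (h / 2) -> P (x + w / 2) (y + h / 2) (w / 2) (h / 2) ->
     P x y w h) ->
  (forall p, box a b c d p -> exists2 del, 0 < del &
     forall x y w h, 0 <= w -> 0 <= h -> a <= x -> x + w <= b -> c <= y -> y + h <= d ->
       box x (x + w) y (y + h) p -> w + h < del -> P x y w h) ->
  P a c (b - a) (d - c).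
Proof.
move=> ab cd step loc; apply: contrapT => nP.
pose w k : R := (b - a) / 2 ^+ k; pose h k : R := (d - c) / 2 ^+ k.
have w0 k : 0 <= w k by rewrite divr_ge0 ?subr_ge0 ?exprn_ge0.
have h0 k : 0 <= h k by rewrite divr_ge0 ?subr_ge0 ?exprn_ge0.
have wS k : w k.+1 = w k / 2 by rewrite /w exprSr invfM mulrA.
have hS k : h k.+1 = h k / 2 by rewrite /h exprSr invfM mulrA.
pose Q k (q : R * R) := [/\ a <= q.1, q.1 + w k <= b, c <= q.2, q.2 + h k <= d
  & ~ P q.1 q.2 (w k) (h k)].
have next (kq : nat * (R * R)) : exists q' : R * R, Q kq.1 kq.2 ->
    [/\ Q kq.1.+1 q', kq.2.1 <= q'.1 <= kq.2.1 + w kq.1.+1 &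
        kq.2.2 <= q'.2 <= kq.2.2 + h kq.1.+1].
  case: kq => k [x y] /=; apply: contrapT => /forallNP nq.
  have [Qk] : Q k (x, y) /\ True.
    by split=> //; apply: contrapT => nQ; apply: (nq (x, y)).
  case: (Qk) => /= h1 h2 h3 h4 h5 _; apply: h5.
  have [wk hk] := (w0 k, h0 k).
  have main (x' y' : R) : x <= x' <= x + w k / 2 -> y <= y' <= y + h k / 2 ->
      P x' y' (w k / 2) (h k / 2).
    move=> xx yy; apply: contrapT => nP'; apply: (nq (x', y')) => _ /=.
    rewrite wS hS; split=> //; rewrite /Q /= wS hS.
    by move: xx yy => /andP[? ?] /andP[? ?]; split=> //; lra.
  by apply: step => //; apply: main; apply/andP; split; lra.
have [nx nxP] := choice next.
pose u := fix u k := if k is k'.+1 then nx (k', u k') else (a, c).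
have uQ k : Q k (u k).
  elim: k => [|k IH]; last by have [] := nxP (k, u k) IH.
  by rewrite /Q /= /w /h expr0 !divr1; split=> //; lra.
have u1 k : (u k).1 <= (u k.+1).1 <= (u k).1 + w k.+1 by have [] := nxP (k, u k) (uQ k).
have u2 k : (u k).2 <= (u k.+1).2 <= (u k).2 + h k.+1 by have [] := nxP (k, u k) (uQ k).
(* Nested intervals, one coordinate at a time: left ends increase, right ends decrease, and the
   supremum of the left ends lies in every interval. *)
have nest (v : nat -> R) (s : nat -> R) (m M : R) : (forall k, 0 <= s k) ->
    (forall k, s k.+1 = s k / 2) -> (forall k, m <= v k <= M) ->
    (forall k, v k <= v k.+1 <= v k + s k.+1) ->
    exists X, forall k, v k <= X <= v k + s k.
  move=> s0 sS vM vs.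
  have mono k j : v k <= v (k + j)%N /\ v (k + j)%N + s (k + j)%N <= v k + s k.
    elim: j => [|j [IH1 IH2]]; first by rewrite addn0 !lexx.
    rewrite addnS; have /andP[? ?] := vs (k + j)%N; have := sS (k + j)%N.
    by split; lra.
  have cross k j : v j <= v k + s k.
    have [kj|/ltnW jk] := leqP k j.
      have := mono k (j - k)%N; rewrite subnKC // => -[_].
      by apply: le_trans; rewrite lerDl.
    have := mono j (k - j)%N; rewrite subnKC // => -[+ _] => /le_trans; apply.
    by rewrite lerDl.
  exists (sup (range v)) => k; apply/andP; split.
    apply: ub_le_sup; last by exists k.
    by exists M => _ [j _ <-]; case/andP: (vM j).
  by apply: ge_sup; [exists (v 0%N), 0%N|move=> _ [j _ <-]].
have [X XP] := nest (fun k => (u k).1) w a b w0 wS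
  (fun k => let: And5 q1 q2 _ _ _ := uQ k in
     introT andP (conj q1 (le_trans (ler_wpDr (w0 k) (lexx _)) q2))) u1.
have [Y YP] := nest (fun k => (u k).2) h c d h0 hS
  (fun k => let: And5 _ _ q1 q2 _ := uQ k in
     introT andP (conj q1 (le_trans (ler_wpDr (h0 k) (lexx _)) q2))) u2.
have pb : box a b c d (pt X Y).
  have [q1 q2 q3 q4 _] := uQ 0%N; have := XP 0%N; have := YP 0%N.
  by rewrite /box /mkset re_pt im_pt => /andP[? ?] /andP[? ?];
    split; apply/andP; split; lra.
have [del del0 delP] := loc _ pb.
have [k kP] : exists k, w k + h k < del.
  have s0 : 0 <= (b - a) + (d - c) by lra.
  (* This exponent k satisfies (total size) / [del] < k <= 2 ^ k. *)
  exists (Num.truncn (((b - a) + (d - c)) / del)).+1; set k := Num.truncn _.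
  rewrite /w /h -mulrDl ltr_pdivrMr ?exprn_gt0 // mulrC -ltr_pdivrMr //.
  have := truncnS_gt (((b - a) + (d - c)) / del); rewrite -/k => /lt_le_trans; apply.
  by rewrite -natrX ler_nat ltnW // ltn_expl.
have [q1 q2 q3 q4 q5] := uQ k; apply: q5; apply: delP => //.
by rewrite /box /mkset re_pt im_pt.
Qed.

(** The bound e (w + h)^2 passes from quarters to the whole with no loss, because each quarter is
    allowed exactly a fourth of it and the inner sides cancel. Near every point it holds by
    [goursat_local]; finally e tends to 0. *)
Theorem goursat f a b c d : a <= b -> c <= d ->
  (forall z, box a b c d z -> differentiable f z) -> rect_cint f a b c d = 0.
Proof.
move=> ab cd df; have fc := differentiable_cts df.
have sub x x' y y' : a <= x -> x' <= b -> c <= y -> y' <= d ->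
    cts_on (bdry x x' y y') f.
  by move=> h1 h2 h3 h4 z /(sub_bdry h1 h2 h3 h4)/fc.
apply/eqP; rewrite -nm_eq0; apply/eqP/le_anti; rewrite nm_ge0 andbT.
have s0 : 0 <= (b - a) + (d - c) by lra.
suff H e : 0 < e -> nm (rect_cint f a b c d) <= e * ((b - a) + (d - c)) ^+ 2.
  apply/ler_addgt0Pr => e e0; rewrite add0r.
  have K0 : 0 < ((b - a) + (d - c)) ^+ 2 + 1 by rewrite ltr_wpDl // sqr_ge0.
  have := H (e / (((b - a) + (d - c)) ^+ 2 + 1)) (divr_gt0 e0 K0).
  move=> /le_trans; apply; rewrite mulrAC ler_pdivrMr // ler_wpM2l ?ltW //.
  by rewrite ltrDl.
move=> e0.
pose P x y w h : Prop := nm (rect_cint f x (x + w) y (y + h)) <= e * (w + h) ^+ 2.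
have kE (x y : R) : x + (y - x) = y by rewrite addrC subrK.
suff : P a c (b - a) (d - c) by rewrite /P (kE a b) (kE c d).
apply: (@quadrisection P) => //.
- move=> x y w h w0 h0 ax xb cy yd; rewrite /P.
  have [l1 l2 l3 l4] : [/\ x <= x + w / 2, x + w / 2 <= x + w, y <= y + h / 2
    & y + h / 2 <= y + h] by clear -w0 h0; split; lra.
  have [l5 l6 l7 l8] : [/\ a <= x + w / 2, x + w / 2 <= b, c <= y + h / 2
    & y + h / 2 <= d] by clear -w0 h0 ax xb cy yd; split; lra.
  have ew : x + w = x + w / 2 + w / 2 by field.
  have eh : y + h = y + h / 2 + h / 2 by field.
  rewrite -ew -eh => p1 p2 p3 p4.
  have l9 := le_trans l3 l4.
  rewrite (rect_catx l1 l2 l9 (sub _ _ _ _ ax l6 cy yd) (sub _ _ _ _ l5 xb cy yd)).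
  rewrite (rect_caty l1 l3 l4 (sub _ _ _ _ ax l6 cy l8) (sub _ _ _ _ ax l6 l7 yd)).
  rewrite (rect_caty l2 l3 l4 (sub _ _ _ _ l5 xb cy l8) (sub _ _ _ _ l5 xb l7 yd)).
  have -> : e * (w + h) ^+ 2 = e * (w / 2 + h / 2) ^+ 2 + e * (w / 2 + h / 2) ^+ 2
     + (e * (w / 2 + h / 2) ^+ 2 + e * (w / 2 + h / 2) ^+ 2) by field.
  apply: le_trans (nmD _ _) _; apply: lerD; apply: le_trans (nmD _ _) _;
    exact: lerD.
- move=> p bp; have [del d0 dP] := goursat_local (df p bp) e0.
  exists del => // x y w h w0 h0 ax xb cy yd bxp wh.
  have dE (s t : R) : s + t - s = t by rewrite addrC addKr.
  have := dP x (x + w) y (y + h); rewrite (dE x w) (dE y h).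
  by apply=> //; [lra|lra|exact: sub].
Qed.

End Goursat.

(** * Removable singularities and Cauchy's formula on a square *)

Section Cauchy.
Context {R : realType}.
Local Notation C := (Cplx R).
Local Notation re := (@complex.Re R).
Local Notation im := (@complex.Im R).
Implicit Types (f g : C -> C) (a b c d r : R).

(** By Goursat the integral equals the one over an arbitrarily small square around [p], where [f] is
    bounded by [M] and the length of the contour tends to 0. Nothing is assumed about [f] at [p]
    itself, since no contour in the argument meets [p]. *)
Lemma rect_punctured f (p : C) a b c d (M del : R) : 0 < del ->
  a < re p < b -> c < im p < d ->
  (forall z, box a b c d z -> z != p -> differentiable f z) ->
  (forall z, z != p -> nm (z - p) < del -> nm (f z) <= M) ->
  rect_cint f a b c d = 0.
Proof.
move=> del0 /andP[ap pb] /andP[cp pd] df fM.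
apply/eqP; rewrite -nm_eq0; apply/eqP/le_anti; rewrite nm_ge0 andbT.
pose x := re p; pose y := im p.
(* The square of half-side [s <= s0] stays inside the rectangle. The bound [del / 8] keeps it within
   [del] of [p], because [box_nm] measures it by 4 s. *)
pose s0 := Num.min (Num.min (Num.min (x - a) (b - x)) (Num.min (y - c) (d - y))) (del / 8).
have s00 : 0 < s0 by rewrite !lt_min !subr_gt0 ap pb cp pd divr_gt0.
suff H s : 0 < s -> s <= s0 -> nm (rect_cint f a b c d) <= 16 * M * s.
  apply/ler_addgt0Pr => e e0; rewrite add0r.
  have K0 : 0 < 16 * `|M| + 1 by rewrite ltr_wpDl // mulr_ge0.
  pose s := Num.min s0 (e / (16 * `|M| + 1)).
  have s1 : 0 < s by rewrite lt_min s00 divr_gt0.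
  have s2 : s <= s0 by rewrite ge_min lexx.
  have s3 : s <= e / (16 * `|M| + 1) by rewrite ge_min lexx orbT.
  apply: le_trans (H s s1 s2) _; move: s3; rewrite ler_pdivlMr // => s3.
  apply: le_trans _ s3; rewrite mulrC ler_wpM2l ?ltW //.
  by have := ler_norm M; lra.
move=> s1; rewrite !le_min -!andbA => /and5P[sa sb sc sd sdel].
have [l1 l2 l3 l4] : [/\ a <= x - s, x - s <= x + s, x + s <= b & x - s <= b].
  by clear -s1 sa sb; split; lra.
have [l5 l6 l7 l8] : [/\ c <= y - s, y - s <= y + s, y + s <= d & y - s <= d].
  by clear -s1 sc sd; split; lra.
have cd : c <= d by exact: le_trans l5 l8.
have sub x1 x2 y1 y2 z : a <= x1 -> x2 <= b -> c <= y1 -> y2 <= d ->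
    box x1 x2 y1 y2 z -> box a b c d z.
  move=> h1 h2 h3 h4 [/andP[k1 k2] /andP[k3 k4]].
  by split; rewrite ?(le_trans h1 k1) ?(le_trans k2 h2) ?(le_trans h3 k3) ?(le_trans k4 h4).
have out x1 x2 y1 y2 : a <= x1 -> x2 <= b -> c <= y1 -> y2 <= d ->
    [\/ x2 < x, x < x1, y2 < y | y < y1] ->
    forall z, box x1 x2 y1 y2 z -> differentiable f z.
  move=> h1 h2 h3 h4 hp z bz; apply: df; first exact: sub bz.
  apply/eqP => zp; move: bz; rewrite zp => -[/andP[k1 k2] /andP[k3 k4]].
  by case: hp => [/(le_lt_trans k2)|/lt_le_trans/(_ k1)|/(le_lt_trans k4)|/lt_le_trans/(_ k3)];
    rewrite ltxx.
have xs1 : x - s < x by rewrite ltrBlDr ltrDl.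
have xs2 : x < x + s by rewrite ltrDl.
have ys1 : y - s < y by rewrite ltrBlDr ltrDl.
have ys2 : y < y + s by rewrite ltrDl.
(* The full-height strips to the left and to the right of the small square, then the pieces below
   and above it in the middle strip: none contains [p]. *)
have dL := out a (x - s) c d (lexx _) l4 (lexx _) (lexx _) (Or41 _ _ _ xs1).
have dR := out (x + s) b c d (le_trans l1 l2) (lexx _) (lexx _) (lexx _) (Or42 _ _ _ xs2).
have dB := out (x - s) (x + s) c (y - s) l1 l3 (lexx _) l8 (Or43 _ _ _ ys1).
have dT := out (x - s) (x + s) (y + s) d l1 l3 (le_trans l5 l6) (lexx _) (Or44 _ _ _ ys2).
have bdryS (x1 x2 y1 y2 : R) (z : C) : bdry x1 x2 y1 y2 z -> box x1 x2 y1 y2 z by case.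
have cL : cts_on (bdry a (x - s) c d) f by apply: differentiable_cts => z /bdryS/dL.
have cR : cts_on (bdry (x + s) b c d) f by apply: differentiable_cts => z /bdryS/dR.
have cB : cts_on (bdry (x - s) (x + s) c (y - s)) f
  by apply: differentiable_cts => z /bdryS/dB.
have cT : cts_on (bdry (x - s) (x + s) (y + s) d) f
  by apply: differentiable_cts => z /bdryS/dT.
have neq x1 x2 y1 y2 z : x1 != x -> x2 != x -> y1 != y -> y2 != y ->
    bdry x1 x2 y1 y2 z -> z != p.
  move=> h1 h2 h3 h4 [_ hz]; apply/eqP => zp; move: hz; rewrite zp.
  by case=> e; [move: h1|move: h2|move: h3|move: h4]; rewrite -e eqxx.
have [n1 n2 n3 n4] : [/\ x - s != x, x + s != x, y - s != y & y + s != y].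
  by rewrite !(lt_eqF xs1, gt_eqF xs2, lt_eqF ys1, gt_eqF ys2).
have [m1 m2 m3 m4] : [/\ a != x, b != x, c != y & d != y].
  by rewrite !(lt_eqF ap, gt_eqF pb, lt_eqF cp, gt_eqF pd).
have cM : cts_on (bdry (x - s) (x + s) c d) f.
  apply: differentiable_cts => z bz; apply: df; last exact: neq bz.
  exact: sub (bdryS _ _ _ _ _ bz).
have cM2 : cts_on (bdry (x - s) (x + s) (y - s) d) f.
  apply: differentiable_cts => z bz; apply: df; last exact: neq bz.
  exact: sub (bdryS _ _ _ _ _ bz).
have cRR : cts_on (bdry (x - s) b c d) f.
  apply: differentiable_cts => z bz; apply: df; last exact: neq bz.
  exact: sub (bdryS _ _ _ _ _ bz).
have cS : cts_on (bdry (x - s) (x + s) (y - s) (y + s)) f.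
  apply: differentiable_cts => z bz; apply: df; last exact: neq bz.
  exact: sub (bdryS _ _ _ _ _ bz).
rewrite (rect_catx l1 l4 cd cL cRR) (goursat l1 cd dL) add0r.
rewrite (rect_catx l2 l3 cd cM cR) (goursat l3 cd dR) addr0.
rewrite (rect_caty l2 l5 l8 cB cM2) (goursat l2 l5 dB) add0r.
rewrite (rect_caty l2 l6 l7 cS cT) (goursat l2 l7 dT) addr0.
have -> : 16 * M * s = 4 * M * ((x + s - (x - s)) + (y + s - (y - s))) by ring.
apply: rect_bound => // z bz; apply: fM; first exact: neq bz.
have bp : box (x - s) (x + s) (y - s) (y + s) p.
  by split; rewrite /= !(ltW xs1, ltW xs2, ltW ys1, ltW ys2).
apply: le_lt_trans (box_nm (bdryS _ _ _ _ _ bz) bp) _.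
by clear -sdel s1 del0; lra.
Qed.

(** Squares centred at 0 take the place of discs. A square of half-side [r] contains the disc of
    radius [r] ([nm_sq]) and lies in the one of radius 2 r ([sq_le]). *)
Definition sq r : set C := box (- r) r (- r) r.
Definition sqb r : set C := bdry (- r) r (- r) r.
Definition circ r f : C := rect_cint f (- r) r (- r) r.

Lemma sqP r z : sq r z <-> `|re z| <= r /\ `|im z| <= r.
Proof. by rewrite /sq /box /mkset -!ler_norml. Qed.

Lemma sqb_ge r z : sqb r z -> r <= nm z.
Proof.
case=> _ hz; have [e|e] : `|re z| = `|r| \/ `|im z| = `|r|.
  by case: hz => ->; rewrite ?normrN; [left|left|right|right].
  by apply: le_trans _ (re_le_nm z); rewrite e ler_norm.
by apply: le_trans _ (im_le_nm z); rewrite e ler_norm.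
Qed.

Lemma sq_le r z : sq r z -> nm z <= 2 * r.
Proof. by move=> /sqP[h1 h2]; apply: le_trans (nm_le_re_im z) _; lra. Qed.

Lemma sqb_sq r z : sqb r z -> sq r z. Proof. by case. Qed.

Lemma nm_sq r z : nm z <= r -> sq r z.
Proof.
by move=> zr; apply/sqP; split; [exact: le_trans (re_le_nm z) zr|exact: le_trans (im_le_nm z) zr].
Qed.

Lemma sqb_dist r z h : sqb r z -> nm h <= r / 2 -> r / 2 <= nm (z - h).
Proof.
move=> /sqb_ge rz hr; have := nmD (z - h) h; rewrite subrK; lra.
Qed.

Lemma circD r f g : 0 <= r -> cts_on (sqb r) f -> cts_on (sqb r) g ->
  circ r (fun z => f z + g z) = circ r f + circ r g.
Proof. by move=> r0; apply: rectD; lra. Qed.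

Lemma circZ r k f : 0 <= r -> cts_on (sqb r) f ->
  circ r (fun z => k * f z) = k * circ r f.
Proof. by move=> r0; apply: rectZ; lra. Qed.

Lemma circ_bound r f (M : R) : 0 <= r -> cts_on (sqb r) f ->
  (forall z, sqb r z -> nm (f z) <= M) -> nm (circ r f) <= 16 * M * r.
Proof.
move=> r0 fc fM; have -> : 16 * M * r = 4 * M * ((r - - r) + (r - - r)) by ring.
by apply: rect_bound => //; lra.
Qed.

Lemma eq_circ r f g : 0 <= r -> (forall z, sqb r z -> f z = g z) ->
  circ r f = circ r g.
Proof. by move=> r0; apply: eq_rect; lra. Qed.

Lemma differentiable_inv (p z : C) : z != p -> differentiable (fun z => (z - p)^-1) z.
Proof.
move=> zp; apply: (@differentiableV _ _ (fun z => z - p)); last by rewrite subr_eq0.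
by apply: differentiableB.
Qed.

Lemma cts_sqb_inv r h : 0 < r -> nm h <= r / 2 -> cts_on (sqb r) (fun z => (z - h)^-1).
Proof.
move=> r0 hr; apply: differentiable_cts => z bz; apply: differentiable_inv.
rewrite -subr_eq0 -nm_gt0; apply: lt_le_trans (sqb_dist bz hr); lra.
Qed.

(** The quotient (f z - f h) / (z - h) is bounded near [h] by |f'(h)| + 1, so its integral vanishes
    by [rect_punctured]. The integral of the kernel stays as a factor in place of 2 pi i. *)
Lemma cauchy f r (h : C) : 0 < r -> nm h <= r / 2 ->
  (forall z, sq r z -> differentiable f z) ->
  circ r (fun z => (z - h)^-1) * f h = circ r (fun z => f z / (z - h)).
Proof.
move=> r0 hr df.
have kc := cts_sqb_inv r0 hr.
have fc : cts_on (sqb r) f by apply: differentiable_cts => z /sqb_sq/df.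
have fkc : cts_on (sqb r) (fun z => f z / (z - h)) by exact: ctsM fc kc.
apply/eqP; rewrite -subr_eq0 -oppr_eq0 opprB; apply/eqP.
have r0' := ltW r0; have nkc := @ctsZ _ (- f h) _ _ _ kc.
rewrite [_ * f h]mulrC -mulNr -(circZ (- f h) r0' kc) -(circD r0' fkc nkc).
have hin : `|re h| < r /\ `|im h| < r.
  by split; [apply: le_lt_trans (re_le_nm h) _|apply: le_lt_trans (im_le_nm h) _]; lra.
have hsq : sq r h by apply: nm_sq; lra.
have [del del0 dP] := diff_nm (df h hsq) ltr01.
apply: (@rect_punctured _ h _ _ _ _ (nm ('d f h 1) + 1) del).
- exact: del0.
- by rewrite -ltr_norml; case: hin.
- by rewrite -ltr_norml; case: hin.
- move=> z bz zh; apply: differentiableD.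
    by apply: differentiableM; [exact: df|exact: differentiable_inv].
  by apply: differentiableM => //; exact: differentiable_inv.
move=> z zh zd; have zh0 : z - h != 0 by rewrite subr_eq0.
have e1 : h + (z - h) = z by rewrite addrC subrK.
have zP := dP (z - h) zd; rewrite e1 mul1r (diff1E f h (z - h)) in zP.
have -> : f z / (z - h) + - f h * (z - h)^-1 =
   (f z - f h - (z - h) * 'd f h 1) * (z - h)^-1 + 'd f h 1 by field.
apply: le_trans (nmD _ _) _; rewrite addrC; apply: lerD; first exact: lexx.
by rewrite nmM nmV ler_pdivrMr ?nm_gt0 // mul1r.
Qed.

End Cauchy.

(** * Lower bound for the Cauchy kernel and estimates for the derivative *)

Section CauchyEstimates.
Context {R : realType}.
Local Notation C := (Cplx R).
Local Notation re := (@complex.Re R).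
Local Notation im := (@complex.Im R).
Implicit Types (f g : C -> C) (a b c d r : R).

Lemma re_cint_ge (g : R -> C) a b (m : R) : a <= b -> cts_on `[a, b] g ->
  (forall t, a <= t <= b -> m <= re (g t)) -> m * (b - a) <= re (cint g a b).
Proof.
move=> ab gc gm; rewrite re_cint -rint_cst //.
by apply: rint_le => //; [exact: cts_cst|exact: cts_re].
Qed.

Lemma im_cint_ge (g : R -> C) a b (m : R) : a <= b -> cts_on `[a, b] g ->
  (forall t, a <= t <= b -> m <= im (g t)) -> m * (b - a) <= im (cint g a b).
Proof.
move=> ab gc gm; rewrite im_cint -rint_cst //.
by apply: rint_le => //; [exact: cts_cst|exact: cts_im].
Qed.

Lemma re_inv (z : C) : re z^-1 = re z / (re z ^+ 2 + im z ^+ 2).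
Proof. by case: z. Qed.

Lemma im_inv (z : C) : im z^-1 = - im z / (re z ^+ 2 + im z ^+ 2).
Proof. by case: z => a b; rewrite mulNr. Qed.

(** [A] is the distance from the pole to the line of a side, [B] the offset along that side. The
    bound is (r / 2) / (9 r^2 / 2), from A >= r / 2 and A^2 + B^2 <= 9 r^2 / 2. *)
Lemma kernel_side (A B r : R) : 0 < r -> r / 2 <= A <= 3 * r / 2 ->
  `|B| <= 3 * r / 2 -> (9 * r)^-1 <= A / (A ^+ 2 + B ^+ 2).
Proof.
move=> r0 /andP[A1 A2] BB.
have A0 : 0 < A by apply: lt_le_trans A1; rewrite divr_gt0.
have AA : A ^+ 2 <= (3 * r / 2) ^+ 2 by rewrite ler_sqr ?nnegrE // ?(ltW A0) // (le_trans (ltW A0)).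
have B2 : B ^+ 2 <= (3 * r / 2) ^+ 2.
  rewrite -[B ^+ 2]real_normK ?num_real // ler_sqr ?nnegrE //.
  exact: le_trans (ltW A0) A2.
have n0 : 0 < A ^+ 2 + B ^+ 2 by rewrite ltr_pwDl ?sqr_ge0 ?exprn_gt0.
rewrite ler_pdivlMr // mulrC ler_pdivrMr ?mulr_gt0 //.
apply: le_trans (_ : A ^+ 2 + B ^+ 2 <= 9 * r ^+ 2 / 2) _.
  by apply: le_trans (lerD AA B2) _; rewrite le_eqVlt; apply/orP; left; apply/eqP; field.
rewrite -subr_ge0.
have -> : A * (9 * r) - 9 * r ^+ 2 / 2 = 9 * r * (A - r / 2) by field.
by rewrite !mulr_ge0 ?subr_ge0 // ltW.
Qed.

Lemma kernel_dist (r p q t : R) : 0 < r -> `|p| <= r / 2 -> `|q| <= r / 2 ->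
  - r <= t <= r -> (9 * r)^-1 <= (r + p) / ((r + p) ^+ 2 + (t - q) ^+ 2).
Proof.
move=> r0 /ler_normlP[p1 p2] /ler_normlP[q1 q2] /andP[t1 t2].
by apply: kernel_side => //; [apply/andP|apply/ler_normlP]; split; lra.
Qed.

Lemma im_contour (x y z w : C) :
  im (x + ic * y - (z + ic * w)) = im x + re y - im z - re w.
Proof. by case: x y z w => [? ?] [? ?] [? ?] [? ?] /=; ring. Qed.

(** A substitute for the value 2 pi i: each of the four sides adds to the imaginary part at least
    its length 2 r times 1 / (9 r), hence 8 / 9 in all. *)
Lemma circ_kernel_ge r (h : C) : 0 < r -> nm h <= r / 2 ->
  1 / 2 <= nm (circ r (fun z => (z - h)^-1)).
Proof.
move=> r0 hr; have rr : - r <= r by clear -r0; lra.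
have h1 := le_trans (re_le_nm h) hr; have h2 := le_trans (im_le_nm h) hr.
have h1' : `|- re h| <= r / 2 by rewrite normrN.
have h2' : `|- im h| <= r / 2 by rewrite normrN.
apply: le_trans (le_trans (ler_norm _) (im_le_nm _)).
have [b1 b2 b3 b4] := cts_sides rr rr (cts_sqb_inv r0 hr).
rewrite im_contour.
have k9 : (9 * r)^-1 * (r - - r) = 2 / 9 by field; rewrite gt_eqF.
have B1 : 2 / 9 <= im (cint (fun x => (pt x (- r) - h)^-1) (- r) r).
  rewrite -k9; apply: (im_cint_ge rr b1) => t tr.
  rewrite im_inv reD imD reN imN re_pt im_pt -opprD opprK sqrrN.
  by rewrite [X in _ / X]addrC; exact: kernel_dist.
have B2 : 2 / 9 <= - im (cint (fun x => (pt x r - h)^-1) (- r) r).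
  have e2 := cintZ (-1) b2; rewrite mulN1r in e2.
  rewrite -k9 -imN -e2; apply: (im_cint_ge rr (@ctsZ _ (-1) _ _ _ b2)) => t tr.
  rewrite mulN1r imN im_inv reD imD reN imN re_pt im_pt -mulNr opprK.
  by rewrite [X in _ / X]addrC; exact: kernel_dist.
have B3 : 2 / 9 <= re (cint (fun y => (pt r y - h)^-1) (- r) r).
  rewrite -k9; apply: (re_cint_ge rr b4) => t tr.
  by rewrite re_inv reD imD reN imN re_pt im_pt; exact: kernel_dist.
have B4 : 2 / 9 <= - re (cint (fun y => (pt (- r) y - h)^-1) (- r) r).
  have e3 := cintZ (-1) b3; rewrite mulN1r in e3.
  rewrite -k9 -reN -e3; apply: (re_cint_ge rr (@ctsZ _ (-1) _ _ _ b3)) => t tr.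
  rewrite mulN1r reN re_inv reD imD reN imN re_pt im_pt -mulNr -opprD opprK sqrrN.
  exact: kernel_dist.
move: (im _) (im _) (re _) (re _) B1 B2 B3 B4 => x y z w; clear; lra.
Qed.

(* Cauchy's formula for f'(0), with 2 pi i as the integral of 1 / z. *)
Definition dcirc r f : C :=
  circ r (fun z => (f z - f 0) * (z^-1 * z^-1)) / circ r (fun z => z^-1).

Lemma circ_inv_ge r : 0 < r -> 1 / 2 <= nm (circ r (fun z => z^-1)).
Proof.
move=> r0; have := @circ_kernel_ge r 0 r0; rewrite nm0 => /(_ _)/le_trans; apply.
  by lra.
by rewrite le_eqVlt; apply/orP; left; apply/eqP; congr (nm _); apply: eq_circ => [|z _]; rewrite ?subr0 // ltW.
Qed.

Lemma circ_inv_neq0 r : 0 < r -> circ r (fun z => z^-1) != 0.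
Proof. by move=> r0; rewrite -nm_gt0; have := circ_inv_ge r0; lra. Qed.

Lemma cts_sqb_V r : 0 < r -> cts_on (sqb r) (fun z : C => z^-1).
Proof.
move=> r0; apply: differentiable_cts => z bz.
apply: (@differentiableV _ _ id); first by [].
by rewrite -nm_gt0; apply: lt_le_trans r0 (sqb_ge bz).
Qed.

Lemma cts_quot r f : 0 < r -> cts_on (sqb r) f ->
  cts_on (sqb r) (fun z => (f z - f 0) * (z^-1 * z^-1)).
Proof.
move=> r0 fc; apply: ctsM; last by apply: ctsM; exact: cts_sqb_V.
exact: ctsD fc (@cts_cst _ _ _ (- f 0)).
Qed.

Lemma dcirc_lin r f g (k : C) : 0 < r -> cts_on (sqb r) f -> cts_on (sqb r) g ->
  dcirc r (fun z => k * f z + g z) = k * dcirc r f + dcirc r g.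
Proof.
move=> r0 fc gc; rewrite /dcirc mulrA -mulrDl; congr (_ / _).
have [fq gq] := (cts_quot r0 fc, cts_quot r0 gc).
have kfq := @ctsZ _ k _ _ _ fq.
rewrite -(circZ k (ltW r0) fq) -(circD (ltW r0) kfq gq).
apply: eq_circ; first exact: ltW.
by move=> z _; ring.
Qed.

(** On the contour |z|^-2 <= r^-2. The constant 32 is the 16 of [circ_bound] divided by the lower
    bound 1/2 for the denominator of [dcirc]. *)
Lemma dcirc_bound r f (M : R) : 0 < r -> cts_on (sqb r) f ->
  (forall z, sqb r z -> nm (f z - f 0) <= M) -> nm (dcirc r f) <= 32 * M / r.
Proof.
move=> r0 fc fM; rewrite /dcirc nmM nmV.
have c0 := circ_inv_ge r0; have c1 : 0 < nm (circ r (fun z => z^-1)) by lra.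
rewrite ler_pdivrMr //.
have M0 : 0 <= M.
  apply: le_trans (fM (pt r r) _); first exact: nm_ge0.
  by split; [rewrite /box /mkset re_pt im_pt; split; lra|rewrite /mkset re_pt; constructor 2].
apply: le_trans (_ : 16 * (M / r ^+ 2) * r <= _).
  apply: circ_bound; [exact: ltW|exact: cts_quot|].
  move=> z bz; rewrite nmM nmM !nmV; apply: ler_pM; rewrite ?nm_ge0 //.
  - by rewrite -invfM invr_ge0 mulr_ge0 // nm_ge0.
  - exact: fM.
  rewrite -invfM lef_pV2 ?posrE ?exprn_gt0 // -?expr2.
  - by rewrite ler_sqr ?nnegrE ?nm_ge0 ?(ltW r0) // sqb_ge.
  - by rewrite exprn_gt0 // (lt_le_trans r0) // sqb_ge.
have -> : 16 * (M / r ^+ 2) * r = 32 * M / r * (1 / 2) by field; rewrite gt_eqF.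
by rewrite ler_wpM2l // divr_ge0 ?mulr_ge0 // ltW.
Qed.

End CauchyEstimates.

(** * First-order Taylor expansion with a quadratic remainder *)

Section CauchyTaylor.
Context {R : realType}.
Local Notation C := (Cplx R).
Implicit Types (f g : C -> C) (r : R).

Lemma nm_sqbV r (z : C) : 0 < r -> sqb r z -> nm z^-1 <= r^-1.
Proof.
move=> r0 /sqb_ge rz; rewrite nmV lef_pV2 ?posrE //; exact: lt_le_trans rz.
Qed.

Lemma nm_sqb_distV r (z h : C) : 0 < r -> sqb r z -> nm h <= r / 2 ->
  nm (z - h)^-1 <= 2 / r.
Proof.
move=> r0 bz hr; have d := sqb_dist bz hr; have r2 : 0 < r / 2 by rewrite divr_gt0.
by rewrite nmV -[2 / r]invf_div lef_pV2 ?posrE //; exact: lt_le_trans d.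
Qed.

(* (z - h)^-1 = z^-1 + h z^-2 + h^2 z^-2 (z - h)^-1, integrated against f. *)
Lemma circ_expand r f (M : R) (h : C) : 0 < r -> nm h <= r / 2 ->
  cts_on (sqb r) f -> (forall z, sqb r z -> nm (f z) <= M) ->
  exists2 E : C, nm E <= 32 * M / r ^+ 2 &
    circ r (fun z => f z * (z - h)^-1) = circ r (fun z => f z * z^-1) +
      (h * circ r (fun z => f z * (z^-1 * z^-1)) + h ^+ 2 * E).
Proof.
move=> r0 hr fc fM; have r0' := ltW r0.
have vc := cts_sqb_V r0; have kc := cts_sqb_inv r0 hr.
have c1 := ctsM fc vc; have c2 := ctsM fc (ctsM vc vc).
have c3 := ctsM (ctsM fc (ctsM vc vc)) kc.
have hc2 := @ctsZ _ h _ _ _ c2; have hc3 := @ctsZ _ (h ^+ 2) _ _ _ c3.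
exists (circ r (fun z => f z * (z^-1 * z^-1) * (z - h)^-1)).
  have -> : 32 * M / r ^+ 2 = 16 * (M * (r^-1 * r^-1) * (2 / r)) * r.
    by field; rewrite gt_eqF.
  apply: (circ_bound r0' c3) => z bz; rewrite !nmM.
  by rewrite !ler_pM ?mulr_ge0 ?nm_ge0 ?fM ?nm_sqbV ?nm_sqb_distV.
rewrite -(circZ h r0' c2) -(circZ (h ^+ 2) r0' c3).
rewrite -(circD r0' hc2 hc3) -(circD r0' c1 (ctsD hc2 hc3)).
apply: (eq_circ r0') => z bz.
have z0 : z != 0 by rewrite -nm_gt0; exact: lt_le_trans r0 (sqb_ge bz).
have zh0 : z - h != 0.
  rewrite -nm_gt0; apply: lt_le_trans (sqb_dist bz hr); exact: divr_gt0.
by field; apply/andP; split.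
Qed.

(** [circ_expand] is applied to f - f 0, whose zeroth coefficient vanishes by Cauchy's formula at 0,
    and to the constant 1, which compares the kernel integrals at [h] and at 0 without evaluating
    either. The estimates give the constant 2 (32 + 1024), the 2 coming from [circ_kernel_ge]; 4096
    is a round value above it. *)
Theorem cauchy_taylor r f (M : R) (h : C) : 0 < r -> nm h <= r / 2 ->
  (forall z, sq r z -> differentiable f z) ->
  (forall z, sq r z -> nm (f z - f 0) <= M) ->
  nm (f h - f 0 - h * dcirc r f) <= 4096 * M / r ^+ 2 * nm h ^+ 2.
Proof.
move=> r0 hr df fM; have r0' := ltW r0.
have h00 : nm (0 : C) <= r / 2 by rewrite nm0 divr_ge0.
pose g z := f z - f 0.
have dg z : sq r z -> differentiable g z.
  by move=> /df dfz; apply: differentiableB => //; exact: differentiable_cst.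
have gc : cts_on (sqb r) g by apply: differentiable_cts => z /sqb_sq/dg.
have gM z : sqb r z -> nm (g z) <= M by move=> /sqb_sq/fM.
have M0 : 0 <= M by apply: le_trans (fM 0 (nm_sq (le_trans h00 _))); rewrite ?nm_ge0 //; lra.
have [E1 E1b E1E] := circ_expand r0 hr gc gM.
have one1 z : sqb r z -> nm (1 : C) <= 1 by rewrite nm1.
have [E2 E2b E2E] := circ_expand r0 hr (@cts_cst _ _ (sqb r) (1 : C)) one1.
have Cg := cauchy r0 hr dg; have C0 := cauchy r0 h00 dg.
have e0 : circ r (fun z => g z / (z - 0)) = circ r (fun z => g z * z^-1).
  by apply: (eq_circ r0') => z _; rewrite subr0.
have g0 : g 0 = 0 by rewrite /g subrr.
rewrite g0 mulr0 e0 in C0; rewrite E1E -C0 add0r in Cg.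
have ek : circ r (fun z => 1 * (z - h)^-1) = circ r (fun z => (z - h)^-1).
  by apply: (eq_circ r0') => z _; rewrite mul1r.
have e1 : circ r (fun z => 1 * z^-1) = circ r (fun z => z^-1).
  by apply: (eq_circ r0') => z _; rewrite mul1r.
rewrite ek e1 in E2E.
have vc := cts_sqb_V r0.
have B2b : nm (circ r (fun z => 1 * (z^-1 * z^-1))) <= 16 / r.
  have -> : 16 / r = 16 * (r^-1 * r^-1) * r by field; rewrite gt_eqF.
  apply: (circ_bound r0' (ctsM (@cts_cst _ _ (sqb r) (1 : C)) (ctsM vc vc))) => z bz.
  by rewrite !nmM nm1 mul1r ler_pM ?nm_ge0 ?nm_sqbV.
have Db : nm (dcirc r f) <= 32 * M / r.
  apply: (dcirc_bound r0 _ gM).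
  by apply: differentiable_cts => z /sqb_sq/df.
have c0n := circ_inv_neq0 r0; have cb := circ_kernel_ge r0 hr.
have De : circ r (fun z => z^-1) * dcirc r f = circ r (fun z => g z * (z^-1 * z^-1)).
  by rewrite /dcirc mulrC divfK.
rewrite -De in Cg; rewrite -/(g h).
move: (dcirc r f) (circ r (fun z => z^-1)) (circ r (fun z => (z - h)^-1))
  (circ r (fun z => 1 * (z^-1 * z^-1))) (g h) Db cb B2b E2E Cg.
move=> D c0 c B w Db cb B2b E2E Cg.
(* [Cg] reads c w = h c0 D + h^2 E1 and [E2E] reads c = c0 + h B + h^2 E2, so the terms in [c0]
   cancel and a factor h^2 is left. *)
have key : c * (w - h * D) = h ^+ 2 * E1 - h ^+ 2 * ((B + h * E2) * D).
  by rewrite mulrBr Cg E2E; ring.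
have BE : nm (B + h * E2) <= 32 / r.
  have hE : nm (h * E2) <= r / 2 * (32 * 1 / r ^+ 2).
    by rewrite nmM ler_pM ?nm_ge0.
  apply: le_trans (nmD _ _) _; apply: le_trans (lerD B2b hE) _.
  by rewrite le_eqVlt; apply/orP; left; apply/eqP; field; rewrite gt_eqF.
have BED : nm ((B + h * E2) * D) <= 32 / r * (32 * M / r).
  by rewrite nmM ler_pM ?nm_ge0.
have cw : nm c * nm (w - h * D) <=
    nm h ^+ 2 * (32 * M / r ^+ 2) + nm h ^+ 2 * (32 / r * (32 * M / r)).
  have n2 (X : C) : nm (h ^+ 2 * X) = nm h ^+ 2 * nm X by rewrite !expr2 !nmM.
  rewrite -nmM key; apply: le_trans (nmB _ _) _; rewrite !n2.
  by apply: lerD; rewrite ler_wpM2l ?exprn_ge0 ?nm_ge0.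
have half : 1 / 2 * nm (w - h * D) <= nm c * nm (w - h * D).
  by rewrite ler_wpM2r ?nm_ge0.
have := le_trans half cw.
have -> : 32 / r * (32 * M / r) = 1024 * (M / r ^+ 2) by field; rewrite gt_eqF.
have -> : 32 * M / r ^+ 2 = 32 * (M / r ^+ 2) by rewrite mulrA.
have -> : 4096 * M / r ^+ 2 * nm h ^+ 2 = 4096 * (nm h ^+ 2 * (M / r ^+ 2)).
  by move: (nm h); clear -r0 => x; field; rewrite gt_eqF.
have K0 : 0 <= nm h ^+ 2 * (M / r ^+ 2).
  by rewrite mulr_ge0 ?divr_ge0 ?exprn_ge0 ?nm_ge0.
rewrite (mulrCA _ 32) (mulrCA _ 1024).
by move: (nm h ^+ 2 * (M / r ^+ 2)) (nm (w - h * D)) K0 => k u; clear; lra.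
Qed.

(** Both numbers are linear coefficients of [f] at 0, one by definition of the derivative and the
    other by [cauchy_taylor]. The two expansions are compared at a small real [t] and divided by
    [t]. *)
Corollary dcirc_diff r f : 0 < r -> (forall z, sq r z -> differentiable f z) ->
  (exists M : R, forall z, sq r z -> nm (f z - f 0) <= M) -> 'd f 0 1 = dcirc r f.
Proof.
move=> r0 df [M fM].
have M0 : 0 <= M.
  by apply: le_trans (fM 0 (nm_sq _)); rewrite ?nm_ge0 // nm0 ltW.
pose K := 4096 * M / r ^+ 2; have K0 : 0 <= K by rewrite divr_ge0 ?mulr_ge0 ?ler0n ?exprn_ge0 ?(ltW r0).
have d0 : differentiable f 0 by apply: df; apply: nm_sq; rewrite nm0 ltW.
apply/eqP; rewrite -subr_eq0 -nm_eq0; apply/eqP/le_anti; rewrite nm_ge0 andbT.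
apply/ler_addgt0Pr => e e0; rewrite add0r.
have e2 : 0 < e / 2 by rewrite divr_gt0.
have [del del0 dP] := diff_nm d0 e2.
pose t := Num.min (Num.min (r / 2) (del / 2)) (e / (2 * (K + 1))).
have K1 : 0 < K + 1 by rewrite ltr_wpDl.
have t0 : 0 < t by rewrite !lt_min !divr_gt0 ?mulr_gt0.
have : t <= t by [].
rewrite {2}/t !le_min -andbA => /and3P[t1 t2 t3].
have nt : nm (rc t : C) = t by rewrite nm_rc_ge0 // ltW.
have h1 : nm (f (rc t) - f 0 - rc t * dcirc r f) <= K * t ^+ 2.
  by have := @cauchy_taylor r f M (rc t) r0; rewrite nt; apply.
have h2 : nm (f (rc t) - f 0 - rc t * 'd f 0 1) <= e / 2 * t.
  have := dP (rc t); rewrite nt add0r (diff1E f 0 (rc t)); apply.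
  by move: t2 del0; clear; lra.
have h3 : nm (rc t * ('d f 0 1 - dcirc r f)) <= K * t ^+ 2 + e / 2 * t.
  have -> : rc t * ('d f 0 1 - dcirc r f) =
     (f (rc t) - f 0 - rc t * dcirc r f) - (f (rc t) - f 0 - rc t * 'd f 0 1) by ring.
  apply: le_trans (nmB _ _) _; exact: lerD.
move: h3; rewrite nmM nt expr2 mulrA -mulrDl mulrC ler_pM2r // => /le_trans; apply.
have : K * t <= e / 2; last by lra.
apply: le_trans (_ : (K + 1) * t <= _).
  by rewrite ler_pM2r // lerDl.
by move: t3; rewrite invfM mulrA ler_pdivlMr // mulrC.
Qed.

End CauchyTaylor.

(** * Derivatives of holomorphic functions *)

Section HolomorphicDerivative.
Context {R : realType}.
Local Notation C := (Cplx R).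

(** Restriction to the complex line through [y] with direction [v]: the passage from one-variable
    estimates to functions on an arbitrary normed space. *)
Lemma diff_lineE (U W : normedModType C) (F : U -> W) (y v : U) (t : C) :
  differentiable F (y + t *: v) ->
  differentiable (fun s : C => F (y + s *: v)) t /\
  'd (fun s : C => F (y + s *: v)) t 1 = 'd F (y + t *: v) v.
Proof.
move=> dF.
have [d1 d2] : differentiable (fun s : C => y + s *: v) t /\
    'd (fun s : C => y + s *: v) t = (fun s => s *: v) :> (C -> U).
  apply: (@nm_diff _ _ _ _ _ _ (nm v)).
  - by move=> a u w; rewrite scalerDl scalerA.
  - by move=> s; rewrite nmZ mulrC.
  move=> e e0; exists 1; first exact: ltr01.
  move=> h _; rewrite scalerDl addrA (addrC (y + _)) addrK subrr.
  by rewrite nm0 mulr_ge0 ?nm_ge0 ?(ltW e0).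
have dc := @differentiable_comp _ _ _ _ (fun s : C => y + s *: v) F t d1 dF.
split; first exact: dc.
rewrite (@diff_comp _ _ _ _ (fun s : C => y + s *: v) F t d1 dF) /=.
by rewrite d2 scale1r.
Qed.

(** * Cauchy estimates on a ball of a complex normed space *)

Section Estimates.
Context {U : normedModType C} (F : U -> C) (z : U) (rho M : R).
Context (rho0 : 0 < rho).
Context (dF : forall y, nm (y - z) < rho -> differentiable F y).
Context (FM : forall y, nm (y - z) < rho -> nm (F y) <= M).

Lemma near_add (y h : U) (a b : R) : nm (y - z) < a -> nm h <= b -> nm (y + h - z) < a + b.
Proof.
by move=> ya hb; rewrite addrAC; apply: le_lt_trans (nmD _ _) _; exact: ltr_leD.
Qed.

Lemma sq_scale (r : R) (t : C) (v : U) : sq r t -> nm (t *: v) <= 2 * r * nm v.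
Proof. by move=> /sq_le tr; rewrite nmZ ler_wpM2r ?nm_ge0. Qed.

Lemma M_ge0 : 0 <= M.
Proof. by apply: le_trans (FM (y := z) _); rewrite ?nm_ge0 // subrr nm0. Qed.

Lemma line_diff (y v : U) (a r : R) : 0 < r -> nm (y - z) < a ->
  a + 2 * r * nm v <= rho -> forall t, sq r t ->
  nm (y + t *: v - z) < rho.
Proof.
by move=> r0 ya ar t /(sq_scale v)/(near_add ya)/lt_le_trans; apply.
Qed.

Lemma dcirc_line (y v : U) (a r : R) : 0 < r -> nm (y - z) < a ->
  a + 2 * r * nm v <= rho -> 'd F y v = dcirc r (fun t => F (y + t *: v)).
Proof.
move=> r0 ya ar; have inb := line_diff r0 ya ar.
have y0 : y + 0 *: v = y by rewrite scale0r addr0.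
have d0 : differentiable F (y + 0 *: v).
  by apply: dF; apply: inb; apply: nm_sq; rewrite nm0 ltW.
have [_ dE] := diff_lineE d0.
have -> : 'd F y v = 'd F (y + 0 *: v) v by rewrite y0.
rewrite -dE; apply: dcirc_diff; first exact: r0.
  by move=> t /inb/dF/diff_lineE[].
exists (M + M) => t tr; apply: le_trans (nmB _ _) _; apply: lerD; apply: FM.
  exact: inb.
by apply: inb; apply: nm_sq; rewrite nm0 ltW.
Qed.

Lemma cts_line (y v : U) (a r : R) : 0 < r -> nm (y - z) < a ->
  a + 2 * r * nm v <= rho -> cts_on (sqb r) (fun t : C => F (y + t *: v)).
Proof.
move=> r0 ya ar; apply: differentiable_cts => t /sqb_sq/(line_diff r0 ya ar).
by move=> /dF/diff_lineE[].
Qed.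

(** Constants for the first derivative, the Taylor remainder and the Lipschitz bound. They come from
    [dcirc_bound] and [cauchy_taylor] on the line t -> F (y + t v) with r = rho / (8 |v|), where
    values of F differ by at most 2 M: 512 = 32 * 2 * 8 and 128 = 2 * 8^2. *)
Definition K1 : R := 512 * M / rho.
Definition K2 : R := 4096 * (128 * M) / rho ^+ 2.
Definition K3 : R := K1 + K2 * rho.

Lemma K1_ge0 : 0 <= K1.
Proof. by rewrite /K1 divr_ge0 ?mulr_ge0 ?ler0n ?M_ge0 ?(ltW rho0). Qed.
Lemma K2_ge0 : 0 <= K2.
Proof. by rewrite /K2 divr_ge0 ?mulr_ge0 ?ler0n ?M_ge0 ?exprn_ge0 ?(ltW rho0). Qed.
Lemma K3_ge0 : 0 <= K3.
Proof.
by apply: addr_ge0; [exact: K1_ge0|apply: mulr_ge0; [exact: K2_ge0|exact: ltW]].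
Qed.

Lemma diff_bound (y v : U) : nm (y - z) < rho / 2 -> nm ('d F y v) <= K1 * nm v.
Proof.
move=> yr; have [->|v0] := eqVneq v 0; first by rewrite linear0 !nm0 mulr0.
have nv0 : 0 < nm v by rewrite nm_gt0.
pose r := rho / (8 * nm v).
have r0 : 0 < r by rewrite divr_gt0 // mulr_gt0.
have ar : rho / 2 + 2 * r * nm v <= rho.
  have -> : 2 * r * nm v = rho / 4 by rewrite /r; field; rewrite gt_eqF.
  by move: rho0; lra.
rewrite (dcirc_line r0 yr ar).
have -> : K1 * nm v = 32 * (M + M) / r.
  by rewrite /K1 /r; field; rewrite !gt_eqF.
apply: (dcirc_bound r0 (cts_line r0 yr ar)) => t /sqb_sq tr.
have inb := line_diff r0 yr ar.
apply: le_trans (nmB _ _) _; apply: lerD; apply: FM; first exact: inb.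
by apply: inb; apply: nm_sq; rewrite nm0 ltW.
Qed.

Lemma taylor_bound (y h : U) : nm (y - z) < rho / 2 -> nm h <= rho / 16 ->
  nm (F (y + h) - F y - 'd F y h) <= K2 * nm h ^+ 2.
Proof.
move=> yr hr; have [->|h0] := eqVneq h 0.
  by rewrite addr0 subrr linear0 subr0 !nm0 expr0n /= mulr0.
have nh0 : 0 < nm h by rewrite nm_gt0.
pose r := rho / (8 * nm h).
have r0 : 0 < r by rewrite divr_gt0 // mulr_gt0.
have ar : rho / 2 + 2 * r * nm h <= rho.
  have -> : 2 * r * nm h = rho / 4 by rewrite /r; field; rewrite gt_eqF.
  by move: rho0; lra.
have inb := line_diff r0 yr ar.
have y0 : y + 0 *: h = y by rewrite scale0r addr0.
have one : nm (1 : C) <= r / 2.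
  rewrite nm1 /r -mulrA -invfM ler_pdivlMr ?mulr_gt0 // mul1r.
  by move: rho0; lra.
have T := @cauchy_taylor _ r (fun t => F (y + t *: h)) (M + M) 1 r0 one.
rewrite (dcirc_line r0 yr ar).
have E : F (y + h) - F y - dcirc r (fun t => F (y + t *: h)) =
   F (y + 1 *: h) - F (y + 0 *: h) - 1 * dcirc r (fun t => F (y + t *: h)).
  by rewrite scale1r y0 mul1r.
rewrite E; apply: le_trans (T _ _) _.
- by move=> t /inb/dF/diff_lineE[].
- move=> t tr; apply: le_trans (nmB _ _) _; apply: lerD; apply: FM.
    exact: inb.
  by apply: inb; apply: nm_sq; rewrite nm0 ltW.
rewrite le_eqVlt; apply/orP; left; apply/eqP.
by rewrite nm1 /K2 /r; field; rewrite !gt_eqF.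
Qed.

Lemma lipschitz_bound (y h : U) : nm (y - z) < rho / 2 -> nm h <= rho / 16 ->
  nm (F (y + h) - F y) <= K3 * nm h.
Proof.
move=> yr hr; rewrite -(subrK ('d F y h) (F (y + h) - F y)).
apply: le_trans (nmD _ _) _; rewrite /K3 mulrDl addrC; apply: lerD.
  exact: diff_bound.
apply: le_trans (taylor_bound yr hr) _; rewrite expr2 mulrA.
rewrite ler_wpM2r ?nm_ge0 // ler_wpM2l ?K2_ge0 //.
by apply: le_trans hr _; move: rho0; lra.
Qed.

(** With one radius common to [x] and [y], Cauchy's formula is linear in the function, so the
    difference of the two derivatives is [dcirc] of a difference of values of [F], which
    [lipschitz_bound] controls. The 1 added to [nm v] in the radius covers v = 0. *)
Lemma diff_cts (v y : U) : nm (y - z) < rho / 4 ->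
  {for y, continuous (fun x => 'd F x v)}.
Proof.
move=> yr; pose r := rho / (16 * (nm v + 1)).
have v1 : 0 < nm v + 1 by rewrite ltr_wpDl ?nm_ge0.
have r0 : 0 < r by rewrite divr_gt0 // mulr_gt0.
have rv : 2 * r * nm v <= rho / 8.
  have -> : rho / 8 = 2 * r * (nm v + 1) by rewrite /r; field; rewrite gt_eqF.
  by apply: ler_wpM2l; [rewrite mulr_ge0 ?(ltW r0)|rewrite lerDl].
have ar : rho / 4 + 2 * r * nm v <= rho by move: rho0; lra.
have ar' : rho / 4 + rho / 16 + 2 * r * nm v <= rho by move: rho0; lra.
apply/cvg_nmP => e e0; apply/near_nmP.
pose Q := 64 * K3 / r.
have Q0 : 0 <= Q.
  apply: divr_ge0; last exact: ltW.
  by apply: mulr_ge0; [exact: ler0n|exact: K3_ge0].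
have Q1 : 0 < Q + 1 by rewrite ltr_wpDl.
exists (Num.min (rho / 16) (e / (Q + 1))).
  by rewrite lt_min !divr_gt0.
move=> x; rewrite lt_min => /andP[/ltW x1 x2].
have xr : nm (x - z) < rho / 4 + rho / 16.
  by have := near_add yr x1; rewrite [y + _]addrC subrK.
have in2 w t : sq r t -> nm (w - z) < rho / 4 -> nm (w + t *: v - z) < rho / 2.
  move=> /(sq_scale v) tr wr; apply: lt_le_trans (near_add wr (le_trans tr rv)) _.
  by move: rho0; lra.
have cx := cts_line r0 xr ar'; have cy := cts_line r0 yr ar.
have DE : 'd F x v - 'd F y v =
    dcirc r (fun t => -1 * F (y + t *: v) + F (x + t *: v)).
  rewrite (dcirc_line r0 xr ar') (dcirc_line r0 yr ar).
  by rewrite (dcirc_lin (-1) r0 cy cx) mulN1r addrC.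
have lip t : sq r t -> nm (F (x + t *: v) - F (y + t *: v)) <= K3 * nm (x - y).
  move=> tr; have := lipschitz_bound (in2 y t tr yr) x1.
  by rewrite addrAC (addrC y) subrK.
have lip0 : nm (F (x + 0 *: v) - F (y + 0 *: v)) <= K3 * nm (x - y).
  by apply: lip; apply: nm_sq; rewrite nm0 ltW.
have : nm ('d F x v - 'd F y v) <= Q * nm (x - y).
  rewrite DE.
  have -> : Q * nm (x - y) = 32 * (K3 * nm (x - y) + K3 * nm (x - y)) / r.
    by rewrite /Q; field; rewrite gt_eqF.
  apply: (dcirc_bound r0 (ctsD (@ctsZ _ (-1) _ _ _ cy) cx)) => t /sqb_sq tr.
  rewrite !mulN1r ![- F _ + _]addrC.
  by apply: le_trans (nmB _ _) _; apply: lerD => //; exact: lip.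
move=> /le_lt_trans; apply; move: x2; rewrite ltr_pdivlMr // => x2.
apply: le_lt_trans _ x2; rewrite mulrC ler_wpM2l ?nm_ge0 //.
by rewrite lerDl.
Qed.

(** Differentiation under the contour integral: the remainder in [taylor_bound] is uniform in [t],
    so integrating it costs only a constant. The formula is kept for every small radius because
    [diff_diffC] has to shrink the radius once more. *)
Lemma diff_of_diff (v : U) :
  differentiable (fun y => 'd F y v) z /\
  exists2 r0 : R, 0 < r0 & forall r, 0 < r -> r <= r0 -> forall h,
    'd (fun y => 'd F y v) z h = dcirc r (fun t => 'd F (z + t *: v) h).
Proof.
have v1 : 0 < nm v + 1 by rewrite ltr_wpDl ?nm_ge0.
pose rr := rho / (32 * (nm v + 1)).
have rr0 : 0 < rr by rewrite divr_gt0 // mulr_gt0.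
suff main r : 0 < r -> r <= rr -> differentiable (fun y => 'd F y v) z /\
    'd (fun y => 'd F y v) z = (fun h => dcirc r (fun t => 'd F (z + t *: v) h)) :> (U -> C).
  split; first by have [] := main rr rr0 (lexx _).
  by exists rr => // r r0 rle h; have [_ ->] := main r r0 rle.
move=> r0 rle.
have rv : 2 * r * nm v <= rho / 16.
  have -> : rho / 16 = 2 * rr * (nm v + 1) by rewrite /rr; field; rewrite gt_eqF.
  by rewrite ler_pM ?mulr_ge0 ?nm_ge0 ?(ltW r0) // ?ler_wpM2l // lerDl.
have z16 : nm (z - z) < rho / 16 by rewrite subrr nm0 divr_gt0.
have zt t : sq r t -> nm (z + t *: v - z) < rho / 8.
  move=> /(sq_scale v) tr; apply: lt_le_trans (near_add z16 (le_trans tr rv)) _.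
  by move: rho0; lra.
have z4 t : sq r t -> nm (z + t *: v - z) < rho / 4.
  by move=> /zt/lt_le_trans; apply; move: rho0; lra.
have z2 t : sq r t -> nm (z + t *: v - z) < rho / 2.
  by move=> /zt/lt_le_trans; apply; move: rho0; lra.
have s0 : sq r (0 : C) by apply: nm_sq; rewrite nm0 ltW.
pose D h : C -> C := fun t => 'd F (z + t *: v) h.
have Dc h : cts_on (sqb r) (D h).
  move=> t /sqb_sq tr; apply: (@continuous_comp _ _ _ (fun t : C => z + t *: v) (fun y => 'd F y h)).
    apply: (@continuousD _ _ _ (fun=> z) (fun t : C => t *: v)); first exact: cst_continuous.
    exact: scalel_continuous.
  by apply: diff_cts; exact: z4.
have Db h t : sqb r t -> nm (D h t - D h 0) <= 2 * (K1 * nm h).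
  move=> /sqb_sq tr; apply: le_trans (nmB _ _) _; rewrite mulr2n mulrDl mul1r.
  by apply: lerD; apply: diff_bound; exact: z2.
apply: (@nm_diff _ _ _ _ _ _ (32 * (2 * K1) / r)).
- move=> a u w; apply: etrans (dcirc_lin a r0 (Dc u) (Dc w)).
  by congr (dcirc _ _); apply/funext => t; exact: linearP.
- move=> h; apply: le_trans (dcirc_bound r0 (Dc h) (Db h)) _.
  by rewrite le_eqVlt; apply/orP; left; apply/eqP; field; rewrite gt_eqF.
move=> e e0.
pose Q := 32 * (2 * K2) / r.
have Q0 : 0 <= Q.
  apply: divr_ge0; last exact: ltW.
  apply: mulr_ge0; first exact: ler0n.
  by apply: mulr_ge0; [exact: ler0n|exact: K2_ge0].
have Q1 : 0 < Q + 1 by rewrite ltr_wpDl.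
exists (Num.min (rho / 16) (e / (Q + 1))); first by rewrite lt_min !divr_gt0.
move=> h; rewrite lt_min => /andP[/ltW h1 h2].
have zh : nm (z + h - z) < rho / 8.
  by apply: lt_le_trans (near_add z16 h1) _; move: rho0; lra.
have ar : rho / 16 + 2 * r * nm v <= rho by move: rho0; lra.
have ar' : rho / 8 + 2 * r * nm v <= rho by move: rho0; lra.
have cz := cts_line r0 z16 ar; have czh := cts_line r0 zh ar'.
have E : 'd F (z + h) v - 'd F z v - dcirc r (D h) =
    dcirc r (fun t => -1 * D h t + (-1 * F (z + t *: v) + F (z + h + t *: v))).
  rewrite (dcirc_line r0 zh ar') (dcirc_line r0 z16 ar).
  rewrite (dcirc_lin (-1) r0 (Dc h) (ctsD (@ctsZ _ (-1) _ _ _ cz) czh)).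
  rewrite (dcirc_lin (-1) r0 cz czh) !mulN1r addrC; congr (_ + _).
  by rewrite addrC.
have T t : sq r t ->
    nm (-1 * D h t + (-1 * F (z + t *: v) + F (z + h + t *: v))) <= K2 * nm h ^+ 2.
  move=> tr; have T0 := taylor_bound (z2 t tr) h1.
  rewrite (addrAC z) in T0; apply: le_trans T0; rewrite /D le_eqVlt.
  apply/orP; left; apply/eqP; congr (nm _).
  by move: (F (z + h + t *: v)) (F (z + t *: v)) ('d F (z + t *: v) h : C) => p q s; ring.
have B : nm ('d F (z + h) v - 'd F z v - dcirc r (D h)) <= Q * nm h ^+ 2.
  rewrite E.
  have -> : Q * nm h ^+ 2 = 32 * (K2 * nm h ^+ 2 + K2 * nm h ^+ 2) / r.
    by rewrite /Q; field; rewrite gt_eqF.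
  have cE := ctsD (@ctsZ _ (-1) _ _ _ (Dc h)) (ctsD (@ctsZ _ (-1) _ _ _ cz) czh).
  apply: (dcirc_bound r0 cE) => t /sqb_sq tr.
  by apply: le_trans (nmB _ _) _; apply: lerD; exact: T.
apply: le_trans B _; rewrite expr2 mulrA ler_wpM2r ?nm_ge0 //.
move: h2; rewrite ltr_pdivlMr // => /ltW; apply: le_trans.
by rewrite mulrC ler_wpM2l ?nm_ge0 // lerDl.
Qed.

End Estimates.

(** Differentiability on a neighbourhood is the notion that is stable under differentiation;
    differentiability at the single point [z] would not be. *)
Definition holo_near (U W : normedModType C) (F : U -> W) (z : U) :=
  \forall y \near z, differentiable F y.

Lemma holo_near_ball (U : normedModType C) (F : U -> C) (z : U) : holo_near F z ->
  exists2 rho : R, 0 < rho & exists M : R, forall y, nm (y - z) < rho ->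
    differentiable F y /\ nm (F y) <= M.
Proof.
move=> /[dup] /near_nmP[d1 d10 d1P] /nbhs_singleton dFz.
have /cvg_nmP/(_ 1 ltr01) := differentiable_continuous dFz.
move=> /near_nmP[d2 d20 d2P].
exists (Num.min d1 d2); first by rewrite lt_min d10.
exists (nm (F z) + 1) => y; rewrite lt_min => /andP[/d1P dy /d2P Fy]; split=> //.
rewrite -(subrK (F z) (F y)) addrC; apply: le_trans (nmD _ _) _.
by apply: lerD => //; exact: ltW.
Qed.

Lemma holo_near_near (U W : normedModType C) (F : U -> W) (z : U) :
  holo_near F z -> \forall y \near z, holo_near F y.
Proof. exact: nbhs_interior. Qed.

Lemma holo_near_diff (U : normedModType C) (F : U -> C) (z v : U) :
  holo_near F z -> holo_near (fun y => 'd F y v) z.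
Proof.
move=> /holo_near_near; apply: filterS => y /holo_near_ball[rho rho0 [M H]].
by case: (diff_of_diff rho0 (fun y yr => (H y yr).1) (fun y yr => (H y yr).2) v).
Qed.

(** The integral that [diff_of_diff] gives for the left side is Cauchy's formula for the derivative
    in direction [v] of y -> ['d F y h], which is itself holomorphic near [z]. *)
Lemma diff_diffC (U : normedModType C) (F : U -> C) (z v h : U) :
  holo_near F z -> 'd (fun y => 'd F y v) z h = 'd (fun y => 'd F y h) z v.
Proof.
move=> Fz; have := holo_near_diff h Fz => /holo_near_ball[rho1 rho10 [M1 H1]].
have [rho rho0 [M H]] := holo_near_ball Fz.
have [_ [r0 r00 rP]] :=
  diff_of_diff rho0 (fun y yr => (H y yr).1) (fun y yr => (H y yr).2) v.
have v1 : 0 < nm v + 1 by rewrite ltr_wpDl ?nm_ge0.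
pose r := Num.min r0 (rho1 / (4 * (nm v + 1))).
have r1 : 0 < r by rewrite lt_min r00 divr_gt0 // mulr_gt0.
have rr0 : r <= r0 by rewrite ge_min lexx.
have rr1 : r <= rho1 / (4 * (nm v + 1)) by rewrite ge_min lexx orbT.
have ar : rho1 / 2 + 2 * r * nm v <= rho1.
  have : 2 * r * nm v <= rho1 / 2; last by lra.
  have -> : rho1 / 2 = 2 * (rho1 / (4 * (nm v + 1))) * (nm v + 1).
    by field; rewrite gt_eqF.
  by rewrite ler_pM ?mulr_ge0 ?nm_ge0 ?(ltW r1) // ?ler_wpM2l // lerDl.
have zz : nm (z - z) < rho1 / 2 by rewrite subrr nm0 divr_gt0.
apply: etrans (rP r r1 rr0 h) (esym _).
exact: (dcirc_line (fun y yr => (H1 y yr).1) (fun y yr => (H1 y yr).2) r1 zz ar).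
Qed.

End HolomorphicDerivative.

(** * Holomorphic calculus with values in row vectors *)

Section Calculus.
Context {R : realType}.
Local Notation C := (Cplx R).
Implicit Types (U V W : normedModType C).

Lemma nm_coord m n (v : 'M[C]_(m, n)) i j : nm (v i j) <= nm v.
Proof.
rewrite -rc_le -!nmE [leRHS]mx_normE -[leLHS]nngE num_le.
exact: (@le_bigmax _ _ _ _ (fun k : 'I_m * 'I_n => `|v k.1 k.2|%:nng%R) (i, j)).
Qed.

Lemma nm_row_le n (v : 'rV[C]_n) : nm v <= \sum_j nm (v 0 j).
Proof.
have [v0|v0] := eqVneq (mx_norm v) 0.
  have -> : nm v = 0 by rewrite /nm -[`|v|]/(mx_norm v) v0.
  by apply: sumr_ge0 => j _; exact: nm_ge0.
have [[i j] vE] := mx_norm_neq0 v0; rewrite /= (ord1 i) in vE.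
have -> : nm v = nm (v 0 j) by rewrite /nm -[`|v|]/(mx_norm v) vE.
by rewrite (bigD1 j) //= lerDl; apply: sumr_ge0 => k _; exact: nm_ge0.
Qed.

Lemma near_diff U V (f g : U -> V) x : (\forall y \near x, f y = g y) ->
  differentiable g x -> differentiable f x /\ forall h, 'd f x h = 'd g x h.
Proof.
suff main : (\forall y \near x, f y = g y) -> differentiable g x ->
    differentiable f x /\ 'd f x = 'd g x :> (U -> V).
  move=> h1 /(main h1)[d dE]; split; first exact: d.
  by move=> h; exact: (congr1 (fun L => L h) dE).
move=> /[dup] /nbhs_singleton fgx /near_nmP[d1 d10 fg] dg.
have [K KP] : exists K : R, forall h, nm ('d g x h) <= K * nm h.
  have /linear_lipschitz[k k0 kP] := @diff_continuous _ _ _ _ _ dg.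
  have [k' k'0 kE] := gt0_rc k0; exists k' => h.
  by rewrite -rc_le rcM -!nmE -kE.
apply: (nm_diff (K := K)) => // [a u v|e e0]; first exact: linearP.
have [d d0 dP] := diff_nm dg e0; exists (Num.min d1 d); first by rewrite lt_min d10.
move=> h; rewrite lt_min => /andP[h1 /dP]; rewrite fgx fg //.
by rewrite addrAC subrr add0r.
Qed.

Lemma near_holo U V (f g : U -> V) x : (\forall y \near x, f y = g y) ->
  holo_near g x -> holo_near f x.
Proof.
move=> /nbhs_interior fg gx; apply: filterS2 fg gx => y fgy dg.
by case: (near_diff fgy dg).
Qed.

Lemma differentiable_bounded U V (f : U -> V) x : differentiable f x ->
  exists K : R, forall h, nm ('d f x h) <= K * nm h.
Proof.
move=> df; have /linear_lipschitz[k k0 kP] := @diff_continuous _ _ _ _ _ df.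
have [k' k'0 kE] := gt0_rc k0; exists k' => h.
by rewrite -rc_le rcM -!nmE -kE.
Qed.

Lemma holo_at U V (f : U -> V) x : holo_near f x -> differentiable f x.
Proof. exact: nbhs_singleton. Qed.

Lemma chain U V W (f : U -> V) (g : V -> W) x :
  differentiable f x -> differentiable g (f x) ->
  differentiable (fun y => g (f y)) x /\
  forall h, 'd (fun y => g (f y)) x h = 'd g (f x) ('d f x h).
Proof.
move=> df dg; split; first exact: (@differentiable_comp _ _ _ _ f g x df dg).
by move=> h; rewrite (@diff_comp _ _ _ _ f g x df dg).
Qed.

Lemma holo_near_comp U V W (f : U -> V) (g : V -> W) x :
  holo_near f x -> holo_near g (f x) -> holo_near (fun y => g (f y)) x.
Proof.
move=> fx gx; have fc := differentiable_continuous (holo_at fx).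
have gx' : \forall y \near x, differentiable g (f y) by exact: (fc _ gx).
by apply: filterS2 fx gx' => y df dg; case: (chain df dg).
Qed.

Lemma affine_diff U V (f L : U -> V) (K : R) :
  (forall (a : C) u v, L (a *: u + v) = a *: L u + L v) ->
  (forall h, nm (L h) <= K * nm h) -> (forall x h, f (x + h) = f x + L h) ->
  forall x, differentiable f x /\ 'd f x = L :> (U -> V).
Proof.
move=> Ll LK fL x; apply: (nm_diff Ll LK) => e e0; exists 1; first exact: ltr01.
move=> h _; rewrite fL (addrC (f x)) addrK subrr nm0.
by rewrite mulr_ge0 ?nm_ge0 ?(ltW e0).
Qed.

Lemma diff_coord U n (F : U -> 'rV[C]_n) x j : differentiable F x ->
  differentiable (fun y => F y 0 j) x /\
  forall h, 'd (fun y => F y 0 j) x h = ('d F x h) 0 j.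
Proof.
have cd : forall v, differentiable (fun v : 'rV[C]_n => v 0 j) v /\
    'd (fun v : 'rV[C]_n => v 0 j) v = (fun v => v 0 j) :> ('rV[C]_n -> C).
  apply: (affine_diff (K := 1)) => [a u v|h|v h]; rewrite ?mxE //.
  by rewrite mul1r nm_coord.
move=> dF; have [d dE] := chain dF (cd (F x)).1; split=> // h.
by rewrite dE (cd (F x)).2.
Qed.

Lemma diff_row U n (F : U -> 'rV[C]_n) x :
  (forall j, differentiable (fun y => F y 0 j) x) ->
  differentiable F x /\ forall h, 'd F x h = \row_j 'd (fun y => F y 0 j) x h.
Proof.
move=> dF; have [K KP] : exists K : 'I_n -> R, forall j h,
    nm ('d (fun y => F y 0 j) x h) <= K j * nm h.
  by have [K KP] := choice (fun j => differentiable_bounded (dF j)); exists K.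
suff [d dE] : differentiable F x /\
    'd F x = (fun h => \row_j 'd (fun y => F y 0 j) x h) :> (U -> 'rV[C]_n).
  by split=> // h; rewrite dE.
apply: (nm_diff (K := \sum_j K j)).
- by move=> a u v; apply/rowP => j; rewrite !mxE linearP.
- move=> h; apply: le_trans (nm_row_le _) _; rewrite mulr_suml; apply: ler_sum => j _.
  by rewrite mxE.
move=> e e0; pose e' := e / (n%:R + 1).
have n1 : 0 < n%:R + 1 :> R by rewrite ltr_wpDl ?ler0n.
have e'0 : 0 < e' by rewrite divr_gt0.
have [d dP] := choice (fun j => let: ex_intro2 d d0 dP := diff_nm (dF j) e'0 in
  ex_intro (fun d : R => 0 < d /\ forall h, nm h < d ->
    nm (F (x + h) 0 j - F x 0 j - 'd (fun y => F y 0 j) x h) <= e' * nm h) d (conj d0 dP)).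
exists (\big[Num.min/1]_j d j).
  apply: (big_ind (fun t : R => 0 < t)) => [|a b a0 b0|j _].
  - exact: ltr01.
  - by rewrite lt_min a0.
  - by case: (dP j).
move=> h hd; apply: le_trans (nm_row_le _) _.
apply: le_trans (_ : \sum_(j < n) e' * nm h <= _).
  apply: ler_sum => j _; rewrite !mxE; apply: (dP j).2; apply: lt_le_trans hd _.
  exact: bigmin_le.
rewrite sumr_const card_ord -mulr_natl mulrA ler_wpM2r ?nm_ge0 //.
rewrite /e' mulrA ler_pdivrMr // mulrDr mulr1 (mulrC e) lerDl; exact: ltW.
Qed.

Lemma holo_near_row U n (F : U -> 'rV[C]_n) x :
  holo_near F x <-> forall j, holo_near (fun y => F y 0 j) x.
Proof.
split=> [Fx j|Fx]; first by apply: filterS Fx => y /(diff_coord j)[].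
have : \forall y \near x, forall j, differentiable (fun y => F y 0 j) y.
  exact: filter_forall.
by apply: filterS => y /diff_row[].
Qed.

Lemma holo_near_coord U n (F : U -> 'rV[C]_n) x j :
  holo_near F x -> holo_near (fun y => F y 0 j) x.
Proof. by move=> /holo_near_row/(_ j). Qed.

Lemma holo_near_diffV U n (F : U -> 'rV[C]_n) x v :
  holo_near F x -> holo_near (fun y => 'd F y v) x.
Proof.
move=> Fx; apply/holo_near_row => j.
apply: near_holo (_ : holo_near (fun y => 'd (fun y => F y 0 j) y v) x).
  by apply: filterS Fx => y dF; have [_ ->] := diff_coord j dF.
by apply: holo_near_diff; exact: holo_near_coord.
Qed.

Lemma diff_diffCV U n (F : U -> 'rV[C]_n) x v h : holo_near F x ->
  'd (fun y => 'd F y v) x h = 'd (fun y => 'd F y h) x v.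
Proof.
move=> Fx; apply/rowP => j.
have aux w k : ('d (fun y => 'd F y w) x k) 0 j =
    'd (fun y => 'd (fun y => F y 0 j) y w) x k.
  have [_ <-] := diff_coord j (holo_at (holo_near_diffV w Fx)).
  have E : \forall y \near x, ('d F y w) 0 j = 'd (fun y => F y 0 j) y w.
    by apply: filterS Fx => y dF; have [_ ->] := diff_coord j dF.
  have Fj : holo_near (fun y => F y 0 j) x by exact: holo_near_coord.
  have dd := holo_at (holo_near_diff w Fj).
  exact: (near_diff E dd).2.
by rewrite !aux; apply: diff_diffC; exact: holo_near_coord.
Qed.

Lemma linear_expand n (L : 'rV[C]_n -> C) (v : 'rV[C]_n) :
  (forall (a : C) u w, L (a *: u + w) = a *: L u + L w) ->
  L v = \sum_j v 0 j * L (delta_mx 0 j).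
Proof.
move=> Ll; pose L' : {linear _ -> C} := HB.pack L (GRing.isLinear.Build _ _ _ _ L Ll).
rewrite {1}[v]row_sum_delta -[LHS]/(L' _) linear_sum.
by apply: eq_bigr => j _; rewrite linearZ.
Qed.

Lemma diff_const U V (a : V) (x : U) : differentiable (fun _ : U => a) x /\
  forall h, 'd (fun _ : U => a) x h = 0.
Proof.
suff [d dE] : differentiable (fun _ : U => a) x /\
    'd (fun _ : U => a) x = (fun=> 0) :> (U -> V).
  by split; [exact: d|move=> h; exact: (congr1 (fun L => L h) dE)].
apply: (affine_diff (K := 0)) => [b u v|h|y h].
- by rewrite scaler0 addr0.
- by rewrite nm0 mul0r.
- by rewrite addr0.
Qed.

Lemma diff_add U V (f g : U -> V) x : differentiable f x -> differentiable g x ->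
  differentiable (fun y => f y + g y) x /\
  forall h, 'd (fun y => f y + g y) x h = 'd f x h + 'd g x h.
Proof.
move=> df dg; split; first exact: (differentiableD df dg).
by move=> h; exact: (congr1 (fun L => L h) (diffD df dg)).
Qed.

Lemma diff_mul U (f g : U -> C) x : differentiable f x -> differentiable g x ->
  differentiable (fun y => f y * g y) x /\
  forall h, 'd (fun y => f y * g y) x h = 'd f x h * g x + f x * 'd g x h.
Proof.
move=> df dg; split; first exact: (differentiableM df dg).
move=> h; apply: etrans (congr1 (fun L => L h) (diffM df dg)) _.
by apply: etrans (addrC _ _) _; congr (_ + _); exact: mulrC.
Qed.

Lemma diff_sum U n (f : 'I_n -> U -> C) x : (forall i, differentiable (f i) x) ->
  differentiable (fun y => \sum_i f i y) x /\
  forall h, 'd (fun y => \sum_i f i y) x h = \sum_i 'd (f i) x h.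
Proof.
elim: n f => [|n IH] f df.
  have -> : (fun y => \sum_(i < 0) f i y) = (fun=> 0) by apply/funext => y; rewrite big_ord0.
  split; first by have [] := diff_const (0 : C) x.
  by move=> h; rewrite big_ord0; exact: (diff_const (0 : C) x).2.
have [d dE] := IH (fun i => f (lift ord0 i)) (fun i => df _).
have -> : (fun y => \sum_(i < n.+1) f i y) =
    (fun y => f ord0 y + \sum_(i < n) f (lift ord0 i) y).
  by apply/funext => y; rewrite big_ord_recl.
have [d' dE'] := diff_add (df ord0) d; split; first exact: d'.
by move=> h; rewrite big_ord_recl -dE; exact: dE'.
Qed.

(** Product rule for a differential evaluated at a moving point on a moving vector, obtained by
    expanding the vector in the standard basis. With [q] the identity, its vector-valued form below
    differentiates expressions such as ['d P y (X y)] for a vector field X, and the first term is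
    then a second derivative of [P]. *)
Lemma diff_pairing U n (P : 'rV[C]_n -> C) (q k : U -> 'rV[C]_n) x :
  holo_near P (q x) -> differentiable q x -> differentiable k x ->
  differentiable (fun y => 'd P (q y) (k y)) x /\
  forall h, 'd (fun y => 'd P (q y) (k y)) x h =
    'd (fun y => 'd P y (k x)) (q x) ('d q x h) + 'd P (q x) ('d k x h).
Proof.
move=> Px dq dk.
have E (y : 'rV[C]_n) w : 'd P y w = \sum_j w 0 j * 'd P y (delta_mx 0 j).
  by apply: linear_expand => a u v; exact: linearP.
have dPj j := holo_at (holo_near_diff (delta_mx 0 j) Px).
have dPq j := chain dq (dPj j).
have dkj j := diff_coord j dk.
have dM j := diff_mul (dkj j).1 (dPq j).1.
have [d dE] := diff_sum (fun j => (dM j).1).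
have -> : (fun y => 'd P (q y) (k y)) =
    (fun y => \sum_j k y 0 j * 'd P (q y) (delta_mx 0 j)).
  by apply/funext => y; exact: E.
split; first exact: d.
move=> h; apply: etrans (dE h) _.
have dc j := (diff_const (k x 0 j) (q x)).
have cM j := diff_mul (dc j).1 (dPj j).
have [d' dE'] := diff_sum (fun j => (cM j).1).
have -> : (fun y => 'd P y (k x)) =
    (fun y => \sum_j k x 0 j * 'd P y (delta_mx 0 j)).
  by apply/funext => y; exact: E.
apply: etrans _ (congr2 +%R (esym (dE' ('d q x h))) (esym (E (q x) ('d k x h)))).
rewrite -big_split; apply: eq_bigr => j _.
apply: etrans ((dM j).2 h) _; apply: etrans (addrC _ _) _; congr (_ + _).
  apply: etrans _ (esym ((cM j).2 _)).
  apply: etrans _ (esym (congr1 (fun t => t * _ + _) ((dc j).2 _))).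
  rewrite mul0r add0r; congr (_ * _); exact: (dPq j).2.
by congr (_ * _); exact: (dkj j).2.
Qed.

Lemma diff_pairingV U n m (P : 'rV[C]_n -> 'rV[C]_m) (q k : U -> 'rV[C]_n) x :
  holo_near P (q x) -> differentiable q x -> differentiable k x ->
  differentiable (fun y => 'd P (q y) (k y)) x /\
  forall h, 'd (fun y => 'd P (q y) (k y)) x h =
    'd (fun y => 'd P y (k x)) (q x) ('d q x h) + 'd P (q x) ('d k x h).
Proof.
move=> Px dq dk.
have Pj j : holo_near (fun y => P y 0 j) (q x) by exact: holo_near_coord.
have qc := differentiable_continuous dq.
have near j : \forall y \near x, ('d P (q y) (k y)) 0 j =
    'd (fun y => P y 0 j) (q y) (k y).
  have Pq : \forall y \near x, differentiable P (q y) by exact: (qc _ Px).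
  apply: filterS Pq => y dP; exact: (esym ((diff_coord j dP).2 (k y))).
have near2 j : \forall y \near q x, ('d P y (k x)) 0 j =
    'd (fun y => P y 0 j) y (k x).
  by apply: filterS Px => y dP; have [_ ->] := diff_coord j dP.
have main j := diff_pairing (Pj j) dq dk.
have [d dE] := diff_row (fun j => (near_diff (near j) (main j).1).1).
split=> // h; rewrite dE; apply/rowP => j; rewrite mxE.
apply: etrans ((near_diff (near j) (main j).1).2 h) _.
apply: etrans ((main j).2 h) _; rewrite mxE; congr (_ + _).
  have dd := holo_at (holo_near_diffV (k x) Px).
  apply: etrans _ ((diff_coord j dd).2 _).
  exact/esym/((near_diff (near2 j) (holo_at (holo_near_diff (k x) (Pj j)))).2).
exact: (diff_coord j (holo_at Px)).2.
Qed.

Lemma diff_id U (x : U) : differentiable (fun y : U => y) x /\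
  forall h, 'd (fun y : U => y) x h = h.
Proof.
suff [d dE] : differentiable (fun y : U => y) x /\
  'd (fun y : U => y) x = (fun h => h) :> (U -> U) by split=> // h; rewrite dE.
by apply: (affine_diff (K := 1)) => // h; rewrite mul1r.
Qed.

Lemma nm_pair U V (u : U) (v : V) : nm (u, v) <= nm u + nm v.
Proof.
have -> : nm (u, v) = Num.max (nm u) (nm v).
  apply: rc_inj; rewrite -nmE prod_normE /= !nmE.
  by rewrite /Order.max rc_lt; case: ifP.
by rewrite ge_max lerDl lerDr !nm_ge0.
Qed.

Lemma diff_pairr U V (a : U) (y : V) : differentiable (fun y : V => (a, y)) y /\
  forall h, 'd (fun y : V => (a, y)) y h = (0, h).
Proof.
suff [d dE] : differentiable (fun y : V => (a, y)) y /\
  'd (fun y : V => (a, y)) y = (fun h => (0, h)) :> (V -> U * V).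
  by split=> // h; rewrite dE.
apply: (affine_diff (K := 1)) => [b u v|h|x h].
- by rewrite -[LHS]/(0, b *: u + v) -[RHS]/(b *: 0 + 0, b *: u + v) scaler0 addr0.
- by apply: le_trans (nm_pair _ _) _; rewrite nm0 add0r mul1r.
- by rewrite -[RHS]/(a + 0, x + h) addr0.
Qed.

Lemma diff_pairl U V (b : V) (x : U) : differentiable (fun x : U => (x, b)) x /\
  forall h, 'd (fun x : U => (x, b)) x h = (h, 0).
Proof.
suff [d dE] : differentiable (fun x : U => (x, b)) x /\
  'd (fun x : U => (x, b)) x = (fun h => (h, 0)) :> (U -> U * V).
  by split=> // h; rewrite dE.
apply: (affine_diff (K := 1)) => [c u v|h|y h].
- by rewrite -[LHS]/(c *: u + v, 0) -[RHS]/(c *: u + v, c *: 0 + 0) scaler0 addr0.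
- by apply: le_trans (nm_pair _ _) _; rewrite nm0 addr0 mul1r.
- by rewrite -[RHS]/(y + h, b + 0) addr0.
Qed.

End Calculus.

(** * Left-invariant vector fields *)

Section LocalCoordinates.
Context {R : realType} {n : nat} {M : complexManifoldType R n}.
Local Notation C := (Cplx R).
Local Notation E := 'rV[C]_n.
Implicit Types (c d e : chart R n M) (p : M).

Lemma near_chart c p : cdom c p ->
  \forall u \near cmap c p, cdom c (cinv c u) /\ cmap c (cinv c u) = u.
Proof.
move=> cp.
have nc : \forall u \near cmap c p, (cmap c @` cdom c) u.
  by apply: open_nbhs_nbhs; split; [exact: cimg_open|exists p].
by apply: filterS nc => u [q cq <-]; rewrite cmapK.
Qed.

Lemma near_cdom c p : cdom c p -> nbhs p (cdom c).
Proof. by move=> cp; apply: open_nbhs_nbhs; split; [exact: cdom_open|]. Qed.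

Lemma cvg_cinv c p : cdom c p -> cinv c @ cmap c p --> p.
Proof. by move=> cp; have := cinv_continuous cp; rewrite /prop_for /continuous_at cmapK. Qed.

Definition hol_at (f : M -> M) p := {for p, continuous f} /\
  forall c d, atlas c -> atlas d -> cdom c p -> cdom d (f p) ->
    differentiable (cmap d \o f \o cinv c) (cmap c p).

Lemma hol_at_id p : hol_at idfun p.
Proof.
split; first exact: cvg_id.
by move=> c d ac ad cp dp; exact: transition_holomorphic dp.
Qed.

(** The chain rule through any chart [d] at the intermediate point. With [idfun] as one of the two
    maps it is the rule for changing charts. *)
Lemma hol_at_comp (f g : M -> M) p : hol_at f p -> hol_at g (f p) ->
  forall c d e v, atlas c -> atlas d -> atlas e ->
    cdom c p -> cdom d (f p) -> cdom e (g (f p)) ->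
  'd (cmap e \o (g \o f) \o cinv c) (cmap c p) v =
  'd (cmap e \o g \o cinv d) (cmap d (f p)) ('d (cmap d \o f \o cinv c) (cmap c p) v).
Proof.
move=> [fc fd] [gc gd] c d e v ac ad ae cp dp ep.
have df := fd c d ac ad cp dp; have dg := gd d e ad ae dp ep.
have fE : (cmap d \o f \o cinv c) (cmap c p) = cmap d (f p) by rewrite /= cmapK.
rewrite -fE in dg *.
have [dd dE] := chain df dg.
have nE : \forall u \near cmap c p, (cmap e \o (g \o f) \o cinv c) u =
    (cmap e \o g \o cinv d) ((cmap d \o f \o cinv c) u).
  have : \forall u \near cmap c p, cdom d (f (cinv c u)).
    exact: (cvg_cinv cp (fc _ (near_cdom dp))).
  by apply: filterS => u du /=; rewrite cmapK.
exact: (etrans ((near_diff nE dd).2 v) (dE v)).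
Qed.

Lemma diff_chart_id c p v : atlas c -> cdom c p -> 'd (cmap c \o idfun \o cinv c) (cmap c p) v = v.
Proof.
move=> ac cp; have nE : \forall u \near cmap c p, (cmap c \o idfun \o cinv c) u = u.
  by apply: filterS (near_chart cp) => u [].
have [d1 d2] := diff_id (cmap c p).
by apply: etrans ((near_diff nE d1).2 v) (d2 v).
Qed.

End LocalCoordinates.

(** * The group operations in charts *)

Section LieGroupCoordinates.
Context {R : realType} {n : nat} {G : complexLieGroupType R n}.
Local Notation C := (Cplx R).
Local Notation E := 'rV[C]_n.
Implicit Types (c d e : chart R n G) (a b p : G).

(** [holomorphic2] speaks of one point at a time. Chart domains are open and multiplication is
    continuous, so the same charts serve at all nearby points. *)
Lemma mulg_holo c c' d a b : atlas c -> atlas c' -> atlas d ->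
  cdom c a -> cdom c' b -> cdom d (a * b)%g ->
  holo_near (fun z : E * E => cmap d (cinv c z.1 * cinv c' z.2)%g) (cmap c a, cmap c' b).
Proof.
move=> ac ac' ad ca cb dab.
have [mc md] := @mulg_holomorphic R n G.
have n1 : \forall z \near (cmap c a, cmap c' b), cdom c (cinv c z.1) /\ cmap c (cinv c z.1) = z.1.
  exact: (cvg_fst (near_chart ca)).
have n2 : \forall z \near (cmap c a, cmap c' b), cdom c' (cinv c' z.2) /\ cmap c' (cinv c' z.2) = z.2.
  exact: (cvg_snd (near_chart cb)).
have n3 : \forall z \near (cmap c a, cmap c' b), cdom d (cinv c z.1 * cinv c' z.2)%g.
  have h1 : (fun z : E * E => cinv c z.1) @ (cmap c a, cmap c' b) --> a.
    by apply: cvg_comp (cvg_cinv ca); exact: cvg_fst.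
  have h2 : (fun z : E * E => cinv c' z.2) @ (cmap c a, cmap c' b) --> b.
    by apply: cvg_comp (cvg_cinv cb); exact: cvg_snd.
  have h4 : (fun z : E * E => (cinv c z.1 * cinv c' z.2)%g) @ (cmap c a, cmap c' b)
      --> (a * b)%g.
    have h3 : (fun z : E * E => (cinv c z.1, cinv c' z.2)) @ (cmap c a, cmap c' b)
        --> (a, b) by exact: cvg_pair.
    exact: (@cvg_comp _ _ _ (fun z : E * E => (cinv c z.1, cinv c' z.2))
      (fun xy : G * G => (xy.1 * xy.2)%g) _ _ _ h3 (mc (a, b))).
  exact: (h4 _ (near_cdom dab)).
apply: filterS3 n1 n2 n3 => z [z1 e1] [z2 e2] z3.
have := md c c' d _ _ ac ac' ad z1 z2 z3; rewrite e1 e2.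
by case: z {z1 z2 z3 e1 e2}.
Qed.

Lemma hol_at_left a p : hol_at (left_translation a : G -> G) p.
Proof.
have [mc md] := @mulg_holomorphic R n G.
split.
  have h : (fun x : G => (a, x)) @ p --> (a, p).
    by apply: cvg_pair; [exact: cvg_cst|exact: cvg_id].
  exact: (@cvg_comp _ _ _ (fun x : G => (a, x))
    (fun xy : G * G => (xy.1 * xy.2)%g) _ _ _ h (mc (a, p))).
move=> c d ac ad cp dp.
have [aa da] := (chart_at_atlas a, chart_at_dom a).
have H := holo_at (mulg_holo aa ac ad da cp dp).
have [d1 _] := diff_pairr (cmap (chart_at a) a) (cmap c p).
have [dd _] := chain d1 H.
suff -> : cmap d \o left_translation a \o cinv c =
  (fun y => cmap d (cinv (chart_at a) (cmap (chart_at a) a, y).1 * cinv c (cmap (chart_at a) a, y).2)%g).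
  exact: dd.
by apply/funext => y /=; rewrite cmapK.
Qed.

Lemma left_translationM a b : left_translation (a * b)%g = left_translation a \o left_translation b :> (G -> G).
Proof. by apply/funext => x; rewrite /left_translation /= mulgA. Qed.

Lemma left_translation1 : left_translation 1%g = idfun :> (G -> G).
Proof. by apply/funext => x; rewrite /left_translation mul1g. Qed.

Lemma invg_holo c d a : atlas c -> atlas d -> cdom c a -> cdom d (a^-1)%g ->
  holo_near (fun z : E => cmap d (cinv c z)^-1%g) (cmap c a).
Proof.
move=> ac ad ca da; have [ic id] := @invg_holomorphic R n G.
have n2 : \forall z \near cmap c a, cdom d (cinv c z)^-1%g.
  exact: (cvg_cinv ca (ic a _ (near_cdom da))).
apply: filterS2 (near_chart ca) n2 => z [z1 e1] z2.
by have := id c d _ ac ad z1 z2; rewrite e1.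
Qed.

End LieGroupCoordinates.

Lemma holo_near_all (R : realType) (U V : normedModType (Cplx R)) (f : U -> V) (x : U) :
  (forall y, differentiable f y) -> holo_near f x.
Proof. by move=> df; apply/near_nmP; exists 1; [exact: ltr01|move=> y _; exact: df]. Qed.

(** * Left-invariant fields and the Jacobi identity *)

Section LeftInvariantFields.
Context {R : realType} {n : nat} {G : complexLieGroupType R n}.
Local Notation C := (Cplx R).
Local Notation E := 'rV[C]_n.
Implicit Types (c d e : chart R n G) (a b p : G) (u v w x : E).

Definition c1 : chart R n G := chart_at (1%g : G).
Definition e1 : E := cmap c1 (1%g : G).

Lemma c1_atlas : atlas c1. Proof. exact: chart_at_atlas. Qed.
Lemma c1_dom : cdom c1 (1%g : G). Proof. exact: chart_at_dom. Qed.

(** Multiplication with the second factor near 1: then the product stays close to the first factor,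
    and one chart [c] serves both. *)
Definition muc c (z : E * E) : E := cmap c (cinv c z.1 * cinv c1 z.2)%g.

(* The left-invariant field with value w at 1, in the chart c. *)
Definition Xf c w x : E := 'd (muc c) (x, e1) (0, w).

Lemma muc_holo c a b : atlas c -> cdom c a -> cdom c1 b -> cdom c (a * b)%g ->
  holo_near (muc c) (cmap c a, cmap c1 b).
Proof. by move=> ac ca cb cab; exact: (mulg_holo ac c1_atlas ac ca cb cab). Qed.

Lemma muc_holo1 c a : atlas c -> cdom c a -> holo_near (muc c) (cmap c a, e1).
Proof. by move=> ac ca; apply: muc_holo c1_dom _ => //; rewrite mulg1. Qed.

(** A left-invariant field is a partial derivative of the group law. This is where derivatives of
    holomorphic maps have to be holomorphic. *)
Lemma Xf_holo c a w : atlas c -> cdom c a -> holo_near (Xf c w) (cmap c a).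
Proof.
move=> ac ca.
have pl : holo_near (fun x : E => (x, e1)) (cmap c a).
  by apply: holo_near_all => x; exact: (diff_pairl e1 x).1.
exact: (holo_near_comp pl (holo_near_diffV (0, w) (muc_holo1 ac ca))).
Qed.

Lemma muc_left c p : cdom c p ->
  (fun y => muc c (cmap c p, y)) = cmap c \o left_translation p \o cinv c1.
Proof. by move=> cp; apply/funext => y; rewrite /muc /= cmapK. Qed.

Lemma left_holo c p : atlas c -> cdom c p ->
  holo_near (cmap c \o left_translation p \o cinv c1) e1.
Proof.
move=> ac cp; rewrite -muc_left //.
have pr : holo_near (fun y : E => (cmap c p, y)) e1.
  by apply: holo_near_all => y; exact: (diff_pairr (cmap c p) y).1.
exact: (holo_near_comp pr (muc_holo1 ac cp)).
Qed.

Lemma Xf_left c p w : atlas c -> cdom c p ->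
  Xf c w (cmap c p) = 'd (cmap c \o left_translation p \o cinv c1) e1 w.
Proof.
move=> ac cp; rewrite -muc_left //.
have [d1 d2] := diff_pairr (cmap c p) e1.
have [_ d3] := chain d1 (holo_at (muc_holo1 ac cp)).
apply: etrans _ (esym (d3 w)); rewrite /Xf.
by congr ('d (muc c) _ _); exact: esym (d2 w).
Qed.

Lemma Xf_linear c (k : C) u v x : Xf c (k *: u + v) x = k *: Xf c u x + Xf c v x.
Proof.
rewrite /Xf; have -> : (0, k *: u + v) = k *: (0, u) + (0, v) :> E * E.
  by rewrite -[RHS]/(k *: 0 + 0, k *: u + v) scaler0 addr0.
exact: linearP.
Qed.

Lemma Xf_1 w : Xf c1 w e1 = w.
Proof.
rewrite Xf_left; [|exact: c1_atlas|exact: c1_dom].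
by rewrite left_translation1 diff_chart_id //; [exact: c1_atlas|exact: c1_dom].
Qed.

Lemma left_translation_1 p : left_translation p (1%g : G) = p.
Proof. exact: mulg1. Qed.

Lemma vf_coord_left c p w : atlas c -> cdom c p ->
  vf_coord c (left_invariant_field w) (cmap c p) = Xf c w (cmap c p).
Proof.
move=> ac cp; rewrite Xf_left // /vf_coord cmapK //.
rewrite /chart_change /left_invariant_field /tangent_map.
have e := left_translation_1 p.
have [aq dq] := (chart_at_atlas (left_translation p (1%g : G)),
                 chart_at_dom (left_translation p (1%g : G))).
have cq : cdom c (left_translation p (1%g : G)) by rewrite e.
have := hol_at_comp (hol_at_left p (1%g : G)) (hol_at_id _) w c1_atlas aq ac c1_dom dq cq.
have ci : cmap c \o idfun = cmap c :> (G -> E) by [].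
have fi : idfun \o left_translation p = left_translation p :> (G -> G) by [].
by rewrite ci fi e => H; apply: etrans (esym H); reflexivity.
Qed.

(* Differentiation of x (y z) = (x y) z in z at z = 1. *)
Lemma Xf_mulg c a b w : atlas c -> cdom c a -> cdom c1 b -> cdom c (a * b)%g ->
  'd (cmap c \o left_translation a \o cinv c1) (cmap c1 b) (Xf c1 w (cmap c1 b)) =
  Xf c w (cmap c (a * b)%g).
Proof.
move=> ac ca cb cab; rewrite !Xf_left //; last exact: c1_atlas.
rewrite left_translationM.
have e := left_translation_1 b.
have cb' : cdom c1 (left_translation b (1%g : G)) by rewrite e.
have cab' : cdom c (left_translation a (left_translation b (1%g : G))) by rewrite e.
have H := hol_at_comp (hol_at_left b (1%g : G)) (hol_at_left a _) w c1_atlas c1_atlas ac c1_dom cb' cab'.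
by rewrite e in H; exact: esym H.
Qed.

(** The derivative at 1, in direction [v], of the left-invariant field of [w]. It depends on the
    chart [c1], but its antisymmetrisation is the Lie bracket ([bracketE]). *)
Definition beta w v : E := 'd (Xf c1 w) e1 v.

(** Left translation [P] by [a] carries the field [Xf c1 w] to [Xf c w]; that identity is
    differentiated at 1 in direction [v]. The first term on the right is a second derivative of [P],
    symmetric in [v] and [w], so it drops out of the commutator in [lie_identity]. *)
Lemma lie_identity0 c a v w : atlas c -> cdom c a ->
  'd (Xf c w) (cmap c a) (Xf c v (cmap c a)) =
  'd (fun y => 'd (cmap c \o left_translation a \o cinv c1) y w) e1 v +
  Xf c (beta w v) (cmap c a).
Proof.
move=> ac ca; set P := cmap c \o left_translation a \o cinv c1.
have Ph : holo_near P e1 by exact: left_holo.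
have Pe : P e1 = cmap c a by rewrite /P /= cmapK; [rewrite left_translation_1|exact: c1_dom].
have nE : \forall y \near e1, 'd P y (Xf c1 w y) = Xf c w (P y).
  have n1 : \forall y \near e1, cdom c (a * cinv c1 y)%g.
    have := @cvg_cinv _ _ _ c1 _ c1_dom.
    have [+ _] := hol_at_left a (1%g : G) => lc h.
    have h2 : left_translation a @ (1%g : G) --> a by have := lc; rewrite /prop_for /continuous_at left_translation_1.
    exact: (h _ (h2 _ (near_cdom ca))).
  apply: filterS2 (near_chart c1_dom) n1 => y [y1 y2] y3.
  have := Xf_mulg w ac ca y1 y3; rewrite y2 => H.
  exact: H.
have dX := holo_at (Xf_holo w c1_atlas c1_dom).
have dXc := holo_at (Xf_holo w ac ca).
have [d1 d2] := diff_pairingV (q := fun y => y) Ph (diff_id e1).1 dX.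
rewrite -Pe in dXc.
have [d3 d4] := chain (holo_at Ph) dXc.
have key := etrans (esym (d2 v)) (etrans ((near_diff nE d3).2 v) (d4 v)).
have XP u : Xf c u (cmap c a) = 'd P e1 u by exact: Xf_left.
rewrite !XP -Pe; apply: etrans (esym key) _; congr (_ + _).
rewrite (_ : Xf c1 w e1 = w); last exact: Xf_1.
by congr ('d _ _ _); exact: (diff_id e1).2.
Qed.

Lemma lie_identity c a v w : atlas c -> cdom c a ->
  'd (Xf c w) (cmap c a) (Xf c v (cmap c a)) -
  'd (Xf c v) (cmap c a) (Xf c w (cmap c a)) =
  Xf c (beta w v - beta v w) (cmap c a).
Proof.
move=> ac ca; have sym := diff_diffCV w v (left_holo ac ca).
apply: etrans (congr2 (fun x y => x - y) (lie_identity0 v w ac ca)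
  (lie_identity0 w v ac ca)) _.
apply: etrans (congr1 (fun z => z + _ - _) sym) _.
have -> : beta w v - beta v w = (-1) *: beta v w + beta w v by rewrite scaleN1r addrC.
by rewrite Xf_linear scaleN1r opprD addrACA subrr add0r addrC.
Qed.

Local Notation br := (@lie_group_bracket R n G).

Lemma bracketE v w : br v w = beta w v - beta v w :> E.
Proof.
have near w' : \forall x \near e1, vf_coord c1 (left_invariant_field w') x = Xf c1 w' x.
  apply: filterS (near_chart c1_dom) => x [x1 x2].
  by have := vf_coord_left w' c1_atlas x1; rewrite x2.
have val w' : left_invariant_field w' (1%g : G) = w'.
  rewrite /left_invariant_field /tangent_map left_translation_1 left_translation1.
  by apply: diff_chart_id; [exact: c1_atlas|exact: c1_dom].
have dv w' u : 'd (vf_coord c1 (left_invariant_field w')) e1 u = beta w' u.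
  exact: (near_diff (near w') (holo_at (Xf_holo w' c1_atlas c1_dom))).2.
rewrite /lie_group_bracket /vf_bracket !val.
exact: (congr2 (fun x y : E => x - y) (dv w v) (dv v w)).
Qed.

Lemma beta_linearr (k : C) w u v : beta w (k *: u + v) = k *: beta w u + beta w v.
Proof. exact: linearP. Qed.

Lemma beta_linearl (k : C) w u v : beta (k *: u + w) v = k *: beta u v + beta w v.
Proof.
have du := holo_at (Xf_holo u c1_atlas c1_dom).
have dw := holo_at (Xf_holo w c1_atlas c1_dom).
rewrite /beta; have -> : Xf c1 (k *: u + w) = (fun x => k *: Xf c1 u x + Xf c1 w x).
  by apply/funext => x; exact: Xf_linear.
have dk := differentiableZ k du.
apply: etrans ((diff_add dk dw).2 v) _; congr (_ + _).
exact: (congr1 (fun L => L v) (diffZ k du)).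
Qed.

Lemma bracket_linearl (k : C) u v w :
  br (k *: u + v) w = k *: br u w + br v w :> E.
Proof.
rewrite !bracketE beta_linearr beta_linearl opprD addrACA scalerBr.
by [].
Qed.

Lemma bracketC v w : br v w = - br w v :> E.
Proof. by rewrite !bracketE opprB. Qed.

(** [lie_identity] holds at every point near 1, so it can be differentiated at 1 in direction
    [u]. *)
Lemma jacobi_beta u v w :
  'd (fun x => 'd (Xf c1 w) x v) e1 u + beta w (beta v u) -
  ('d (fun x => 'd (Xf c1 v) x w) e1 u + beta v (beta w u)) =
  beta (beta w v - beta v w) u.
Proof.
have hX w' : holo_near (Xf c1 w') e1 := Xf_holo w' c1_atlas c1_dom.
have nE : \forall x \near e1, 'd (Xf c1 w) x (Xf c1 v x) + (-1) *: 'd (Xf c1 v) x (Xf c1 w x) =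
    Xf c1 (beta w v - beta v w) x.
  apply: filterS (near_chart c1_dom) => x [x1 x2].
  by have := lie_identity v w c1_atlas x1; rewrite x2 scaleN1r.
have pair w' v' := diff_pairingV (q := fun y => y) (hX w') (diff_id e1).1 (holo_at (hX v')).
have [d1 E1] := pair w v; have [d2 E2] := pair v w.
have d2' := differentiableZ (-1) d2.
have dX := holo_at (hX (beta w v - beta v w)).
have pE w' v' : 'd (fun y => 'd (Xf c1 w') y (Xf c1 v' y)) e1 u =
    'd (fun x => 'd (Xf c1 w') x v') e1 u + beta w' (beta v' u).
  apply: etrans ((pair w' v').2 u) _; congr (_ + _).
  rewrite (_ : Xf c1 v' e1 = v'); last exact: Xf_1.
  by congr ('d _ _ _); exact: (diff_id e1).2.
apply: etrans (congr2 (fun x y : E => x - y) (esym (pE w v)) (esym (pE v w))) _.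
apply: etrans _ ((near_diff nE dX).2 u).
apply: etrans _ (esym ((diff_add d1 d2').2 u)); congr (_ + _).
apply: etrans (esym (scaleN1r _)) _.
exact: esym (congr1 (fun L => L u) (diffZ (-1) d2)).
Qed.

(** In the cyclic sum of [jacobi_beta] the second derivatives of the fields, abstracted as [S],
    cancel by symmetry in their last two arguments, and the nested [beta] terms cancel in pairs. *)
Lemma bracket_jacobi u v w :
  br u (br v w) +
  br v (br w u) +
  br w (br u v) = 0 :> E.
Proof.
have [S [SC J]] : exists S : E -> E -> E -> E, (forall w v u, S w v u = S w u v) /\
    forall u v w, S w v u + beta w (beta v u) - (S v w u + beta v (beta w u)) =
      beta (beta w v - beta v w) u.
  exists (fun w v u => 'd (fun x => 'd (Xf c1 w) x v) e1 u); split.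
    by move=> w' v' u'; exact: diff_diffCV (Xf_holo w' c1_atlas c1_dom).
  exact: jacobi_beta.
have bB z x y : beta z (x - y) = beta z x - beta z y.
  by rewrite -[x - y]addrC -scaleN1r beta_linearr scaleN1r addrC.
rewrite !bracketE -(J u v w) -(J v w u) -(J w u v) !bB.
rewrite (SC w v u) (SC v u w) (SC u w v).
move: (S w u v) (S v w u) (S u v w) (beta w (beta v u)) (beta v (beta w u))
  (beta u (beta w v)) (beta u (beta v w)) (beta w (beta u v)) (beta v (beta u w)).
by clear => s1 s2 s3 b1 b2 b3 b4 b5 b6; apply/rowP => j; rewrite !mxE; ring.
Qed.

End LeftInvariantFields.

(** * Engel's theorem *)

Section Engel.
Context {K : fieldType} {n : nat}.
Local Notation E := 'rV[K]_n.
Context (br : E -> E -> E).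
Context (br_linearl : forall (k : K) u v w, br (k *: u + v) w = k *: br u w + br v w).
Context (brC : forall v w, br v w = - br w v).
Context (br_alt : forall v, br v v = 0).
Context (br_jacobi : forall u v w, br u (br v w) + br v (br w u) + br w (br u v) = 0).
Context (br_nil : forall x, exists m, forall y, iter m (br x) y = 0).
Implicit Types (L A B : {vspace E}) (x y z : E).

Let br_linearr (k : K) u v w : br w (k *: u + v) = k *: br w u + br w v.
Proof. by rewrite brC br_linearl opprD -scalerN -!brC. Qed.

Let brDl u v w : br (u + v) w = br u w + br v w.
Proof. by have := br_linearl 1 u v w; rewrite !scale1r. Qed.

Let brDr u v w : br w (u + v) = br w u + br w v.
Proof. by have := br_linearr 1 u v w; rewrite !scale1r. Qed.

Let br0 w : br 0 w = 0.
Proof. by have := br_linearl (-1) 0 0 w; rewrite !scaleN1r oppr0 addr0 addNr. Qed.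

Let brZl k u w : br (k *: u) w = k *: br u w.
Proof. by rewrite -[k *: u]addr0 br_linearl br0 addr0. Qed.

Let brNr u w : br w (- u) = - br w u.
Proof. by rewrite brC -[- u]scaleN1r brZl scaleN1r opprK (brC w) opprK. Qed.

Let brZr k u w : br w (k *: u) = k *: br w u.
Proof. by rewrite brC brZl -scalerN -brC. Qed.

Let br_deriv x y z : br x (br y z) = br (br x y) z + br y (br x z).
Proof.
have /eqP := br_jacobi x y z; rewrite -addrA addr_eq0 => /eqP ->.
by rewrite opprD (brC z x) brNr opprK (brC z) opprK addrC.
Qed.

Definition subalgebra L := forall x y, x \in L -> y \in L -> br x y \in L.

(** A vector of M / N killed by [L], stated for the pair [M], [N] so that no quotient is formed. By
    induction on the dimension of [L], the hypothesis is used twice for a proper subalgebra [H] of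
    maximal dimension: on L / H, which yields a complement of [H] that normalises it, and on M /
    N. *)
Lemma engel_section L (M N : {vspace E}) : subalgebra L ->
  (forall x y, x \in L -> y \in M -> br x y \in M) ->
  (forall x y, x \in L -> y \in N -> br x y \in N) ->
  ~~ (M <= N)%VS ->
  exists v, [/\ v \in M, v \notin N & forall x, x \in L -> br x v \in N].
Proof.
have [m] := ubnP (\dim L); elim: m L M N => // m IH L M N dL sL sM sN nMN.
have [L0|L0] := eqVneq L 0%VS.
  have /subvPn[v vM vN] := nMN; exists v; split=> // x.
  by rewrite L0 memv0 => /eqP ->; rewrite br0 mem0v.
pose proper d := exists H : {vspace E}, [/\ (H <= L)%VS, H != L, subalgebra H & \dim H = d].
have ex0 : exists d, `[< proper d >].
  exists 0%N; apply/asboolP; exists 0%VS; split; rewrite ?sub0v ?dimv0 //.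
    by rewrite eq_sym.
  by move=> x y; rewrite !memv0 => /eqP ->; rewrite br0.
have bnd d : `[< proper d >] -> (d <= \dim L)%N.
  by move=> /asboolP[H [HL _ _ <-]]; exact: dimvS.
case: (ex_maxnP ex0 bnd) => d /asboolP[H [HL nHL sH dH]] dmax.
have dHL : (\dim H < \dim L)%N.
  by rewrite ltn_neqAle dimvS // andbT; apply: contra nHL => /eqP e; rewrite eqEdim HL e leqnn.
have HdL x : x \in H -> x \in L by move/subvP: HL; apply.
have nLH : ~~ (L <= H)%VS.
  by apply: contra nHL => LH; apply/eqP/subv_anti; rewrite HL.
(* [H] acts on L / H. A vector killed there normalises [H], so adding it to [H] gives a larger
   subalgebra, which by maximality is [L]. *)
have [z [zL zH zN]] := IH H L H (leq_trans dHL dL) sH (fun x y xH => sL x y (HdL x xH)) sH nLH.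
have HzL : (H + <[z]>)%VS = L.
  apply/eqP; apply: contraT => nHz.
  have sub : (H + <[z]> <= L)%VS by rewrite subv_add HL -memvE.
  have sHz : subalgebra (H + <[z]>)%VS.
    move=> x y /memv_addP[x1 x1H [_ /vlineP[k ->] ->]] /memv_addP[y1 y1H [_ /vlineP[l ->] ->]].
    rewrite brDl !brDr !brZl !brZr br_alt !scaler0 addr0.
    have HzS : (H <= H + <[z]>)%VS by exact: addvSl.
    apply: (subvP HzS); rewrite !memvD //; [exact: sH|apply: memvZ; exact: zN|].
    by apply: memvZ; rewrite brC memvN; exact: zN.
  have : `[< proper (\dim (H + <[z]>)) >].
    by apply/asboolP; exists (H + <[z]>)%VS.
  move=> /dmax; rewrite leqNgt => /negP; case; rewrite -dH ltnNge; apply: contra zH => le.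
  have /eqP HE : H == (H + <[z]>)%VS by rewrite eqEdim addvSl.
  by rewrite HE; apply: (subvP (addvSr _ _)); exact: memv_line.
have [w0 [w0M w0N w0P]] := IH H M N (leq_trans dHL dL) sH
  (fun x y xH => sM x y (HdL x xH)) (fun x y xH => sN x y (HdL x xH)) nMN.
(* Vectors of [M] that [H] kills modulo [N] are stable under [br z], because [z] normalises [H]. By
   nilpotency the iterates reach [N], and the last one outside [N] is killed by [z] too. *)
have inv i : iter i (br z) w0 \in M /\ forall x, x \in H -> br x (iter i (br z) w0) \in N.
  elim: i => [|i [IM IN]]; first by split.
  split; first exact: sM.
  move=> x xH /=; rewrite br_deriv memvD //; first by apply: IN; exact: zN.
  by apply: sN => //; exact: IN.
have exj : exists i, iter i (br z) w0 \in N.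
  by have [i iP] := br_nil z; exists i; rewrite iP mem0v.
case: (ex_minnP exj) => -[|i] iN imin; first by rewrite iN in w0N.
exists (iter i (br z) w0); have [IM IN] := inv i; split=> //.
  by apply/negP => /imin; rewrite ltnn.
move=> x; rewrite -HzL => /memv_addP[h hH [_ /vlineP[k ->] ->]].
by rewrite brDl brZl memvD ?memvZ //; exact: IN.
Qed.

Lemma engel_center : (0 < n)%N -> exists2 v : E, v != 0 & forall x, br x v = 0.
Proof.
move=> n0; have nf : ~~ ({:E} <= 0)%VS.
  by rewrite subv0 -dimv_eq0 dimvf /dim /= mul1n -lt0n.
have s0 x y : x \in fullv -> y \in 0%VS -> br x y \in 0%VS.
  by move=> _; rewrite !memv0 => /eqP ->; rewrite brC br0 oppr0.
have [v [_ v0 vP]] := @engel_section fullv fullv 0%VS (fun _ _ _ _ => memvf _)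
  (fun _ _ _ _ => memvf _) s0 nf.
exists v; first by rewrite -memv0.
by move=> x; apply/eqP; rewrite -memv0; apply: vP; exact: memvf.
Qed.

End Engel.

(** * A nonzero eigenvalue, and a symmetric form with a prescribed row *)

Section NonNilpotent.
Context {K : numClosedFieldType} {n : nat}.
Local Notation E := 'rV[K]_n.

(** If 0 were the only eigenvalue, the characteristic polynomial would be a power of ['X] and
    Cayley-Hamilton would make [A] nilpotent. Since [A] acts on rows from the right, the column
    [phi] is a linear form, an eigenvector of the transpose. *)
Lemma nonnilpotent_eigenvector (A : 'M[K]_n) :
  ~ (exists m, forall y : E, iter m (mulmxr A) y = 0) ->
  exists2 lam : K, lam != 0 & exists2 phi : 'cV[K]_n, phi != 0 & A *m phi = lam *: phi.
Proof.
case: n A => [|m] A nn.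
  by case: nn; exists 0%N => y; apply/rowP => -[].
have [[lam lam0 ev]|all0] := pselect (exists2 lam, lam != 0 & eigenvalue A^T lam).
  exists lam => //; have [v vE v0] := eigenvalueP ev.
  exists v^T; first by rewrite -trmx0 (inj_eq trmx_inj).
  by rewrite -[A]trmxK -trmx_mul vE linearZ.
case: nn; exists m.+1 => y.
have itE k (z : 'rV[K]_m.+1) : iter k (mulmxr A) z = z *m A ^+ k.
  elim: k z => [|k IHk] z; first by rewrite expr0 mulmx1.
  by rewrite iterS IHk /mulmxr /= -mulmxA exprSr.
rewrite itE; suff -> : A ^+ m.+1 = 0 by rewrite mulmx0.
have [r rE] := closed_field_poly_normal (char_poly A).
have := monicP (char_poly_monic A); move=> lc; rewrite lc scale1r in rE.
have r0 : all (pred1 0) r.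
  apply/allP => x xr /=; apply: contraT => x0; case: all0; exists x => //.
  rewrite eigenvalue_root_char; have -> : char_poly A^T = char_poly A.
    by rewrite /char_poly -[RHS]det_tr; congr (\det _); apply/matrixP => k l; rewrite !mxE eq_sym.
  by rewrite rE root_prod_XsubC.
have rs : size r = m.+1.
  by have := size_char_poly A; rewrite rE size_prod_XsubC => -[].
have cE : char_poly A = 'X^(m.+1).
  rewrite rE -rs (eq_big_seq (fun=> 'X)) => [|z /(allP r0)/eqP ->]; last by rewrite subr0.
  by rewrite big_const_seq count_predT; elim: (size r) => // k IHk; rewrite iterS IHk exprS.
by have := Cayley_Hamilton A; rewrite cE rmorphXn /= horner_mx_X.
Qed.

(** The form is built in a basis whose first vector is [e0 *m U], proportional to [x]. Its first row
    has to be [psi], that is [phi] in this basis, rescaled by [a^-1] because x is [a] times that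
    vector. As phi vanishes on x, the entry [psi 0 0] is 0 and some other entry [j] is not. *)
Lemma form_with_row (x : E) (phi : 'cV[K]_n) : x != 0 -> phi != 0 -> x *m phi = 0 ->
  exists S : 'M[K]_n, [/\ S^T = S, S \in unitmx & x *m S = phi^T].
Proof.
move=> x0 phi0 xphi; case: n x phi x0 phi0 xphi => [|m] x phi x0 phi0 xphi.
  by move: x0; rewrite (_ : x = 0) ?eqxx //; apply/rowP => -[].
pose U := row_ebase x; have Uu : U \in unitmx := row_ebase_unit x.
have rx : \rank x = 1%N by apply/eqP; rewrite eqn_leq rank_leq_row lt0n mxrank_eq0.
pose e0 : 'rV[K]_m.+1 := delta_mx 0 0.
have [a a0 xE] : exists2 a : K, a != 0 & x = a *: (e0 *m U).
  pose a := col_ebase x 0 0.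
  have xE : x = a *: (e0 *m U).
    rewrite -{1}[x]mulmx_ebase rx -/U scalemxAl; congr (_ *m _).
    apply/rowP => j; rewrite !mxE big_ord1 !mxE /= -/a; congr (_ * _).
    by case: j => -[|j] jm; rewrite ?eqxx.
  by exists a => //; apply: contra_neq x0 => a0; rewrite xE a0 scale0r.
have [psi psiE] : exists psi : 'rV[K]_m.+1, psi = a^-1 *: (phi^T *m U^T) by eexists.
have psi0 : psi 0 0 = 0.
  have h : a *: (e0 *m (U *m phi)) = 0 by rewrite mulmxA scalemxAl -xE.
  have /eqP := h; rewrite scaler_eq0 (negPf a0) /= => /eqP/matrixP/(_ 0 0).
  rewrite -[e0 *m _]rowE [RHS]mxE mxE => h0.
  have -> : psi = a^-1 *: (U *m phi)^T by rewrite psiE trmx_mul.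
  by rewrite mxE mxE h0 mulr0.
have psin : psi != 0.
  have -> : psi = a^-1 *: (U *m phi)^T by rewrite psiE trmx_mul.
  rewrite scaler_eq0 invr_eq0 (negPf a0) /= -trmx0 (inj_eq trmx_inj).
  by apply: contra phi0 => /eqP h; rewrite -[phi](mulKmx Uu) h mulmx0.
have [j pj] : exists j, psi 0 j != 0.
  by apply/existsP; apply: contraNT psin => /existsPn h; apply/eqP/rowP => k;
    rewrite mxE; have := h k; rewrite negbK => /eqP.
have j0 : j != 0 by apply: contra_neq pj => ->.
(* Row and column 0 are [psi], the rest is the identity with entry (j, j) erased. So 0 and [j] pair
   off as in a hyperbolic plane: for v in the kernel, column [j] gives v 0 = 0, column k gives v k =
   0 for the remaining k, and column 0 then gives v j = 0. *)
pose S' : 'M[K]_m.+1 := \matrix_(k, l)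
  if k == 0 then psi 0 l else if l == 0 then psi 0 k else ((k == l) && (k != j))%:R.
have S'T : S'^T = S'.
  apply/matrixP => k l; rewrite !mxE; have [->|k0] := eqVneq k 0.
    by have [->|] := eqVneq l 0.
  have [//|l0] := eqVneq l 0.
  by have [->|] := eqVneq k l.
have S'u : S' \in unitmx.
  rewrite -row_free_unit; apply: inj_row_free => v vS.
  have col l : \sum_k v 0 k * S' k l = 0 by have /matrixP/(_ 0 l) := vS; rewrite !mxE.
  have v0 : v 0 0 = 0.
    have := col j; rewrite (bigD1 0) //= big1 => [|k k0].
      by rewrite addr0 !mxE eqxx => /eqP; rewrite mulf_eq0 (negPf pj) orbF => /eqP.
    by rewrite !mxE (negPf k0) (negPf j0); have [->|] := eqVneq k j; rewrite /= ?eqxx mulr0.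
  have vk k : k != 0 -> k != j -> v 0 k = 0.
    move=> k0 kj; have := col k; rewrite (bigD1 k) //= big1 => [|l lk].
      by rewrite addr0 !mxE (negPf k0) eqxx kj mulr1.
    rewrite !mxE; have [->|l0] := eqVneq l 0; first by rewrite v0 mul0r.
    by rewrite (negPf k0) (negPf lk) mulr0.
  have vj : v 0 j = 0.
    have := col 0; rewrite (bigD1 j) //= big1 => [|l lj].
      by rewrite addr0 !mxE (negPf j0) eqxx => /eqP; rewrite mulf_eq0 (negPf pj) orbF => /eqP.
    by have [->|l0] := eqVneq l 0; rewrite ?v0 ?(vk _ l0 lj) mul0r.
  apply/rowP => k; rewrite mxE; have [->|k0] := eqVneq k 0 => //.
  by have [->|kj] := eqVneq k j => //; exact: vk.
have S'0 : e0 *m S' = psi by rewrite -rowE; apply/rowP => l; rewrite !mxE eqxx.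
exists (invmx U *m S' *m (invmx U)^T); split.
- by rewrite !trmx_mul trmxK S'T mulmxA.
- by rewrite !unitmx_mul unitmx_tr unitmx_inv Uu S'u.
rewrite xE -scalemxAl !mulmxA mulmxK // S'0 psiE -scalemxAl scalerA divff // scale1r.
by rewrite -mulmxA -trmx_mul mulVmx // trmx1 mulmx1.
Qed.

End NonNilpotent.

(** * The vector, the eigenvalue and the form in a semisimple algebra *)

Section SemisimpleData.
Context {R : realType} {n : nat} {G : complexLieGroupType R n}.
Local Notation C := (Cplx R).
Local Notation E := 'rV[C]_n.
Local Notation br := (@lie_group_bracket R n G).

Lemma bracket_alt (v : E) : br v v = 0.
Proof. by rewrite bracketE subrr. Qed.

Lemma bracket0l (w : E) : br 0 w = 0.
Proof.
have := @bracket_linearl R n G (-1) 0 0 w; rewrite scaler0 addr0 => ->.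
by rewrite scaleN1r addNr.
Qed.

(** If every ad_x were nilpotent, Engel's theorem would give a nonzero central vector. The line it
    spans is an ideal on which the bracket vanishes, hence solvable in one step, against
    semisimplicity. *)
Lemma semisimple_nonnilpotent : semisimple G ->
  exists x : E, ~ exists m, forall y, iter m (br x) y = 0.
Proof.
move=> [[v0 v0n] ss]; apply: contrapT => /forallNP allnil.
have nil x : exists m, forall y, iter m (br x) y = 0 by apply: contrapT; exact: allnil.
have n0 : (0 < n)%N.
  rewrite lt0n; apply: contra_neq v0n => n0; apply/rowP => -[j jn]; exfalso; by rewrite n0 in jn.
have [v vn vP] := engel_center bracket_linearl bracketC bracket_alt bracket_jacobi nil n0.
have bZ k x : br x (k *: v) = 0.
  rewrite bracketC -[k *: v]addr0 bracket_linearl bracketC vP oppr0 scaler0 add0r.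
  by rewrite bracket0l oppr0.
suff /eqP : <[v]>%VS = 0%VS by rewrite -dimv_eq0 dim_vline vn.
apply: ss => [x y /vlineP[k ->]|].
- by rewrite bZ mem0v.
- exists 1%N; apply: smallest_sub.
    by split=> [|x y -> ->|k x ->]; rewrite /set1 /mkset ?addr0 ?scaler0.
  by move=> z [x [y [_ /vlineP[k ->] ->]]]; exact: bZ.
Qed.

Lemma semisimple_form : semisimple G ->
  exists (x : E) (lam : C) (S : 'M[C]_n), [/\ x != 0, lam != 0, S^T = S, S \in unitmx &
    forall w, mxform S x (br x w) = lam * mxform S x w].
Proof.
move=> ss; have [x xn] := semisimple_nonnilpotent ss.
pose A : 'M[C]_n := lin1_mx (br x).
have brr (k : C) u v : br x (k *: u + v) = k *: br x u + br x v.
  by rewrite (bracketC x) bracket_linearl (bracketC x u) (bracketC x v) opprD scalerN.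
pose brx : {linear E -> E} := HB.pack (br x) (GRing.isLinear.Build _ _ _ _ (br x) brr).
have AE y : y *m A = br x y by rewrite -[A]/(lin1_mx brx) mul_rV_lin1.
have An : ~ (exists m, forall y : E, iter m (mulmxr A) y = 0).
  move=> [m mP]; apply: xn; exists m => y; rewrite -(mP y).
  by apply: eq_iter => z; rewrite -AE.
have [lam lam0 [phi phi0 phiE]] := nonnilpotent_eigenvector An.
have x0 : x != 0.
  apply: contra_not_neq xn => ->; exists 1%N => y /=.
  exact: bracket0l.
(* lam phi(x) = phi([x, x]) = 0. *)
have xphi : x *m phi = 0.
  have /eqP : lam *: (x *m phi) = 0.
    by rewrite scalemxAr -phiE mulmxA AE bracket_alt mul0mx.
  by rewrite scaler_eq0 (negPf lam0) => /eqP.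
have [S [ST Su xS]] := form_with_row x0 phi0 xphi.
exists x, lam, S; split=> // w.
have tr (y : E) : phi^T *m y^T = (y *m phi)^T by rewrite trmx_mul.
by rewrite /mxform xS !tr -AE -mulmxA phiE -scalemxAr !mxE.
Qed.

End SemisimpleData.

(** * Left-invariant metrics *)

Section Projections.
Context {R : realType} {U V : normedModType (Cplx R)}.

Lemma nm_pairE (z : U * V) : nm z = Num.max (nm z.1) (nm z.2).
Proof.
case: z => u v; apply: rc_inj; rewrite -nmE prod_normE /= !nmE.
by rewrite /Order.max rc_lt; case: ifP.
Qed.

Lemma diff_fst (z : U * V) : differentiable (fun z : U * V => z.1) z.
Proof.
apply: (affine_diff (K := 1) (L := fun z : U * V => z.1) _ _ _ z).1 => //.
by move=> h; rewrite mul1r nm_pairE le_max lexx.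
Qed.

Lemma diff_snd (z : U * V) : differentiable (fun z : U * V => z.2) z.
Proof.
apply: (affine_diff (K := 1) (L := fun z : U * V => z.2) _ _ _ z).1 => //.
by move=> h; rewrite mul1r nm_pairE le_max lexx orbT.
Qed.

End Projections.

Section LeftInvariantMetric.
Context {R : realType} {n : nat} {G : complexLieGroupType R n}.
Local Notation C := (Cplx R).
Local Notation E := 'rV[C]_n.
Implicit Types (c d e : chart R n G) (a b p : G) (u v w x : E).
Local Notation c1 := (@c1 R n G).
Local Notation e1 := (@e1 R n G).

(* The Maurer-Cartan form, in the chart c. *)
Definition theta c p v : E := 'd (cmap c1 \o left_translation p^-1%g \o cinv c) (cmap c p) v.

Lemma inv_dom p : cdom c1 (left_translation p^-1%g p).
Proof. by rewrite /left_translation mulVg; exact: c1_dom. Qed.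

Lemma theta_change c d p v : atlas c -> atlas d -> cdom c p -> cdom d p ->
  theta d p ('d (cmap d \o idfun \o cinv c) (cmap c p) v) = theta c p v.
Proof.
move=> ac ad cp dp.
have H := hol_at_comp (hol_at_id p) (hol_at_left p^-1%g (idfun p)) v ac ad c1_atlas cp dp (inv_dom p).
exact: esym H.
Qed.

Lemma theta_left c d a p v : atlas c -> atlas d -> cdom c p -> cdom d (left_translation a p) ->
  theta d (left_translation a p) ('d (cmap d \o left_translation a \o cinv c) (cmap c p) v) =
  theta c p v.
Proof.
move=> ac ad cp dp.
have H := hol_at_comp (hol_at_left a p) (hol_at_left (left_translation a p)^-1%g _) v ac ad c1_atlas cp dp (inv_dom _).
apply: etrans (esym H) _; rewrite /theta.
have -> : left_translation (left_translation a p)^-1%g \o left_translation a =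
    left_translation p^-1%g :> (G -> G); last by [].
by apply/funext => x; rewrite /left_translation /= invgM -mulgA mulKg.
Qed.

Lemma theta_Xf c p w : atlas c -> cdom c p -> theta c p (Xf c w (cmap c p)) = w.
Proof.
move=> ac cp; rewrite Xf_left //.
have cp' : cdom c (left_translation p (1%g : G)) by rewrite left_translation_1.
have := theta_left w c1_atlas ac c1_dom cp'.
rewrite left_translation_1 => ->.
rewrite /theta invg1 left_translation1.
by apply: diff_chart_id; [exact: c1_atlas|exact: c1_dom].
Qed.

Lemma Xf_theta c p v : atlas c -> cdom c p -> Xf c (theta c p v) (cmap c p) = v.
Proof.
move=> ac cp; rewrite Xf_left //.
have i1 : left_translation p^-1%g p = 1%g :> G by rewrite /left_translation mulVg.
have cp' : cdom c (left_translation p (left_translation p^-1%g p)).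
  by rewrite i1 left_translation_1.
have H := hol_at_comp (hol_at_left p^-1%g p) (hol_at_left p _) v ac c1_atlas ac cp (inv_dom p) cp'.
rewrite i1 in H; apply: etrans (esym H) _.
rewrite -left_translationM mulgV left_translation1.
exact: diff_chart_id.
Qed.

(** The map (p, q) -> p^-1 q near the diagonal. Its partial derivative in [q] at the diagonal is
    [theta], which makes the holomorphic dependence of [theta] on the base point visible. *)
Definition nu c (z : E * E) : E := cmap c1 ((cinv c z.1)^-1 * cinv c z.2)%g.

Lemma nu_holo c p : atlas c -> cdom c p -> holo_near (nu c) (cmap c p, cmap c p).
Proof.
move=> ac cp; pose d := chart_at (p^-1)%g.
have [ad dd] := (chart_at_atlas (p^-1)%g, chart_at_dom (p^-1)%g).
have dom : cdom c1 (p^-1 * p)%g by rewrite mulVg; exact: c1_dom.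
have H := mulg_holo ad ac c1_atlas dd cp dom.
have I := invg_holo ac ad cp dd.
pose q (z : E * E) : E * E := (cmap d (cinv c z.1)^-1%g, z.2).
have qE : q (cmap c p, cmap c p) = (cmap d (p^-1)%g, cmap c p) by rewrite /q /= cmapK.
have qh : holo_near q (cmap c p, cmap c p).
  have f1 : holo_near (fun z : E * E => z.1) (cmap c p, cmap c p).
    by apply: holo_near_all => z; exact: diff_fst.
  have f2 : holo_near (fun z : E * E => z.2) (cmap c p, cmap c p).
    by apply: holo_near_all => z; exact: diff_snd.
  have f3 := holo_near_comp f1 I.
  by apply: filterS2 f3 f2 => z d1 d2; exact: differentiable_pair.
rewrite -qE in H; have HH := holo_near_comp qh H.
apply: near_holo HH.
have n1 : \forall z \near (cmap c p, cmap c p), cdom d (cinv c z.1)^-1%g.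
  have [ic _] := @invg_holomorphic R n G.
  have h : (fun z : E * E => cinv c z.1) @ (cmap c p, cmap c p) --> p.
    by apply: cvg_comp (cvg_cinv cp); exact: cvg_fst.
  exact: (h _ (ic p _ (near_cdom dd))).
by apply: filterS n1 => z z1; rewrite /nu /q /= cmapK.
Qed.

Lemma theta_nu c p v : atlas c -> cdom c p ->
  theta c p v = 'd (nu c) (cmap c p, cmap c p) (0, v).
Proof.
move=> ac cp; have [d1 d2] := diff_pairr (cmap c p) (cmap c p).
have [_ d3] := chain d1 (holo_at (nu_holo ac cp)).
have e : (fun y => nu c (cmap c p, y)) = cmap c1 \o left_translation p^-1%g \o cinv c.
  by apply/funext => y; rewrite /nu /= cmapK.
rewrite e in d3; apply: etrans (d3 v) _.
by congr ('d (nu c) _ _); exact: (d2 v).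
Qed.

Lemma theta_diff c p v : atlas c -> cdom c p ->
  differentiable (fun u => theta c (cinv c u) v) (cmap c p).
Proof.
move=> ac cp.
have nE : \forall u \near cmap c p, theta c (cinv c u) v = 'd (nu c) (u, u) (0, v).
  apply: filterS (near_chart cp) => u [u1 u2].
  by have := theta_nu v ac u1; rewrite u2; exact.
apply: (near_diff nE _).1.
have dg : differentiable (fun u : E => (u, u)) (cmap c p).
  by apply: differentiable_pair; exact: (diff_id _).1.
exact: (chain dg (holo_at (holo_near_diffV (0, v) (nu_holo ac cp)))).1.
Qed.

Section Metric.
Context (S : 'M[C]_n) (ST : S^T = S) (Su : S \in unitmx).

Lemma mxform_sym v w : mxform S v w = mxform S w v.
Proof.
rewrite /mxform -[in LHS](trmxK (v *m S *m w^T)) mxE !trmx_mul trmxK ST mulmxA.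
by [].
Qed.

Lemma mxform_nondeg v : (forall w, mxform S v w = 0) -> v = 0.
Proof.
move=> h; rewrite -[v](mulmxK Su); suff -> : v *m S = 0 by rewrite mul0mx.
apply/rowP => k; rewrite [RHS]mxE; have := h (delta_mx 0 k).
by rewrite /mxform trmx_delta -colE mxE.
Qed.

(** The pull-back of [S] by the Maurer-Cartan form, whose matrix in the preferred chart is [J]. The
    order of the factors reflects that jacobians act on row vectors from the right. *)
Definition li_at p : 'M[C]_n :=
  let J := 'J (cmap c1 \o left_translation p^-1%g \o cinv (chart_at p)) (cmap (chart_at p) p) in
  J *m S *m J^T.

Lemma li_atE p v w : mxform (li_at p) v w =
  mxform S (theta (chart_at p) p v) (theta (chart_at p) p w).
Proof.
by rewrite /mxform /li_at /theta /jacobian -!mul_rV_lin1 trmx_mul !mulmxA.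
Qed.

Lemma li_sym p v w : mxform (li_at p) v w = mxform (li_at p) w v.
Proof. by rewrite !li_atE mxform_sym. Qed.

Lemma li_nondegenerate p v : (forall w, mxform (li_at p) v w = 0) -> v = 0.
Proof.
move=> h; have [ap dp] := (chart_at_atlas p, chart_at_dom p).
have t0 : theta (chart_at p) p v = 0.
  apply: mxform_nondeg => w; rewrite -(theta_Xf w ap dp) -li_atE; exact: h.
by rewrite -(Xf_theta v ap dp) t0 /Xf; exact: linear0.
Qed.

Lemma li_coordE c p v w : atlas c -> cdom c p ->
  metric_coord li_at c v w (cmap c p) = mxform S (theta c p v) (theta c p w).
Proof.
move=> ac cp; apply: etrans (mxform_metric_mx li_at c (cmap c p) v w) _.
rewrite (cmapK cp); apply: etrans (li_atE _ _ _) _.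
have [ap dp] := (chart_at_atlas p, chart_at_dom p).
exact: (congr2 (mxform S) (theta_change v ac ap cp dp) (theta_change w ac ap cp dp)).
Qed.

Lemma mxformE v w : mxform S v w = \sum_i \sum_j v 0 i * S i j * w 0 j.
Proof.
rewrite /mxform mxE exchange_big; apply: eq_bigr => j _ /=.
by rewrite !mxE mulr_suml; apply: eq_bigr.
Qed.

Lemma mxform_diff (U : normedModType C) (f g : U -> E) (y : U) :
  differentiable f y -> differentiable g y ->
  differentiable (fun z : U => mxform S (f z) (g z)) y.
Proof.
move=> df dg; have -> : (fun z => mxform S (f z) (g z)) =
    (fun z => \sum_i \sum_j f z 0 i * S i j * g z 0 j) by apply/funext => z; exact: mxformE.
have dS i j : differentiable (fun z => f z 0 i * S i j * g z 0 j) y.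
  apply: (diff_mul _ (diff_coord j dg).1).1.
  exact: (diff_mul (diff_coord i df).1 (diff_const (S i j) y).1).1.
exact: (diff_sum (fun i => (diff_sum (dS i)).1)).1.
Qed.

Lemma li_holomorphic c p : atlas c -> cdom c p ->
  forall v w, differentiable (metric_coord li_at c v w) (cmap c p).
Proof.
move=> ac cp v w.
have nE : \forall u \near cmap c p, metric_coord li_at c v w u =
    mxform S (theta c (cinv c u) v) (theta c (cinv c u) w).
  apply: filterS (near_chart cp) => u [u1 u2].
  by have := li_coordE v w ac u1; rewrite u2.
apply: (near_diff nE _).1.
exact: mxform_diff (theta_diff v ac cp) (theta_diff w ac cp).
Qed.

Definition li_metric : holo_metric G :=
  HoloMetric li_sym li_nondegenerate li_holomorphic.

Lemma li_left_invariant : left_invariant li_metric.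
Proof.
move=> a p v w; apply: etrans (li_atE _ _ _) _; apply: etrans _ (esym (li_atE _ _ _)).
have [aq dq] := (chart_at_atlas (left_translation a p), chart_at_dom (left_translation a p)).
have [ap dp] := (chart_at_atlas p, chart_at_dom p).
exact: (congr2 (mxform S) (theta_left v ap aq dp dq) (theta_left w ap aq dp dq)).
Qed.

End Metric.

End LeftInvariantMetric.

(** * The Euler-Arnold equation *)

Section FormCalculus.
Context {R : realType} {n : nat}.
Local Notation C := (Cplx R).
Local Notation E := 'rV[C]_n.

Lemma mxformDr (A : 'M[C]_n) (v w w' : E) : mxform A v (w + w') = mxform A v w + mxform A v w'.
Proof. by rewrite /mxform linearD mulmxDr mxE. Qed.

Lemma mxformNl (A : 'M[C]_n) (v w : E) : mxform A (- v) w = - mxform A v w.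
Proof. by rewrite /mxform !mulNmx mxE. Qed.

Lemma mxformNr (A : 'M[C]_n) (v w : E) : mxform A v (- w) = - mxform A v w.
Proof. by rewrite /mxform linearN mulmxN mxE. Qed.

(** This identity and the three that follow are the scalar bookkeeping of the Euler-Arnold
    computation, isolated so that [ring] works on variables rather than on differentials. *)
Lemma frame_identity_algebra (t s s' : C) : s' = s -> t + s' + s = 0 -> t = - (2 * s).
Proof. by move=> -> /eqP; rewrite -addrA addr_eq0 => /eqP ->; ring. Qed.

Lemma koszul_algebra (s t : C) : 2^-1 * (s + s - t) = s - 2^-1 * t.
Proof.
have two : (2 : C) != 0 by rewrite pnatr_eq0.
have ss : s + s = 2 * s by ring.
by rewrite ss mulrBr (mulKf two).
Qed.

Lemma euler_arnold_algebra (P Q x y : C) : Q = - (2 * y) -> P + - (P - 2^-1 * Q) + x = x - y.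
Proof.
have two : (2 : C) != 0 by rewrite pnatr_eq0.
by move=> ->; rewrite mulrN (mulKf two); ring.
Qed.

Lemma triple_product_algebra (a A b a' A' b' : C) : (a' * A + a * A') * b + a * A * b' =
  (0 * A + a * A') * b + a * A * 0 + a' * A * b + a * A * b'.
Proof. by ring. Qed.

(** The product rule in three factors, by expansion into matrix entries. The first term
    differentiates the form with both arguments frozen, which is how derivatives of the metric
    appear in Koszul's identity. *)
Lemma diff_form (U V : normedModType C) (A : V -> 'M[C]_n) (q : U -> V) (a b : U -> E) (y : U) :
  (forall i j, differentiable (fun u => A u i j) (q y)) ->
  differentiable q y -> differentiable a y -> differentiable b y ->
  differentiable (fun z => mxform (A (q z)) (a z) (b z)) y /\
  forall h, 'd (fun z => mxform (A (q z)) (a z) (b z)) y h =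
    'd (fun u => mxform (A u) (a y) (b y)) (q y) ('d q y h)
    + mxform (A (q y)) ('d a y h) (b y) + mxform (A (q y)) (a y) ('d b y h).
Proof.
move=> dA dq da db.
have -> : (fun z => mxform (A (q z)) (a z) (b z)) =
    (fun z => \sum_i \sum_j a z 0 i * A (q z) i j * b z 0 j).
  by apply/funext => z; exact: mxformE.
have -> : (fun u => mxform (A u) (a y) (b y)) =
    (fun u => \sum_i \sum_j a y 0 i * A u i j * b y 0 j).
  by apply/funext => z; exact: mxformE.
have dai i := diff_coord i da; have dbj j := diff_coord j db.
have dAq i j := chain dq (dA i j).
have d1 i j := diff_mul (dai i).1 (dAq i j).1.
have d2 i j := diff_mul (d1 i j).1 (dbj j).1.
have d3 i := diff_sum (fun j => (d2 i j).1).
have d4 := diff_sum (fun i => (d3 i).1).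
have k1 i j := diff_mul (diff_const (a y 0 i) (q y)).1 (dA i j).
have k2 i j := diff_mul (k1 i j).1 (diff_const (b y 0 j) (q y)).1.
have k3 i := diff_sum (fun j => (k2 i j).1).
have k4 := diff_sum (fun i => (k3 i).1).
split; first exact: d4.1.
move=> h; apply: etrans (d4.2 h) _.
apply: etrans _ (esym (congr1 (fun t => t + _ + _) (k4.2 ('d q y h)))).
rewrite (mxformE _ ('d a y h)) (mxformE _ (a y)) -!big_split.
apply: eq_bigr => i _; apply: etrans ((d3 i).2 h) _.
apply: etrans _ (esym (congr1 (fun t => t + _ + _) ((k3 i).2 ('d q y h)))).
rewrite -!big_split; apply: eq_bigr => j _.
apply: etrans ((d2 i j).2 h) _.
apply: etrans _ (esym (congr1 (fun t => t + _ + _) ((k2 i j).2 ('d q y h)))).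
have E1 := (d1 i j).2 h; have E2 := (dai i).2 h; have E3 := (dbj j).2 h.
have E4 := (dAq i j).2 h; have E5 := (k1 i j).2 ('d q y h).
have E6 := (diff_const (a y 0 i) (q y)).2 ('d q y h).
have E7 := (diff_const (b y 0 j) (q y)).2 ('d q y h).
apply: etrans (congr2 (fun s t => s * _ + _ * t) E1 E3) _.
apply: etrans (congr2 (fun s t => (s * _ + _ * t) * _ + _) E2 E4) _.
apply: etrans _ (esym (congr2 (fun s t => s * _ + _ * t + _ + _) E5 E7)).
apply: etrans _ (esym (congr1 (fun s => (s * _ + _) * _ + _ + _ + _) E6)).
exact: triple_product_algebra.
Qed.

End FormCalculus.

Section EulerArnold.
Context {R : realType} {n : nat} {G : complexLieGroupType R n}.
Local Notation C := (Cplx R).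
Local Notation E := 'rV[C]_n.
Local Notation br := (@lie_group_bracket R n G).
Context (S : 'M[C]_n) (ST : S^T = S) (Su : S \in unitmx).
Let g : holo_metric G := li_metric ST Su.

Lemma li_frame (c : chart R n G) (p : G) (v w : E) : atlas c -> cdom c p ->
  mxform (metric_mx g c (cmap c p)) (Xf c v (cmap c p)) (Xf c w (cmap c p)) = mxform S v w.
Proof.
move=> ac cp; apply: etrans (li_coordE S _ _ ac cp) _.
exact: (congr2 (mxform S) (theta_Xf v ac cp) (theta_Xf w ac cp)).
Qed.

Lemma metric_entries (c : chart R n G) (p : G) : atlas c -> cdom c p ->
  forall i j, differentiable (fun u => metric_mx g c u i j) (cmap c p).
Proof.
move=> ac cp i j.
have -> : (fun u => metric_mx g c u i j) = metric_coord g c (delta_mx 0 i) (delta_mx 0 j).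
  apply/funext => u; rewrite /metric_coord /mxform trmx_delta -rowE.
  by rewrite -colE !mxE.
exact: metric_holomorphic.
Qed.

(** The left-invariant field of [a] has constant square [mxform S a a]. Differentiating that
    constant trades a derivative of the metric for a derivative of the field. *)
Lemma frame_identity (c : chart R n G) (p : G) (a : E) : atlas c -> cdom c p ->
  let u := cmap c p in let v := Xf c a u in forall w,
  'd (fun x => mxform (metric_mx g c x) v v) u w =
  - (2 * mxform (metric_mx g c u) v ('d (Xf c a) u w)).
Proof.
move=> ac cp u v w.
have dA := metric_entries ac cp.
have dX : differentiable (Xf c a) u := holo_at (Xf_holo a ac cp).
have [d1 d2] := @diff_form R n E E (metric_mx g c) (fun y => y) (Xf c a) (Xf c a) u
  dA (diff_id u).1 dX dX.
have nE : \forall x \near u, mxform (metric_mx g c x) (Xf c a x) (Xf c a x) = mxform S a a.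
  apply: filterS (near_chart cp) => x [x1 x2].
  by have := li_frame a a ac x1; rewrite x2.
have dS := diff_const (mxform S a a) u.
have idw : 'd (fun y : E => y) u w = w := (diff_id u).2 w.
pose f x := mxform (metric_mx g c x) v v.
pose m2 := mxform (metric_mx g c u) v ('d (Xf c a) u w).
have z0 : 'd f u w + mxform (metric_mx g c u) ('d (Xf c a) u w) v + m2 = 0.
  apply: etrans (congr1 (fun t : E => 'd f u t + mxform (metric_mx g c u) ('d (Xf c a) u w) v + m2) (esym idw)) _.
  apply: etrans (esym (d2 w)) _.
  exact: etrans ((near_diff nE dS.1).2 w) (dS.2 w).
have sm : mxform (metric_mx g c u) ('d (Xf c a) u w) v = m2 := mxform_metric_mx_sym g c u _ _.
exact: frame_identity_algebra sm z0.
Qed.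

Context (gam : C -> G) (geo : geodesic g setT gam).

Definition xi (t : C) : E := theta (chart_at (gam t)) (gam t) (velocity gam t).

Lemma near_gam (c : chart R n G) (t0 : C) : cdom c (gam t0) ->
  \forall t \near t0, cdom c (gam t).
Proof.
move=> cp; have [_ hc _] := geo; have [gc _] := hc t0 I.
exact: (gc _ (near_cdom cp)).
Qed.

Lemma gam_holo (c : chart R n G) (t0 : C) : atlas c -> cdom c (gam t0) ->
  holo_near (cmap c \o gam) t0.
Proof.
move=> ac cp; have [_ hc _] := geo.
by apply: filterS (near_gam cp) => t ct; have [_ h] := hc t I; exact: h.
Qed.

Lemma xiE (c : chart R n G) (t : C) : atlas c -> cdom c (gam t) ->
  xi t = theta c (gam t) ('d (cmap c \o gam) t 1).
Proof.
move=> ac cp; have [ad dp] := (chart_at_atlas (gam t), chart_at_dom (gam t)).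
rewrite /xi /velocity derive1E'; last exact: holo_at (gam_holo ad dp).
rewrite -(theta_change _ ac ad cp dp); congr (theta _ _ _).
have dz := holo_at (gam_holo ac cp).
have dT := (hol_at_id (gam t)).2 c _ ac ad cp dp.
have [k1 k2] := chain dz dT.
apply: etrans _ (k2 1); apply: (near_diff _ k1).2.
by apply: filterS (near_gam cp) => s cs /=; rewrite cmapK.
Qed.

Lemma geodesic_chart (c : chart R n G) (t0 : C) : atlas c -> cdom c (gam t0) ->
  'd (fun t => 'd (cmap c \o gam) t 1) t0 1 =
  - christoffel g c (cmap c (gam t0)) ('d (cmap c \o gam) t0 1) ('d (cmap c \o gam) t0 1).
Proof.
move=> ac cp; set z := cmap c \o gam.
have v1 t : cdom c (gam t) -> derive1 z t = 'd z t 1.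
  by move=> ct; exact: (derive1E' (holo_at (gam_holo ac ct))).
have nv : \forall t \near t0, derive1 z t = 'd z t 1.
  by apply: filterS (near_gam cp) => t; exact: v1.
have [k1 k2] := near_diff nv (holo_at (holo_near_diffV (1 : C) (gam_holo ac cp))).
have [_ _ /(_ t0 c I ac cp)] := geo; rewrite /nabla_along (v1 _ cp).
move=> /eqP; rewrite addr_eq0 => /eqP h.
exact: etrans (esym (k2 1)) (etrans (esym (derive1E' k1)) h).
Qed.

Lemma koszul_diff (c : chart R n G) (p : G) (v w : E) : atlas c -> cdom c p ->
  let u := cmap c p in
  koszul g c u v v w = 'd (fun x => mxform (metric_mx g c x) v w) u v
     - 2^-1 * 'd (fun x => mxform (metric_mx g c x) v v) u w.
Proof.
move=> ac cp u.
have dB a' b' : differentiable (metric_coord g c a' b') u := metric_holomorphic g ac cp a' b'.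
have E1 : 'D_v (metric_coord g c v w) u = 'd (metric_coord g c v w) u v := deriveE _ (dB v w).
have E2 : 'D_w (metric_coord g c v v) u = 'd (metric_coord g c v v) u w := deriveE _ (dB v v).
rewrite /koszul.
apply: etrans (congr2 (fun s t => 2^-1 * (s + s - t)) E1 E2) _.
exact: koszul_algebra.
Qed.

(** S(xi, w) is g(gam', X_w), with X_w the left-invariant field of w. With v = gam'(t0), W = X_w and
    a = xi(t0) frozen, its derivative is D_v g(v, W) + g(gam'', W) + g(v, D_v X_w). The geodesic
    equation and Koszul's identity reduce the first two terms to half of D_W g(v, v), which is -g(v,
    D_W X_a) by [frame_identity]. What is left is g(v, [X_a, X_w]), and [lie_identity] turns it into
    S(a, [a, w]). *)
Theorem euler_arnold (t0 : C) (w : E) :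
  differentiable (fun t => mxform S (xi t) w) t0 /\
  'd (fun t => mxform S (xi t) w) t0 1 = mxform S (xi t0) (br (xi t0) w).
Proof.
pose c := chart_at (gam t0).
have [ac cp] : atlas c /\ cdom c (gam t0) by split; [exact: chart_at_atlas|exact: chart_at_dom].
pose z := cmap c \o gam; have zh : holo_near z t0 := gam_holo ac cp.
pose z' t := 'd z t 1.
have z'h : holo_near z' t0 := holo_near_diffV (1 : C) zh.
have dA := metric_entries ac cp.
have dX v := holo_at (Xf_holo v ac cp).
have XE t : cdom c (gam t) -> Xf c (xi t) (z t) = z' t.
  by move=> ct; rewrite (xiE ac ct); exact: Xf_theta.
have nE : \forall t \near t0, mxform S (xi t) w = mxform (metric_mx g c (z t)) (z' t) (Xf c w (z t)).
  apply: filterS (near_gam cp) => t ct.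
  by rewrite -(XE t ct); exact: esym (li_frame _ _ ac ct).
have dXz := chain (holo_at zh) (dX w).
have [d1 d2] := diff_form dA (holo_at zh) (holo_at z'h) dXz.1.
have [d3 d4] := near_diff nE d1; split; first exact: d3.
apply: etrans (d4 1) _; apply: etrans (d2 1) _.
set u := z t0; set v := z' t0; set W := Xf c w u; set a := xi t0.
have va : Xf c a u = v := XE t0 cp.
have geoE : 'd z' t0 1 = - christoffel g c u v v := geodesic_chart ac cp.
have chr := christoffelP g ac cp v v W.
have kE := koszul_diff v W ac cp.
have fi := frame_identity a ac cp W.
have li := lie_identity a w ac cp.
have la : mxform (metric_mx g c u) (Xf c a u) (Xf c (br a w) u) = mxform S a (br a w) := li_frame a (br a w) ac cp.
have be : br a w = beta w a - beta a w := bracketE a w.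
have dXz2 : 'd (fun y => Xf c w (z y)) t0 1 = 'd (Xf c w) u v := dXz.2 1.
rewrite va in fi li la.
have mW : mxform (metric_mx g c u) ('d z' t0 1) W =
    - ('d (fun x => mxform (metric_mx g c x) v W) u v
       - 2^-1 * 'd (fun x => mxform (metric_mx g c x) v v) u W).
  apply: etrans (congr1 (fun t : E => mxform (metric_mx g c u) t W) geoE) _.
  by apply: etrans (mxformNl _ _ _) _; rewrite -kE; exact: (congr1 -%R chr).
have rhs : mxform S a (br a w) = mxform (metric_mx g c u) v ('d (Xf c w) u v)
    - mxform (metric_mx g c u) v ('d (Xf c a) u W).
  apply: etrans (esym la) _; rewrite -mxformNr -mxformDr.
  apply: (congr1 (fun t : E => mxform (metric_mx g c u) v t)).
  exact: etrans (congr1 (fun t : E => Xf c t u) be) (esym li).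
apply: etrans _ (esym rhs).
apply: etrans (congr2 (fun (s : C) (t : E) => _ + s + mxform _ v t) mW dXz2) _.
exact: euler_arnold_algebra fi.
Qed.

End EulerArnold.

(** * Blow-up *)

Section SingularGronwall.
Context {R : realType} {m : nat}.
Implicit Types (p q : 'I_m -> R -> R).

Lemma sqr_sum_le (u : 'I_m -> R) : (\sum_i u i) ^+ 2 <= m%:R * \sum_i u i ^+ 2.
Proof.
have -> : (\sum_i u i) ^+ 2 = \sum_i \sum_j u i * u j.
  by rewrite expr2 mulr_suml; apply: eq_bigr => i _; rewrite mulr_sumr.
apply: le_trans (_ : \sum_i \sum_j (u i ^+ 2 + u j ^+ 2) / 2 <= _).
  apply: ler_sum => i _; apply: ler_sum => j _; have := sqr_ge0 (u i - u j).
  by move: (u i) (u j) => x y; rewrite !expr2; lra.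
under eq_bigr => i _ do rewrite -mulr_suml big_split /= sumr_const card_ord.
rewrite -mulr_suml big_split /= sumr_const card_ord sumrMnl mulr_natl.
by move: (_ *+ m) => x; lra.
Qed.

Lemma is_derive_norm2 p q (p' q' : 'I_m -> R -> R) (K : nat) (s : R) :
  (forall k, is_derive s 1 (p k) (p' k s)) -> (forall k, is_derive s 1 (q k) (q' k s)) ->
  is_derive s (1 : R) (fun t => (\sum_k (p k t ^+ 2 + q k t ^+ 2)) * (1 - t) ^+ K.+1)
   ((\sum_k 2 * (p k s * p' k s + q k s * q' k s)) * (1 - s) ^+ K.+1
    - (\sum_k (p k s ^+ 2 + q k s ^+ 2)) * (K.+1%:R * (1 - s) ^+ K)).
Proof.
move=> dp dq.
have -> : (fun t => (\sum_k (p k t ^+ 2 + q k t ^+ 2)) * (1 - t) ^+ K.+1) =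
    (\sum_k (p k ^+ 2 + q k ^+ 2)) * (cst 1 - id) ^+ K.+1.
  by apply/funext => t; rewrite [RHS]/GRing.mul /= exprfctE fct_sumE.
apply: is_derive_eq; rewrite exprfctE fct_sumE /= sub0r.
rewrite [X in _ + X]mulrC addrC; congr (_ * _ + _); first by apply: eq_bigr => k _; rewrite /GRing.scale /=; ring.
by rewrite /GRing.scale /= mulrN1 mulrN.
Qed.

(* (1 - s)^K times the sum of the squares is nonincreasing for K large. *)
Lemma singular_gronwall p q (p' q' : 'I_m -> R -> R) (M : R) : 0 <= M ->
  (forall k (s : R), is_derive s (1 : R) (p k) (p' k s)) ->
  (forall k (s : R), is_derive s (1 : R) (q k) (q' k s)) ->
  (forall k, p k 0 = 0) -> (forall k, q k 0 = 0) ->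
  (forall k (s : R), 0 <= s <= 1 -> `|(1 - s) * p' k s| <= M * \sum_j (`|p j s| + `|q j s|)) ->
  (forall k (s : R), 0 <= s <= 1 -> `|(1 - s) * q' k s| <= M * \sum_j (`|p j s| + `|q j s|)) ->
  forall k (s : R), 0 <= s < 1 -> p k s = 0 /\ q k s = 0.
Proof.
move=> M0 dp dq p0 q0 pM qM.
(* With U the sum of all |p| + |q|, the hypotheses give (1 - s) N' <= 2 M U^2, and U^2 <= 2 m N by
   [sqr_sum_le]. So (1 - s) N' <= K N, and the derivative of N (1 - s)^(K + 1) is at most 0. *)
pose K := Num.bound (4 * M * m%:R).
pose N s := \sum_k (p k s ^+ 2 + q k s ^+ 2).
have N0 s : 0 <= N s by apply: sumr_ge0 => k _; rewrite addr_ge0 ?sqr_ge0.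
have key (s : R) : 0 <= s <= 1 -> (\sum_k 2 * (p k s * p' k s + q k s * q' k s)) * (1 - s) <= K%:R * N s.
  move=> sI; pose U : R := \sum_j (`|p j s| + `|q j s|).
  have step (a b : R) : `|(1 - s) * b| <= M * U -> a * b * (1 - s) <= `|a| * (M * U).
    move=> h; rewrite -mulrA [b * _]mulrC; apply: le_trans (ler_norm _) _.
    by rewrite normrM; apply: ler_wpM2l.
  apply: le_trans (_ : 2 * M * U ^+ 2 <= _).
    rewrite expr2 [_ * (U * U)]mulrA {1}/U mulr_sumr !mulr_suml; apply: ler_sum => k _.
    have h1 := step (p k s) _ (pM k s sI); have h2 := step (q k s) _ (qM k s sI).
    have := ler_wpM2l (ler0n R 2) (lerD h1 h2).
    move=> h; rewrite -/U; clear -h; move: U h => V; move: (p k s) (p' k s) (q k s) (q' k s) => a a' b b'.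
    by move: `|a| `|b| => c d h; apply: le_trans (le_trans _ h) _; rewrite le_eqVlt; apply/orP; left; apply/eqP; ring.
  have h := sqr_sum_le (fun j => `|p j s| + `|q j s|).
  apply: le_trans (_ : 2 * M * (m%:R * (2 * N s)) <= _).
    apply: ler_wpM2l; first lra.
    apply: le_trans h _; apply: ler_wpM2l; first exact: ler0n.
    rewrite mulr_sumr; apply: ler_sum => j _; rewrite -[p j s ^+ 2]real_normK ?num_real //.
    rewrite -[q j s ^+ 2]real_normK ?num_real //.
    have := sqr_ge0 (`|p j s| - `|q j s|); move: `|p j s| `|q j s| => x y; rewrite !expr2; lra.
  have kb : 4 * M * m%:R <= K%:R by apply/ltW/archi_boundP; rewrite !mulr_ge0 ?ler0n.
  apply: le_trans (_ : (4 * M * m%:R) * N s <= _); first by rewrite le_eqVlt; apply/orP; left; apply/eqP; ring.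
  exact: ler_wpM2r.
pose f s := N s * (1 - s) ^+ K.+1.
have df s := is_derive_norm2 K (fun k => dp k s) (fun k => dq k s).
have f0' (x : R) : x \in `]0, 1[%R -> derive1 f x <= 0.
  rewrite in_itv /= => /andP[x0 x1]; rewrite derive1E; have [_ ->] := df x.
  have x01 : 0 <= x <= 1 by rewrite !ltW.
  rewrite exprS mulrA [(1 - x) ^+ K]lock mulrA -mulrBl; apply: mulr_le0_ge0.
    rewrite subr_le0; apply: le_trans (key x x01) _.
    by rewrite mulrC ler_wpM2l ?ler_nat.
  by rewrite -lock exprn_ge0 // subr_ge0 ltW.
have fle s : 0 <= s <= 1 -> f s <= f 0.
  move=> /andP[s0 s1].
  apply: (@ler0_derive1_le_cc R f 0 1); rewrite ?in_itv /= ?lexx ?ler01 ?s0 //.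
  apply: continuous_subspaceT => x; apply: differentiable_continuous.
  by apply/derivable1_diffP; exact: (@ex_derive _ _ _ _ _ _ _ (df x)).
move=> k s /andP[s0 s1].
have f0 : f 0 = 0.
  rewrite /f /N big1 ?mul0r // => j _; rewrite p0 q0 !expr2; ring.
have fs : f s <= 0 by rewrite -f0; apply: fle; rewrite s0 ltW.
have Ns : N s = 0.
  apply/eqP; rewrite eq_le N0 andbT.
  move: fs; rewrite /f pmulr_lle0 // exprn_gt0 // subr_gt0 //.
have /eqP := Ns; rewrite psumr_eq0 => [/allP/(_ k)|j _]; last by rewrite addr_ge0 ?sqr_ge0.
by rewrite mem_index_enum paddr_eq0 ?sqr_ge0 // !sqrf_eq0 => /(_ isT)/andP[/eqP -> /eqP ->].
Qed.

End SingularGronwall.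

Section RadialDerivative.
Context {R : realType}.
Local Notation C := (Cplx R).
Local Notation re := (@complex.Re R).
Local Notation im := (@complex.Im R).

(** [l] stands for the real or the imaginary part. Both become real functions on the ray through
    [tau], to which the real Gronwall estimate applies. *)
Lemma is_derive_line (l : C -> R) (g : C -> C) (tau : C) (s : R) :
  (forall z w, l (z - w) = l z - l w) -> (forall (x : R) z, l (rc x * z) = x * l z) ->
  (forall z, `|l z| <= nm z) -> differentiable g (rc s * tau) ->
  is_derive s (1 : R) (fun t : R => l (g (rc t * tau))) (l (tau * 'd g (rc s * tau) 1)).
Proof.
move=> lB lZ lnm dg; set L := l _.
have cv : (fun h : R => h^-1 *: (l (g (rc (h *: 1 + s) * tau)) - l (g (rc s * tau)))) @ 0^' --> L.
  apply/cvgrPdist_le => e e0.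
  have T1 : 0 < nm tau + 1 by rewrite ltr_wpDl ?nm_ge0.
  have [d d0 dP] := diff_nm dg (divr_gt0 e0 T1).
  apply/nbhs_ballP; exists (d / (nm tau + 1)) => /=; first exact: divr_gt0.
  move=> h; rewrite /ball /= sub0r normrN => hd h0.
  have hd' : nm (rc h * tau) < d.
    rewrite nmM nm_rc; move: hd; rewrite ltr_pdivlMr //; apply: le_lt_trans.
    by apply: ler_wpM2l; rewrite ?normr_ge0 // lerDl ler01.
  have := dP _ hd'.
  have -> : rc s * tau + rc h * tau = rc (h *: 1 + s) * tau.
    by rewrite -mulrDl -rcD [h *: 1]mulr1 addrC.
  set D := g _ - g _; have -> : 'd g (rc s * tau) (rc h * tau) = rc h * (tau * 'd g (rc s * tau) 1).
    rewrite mulrA -[in LHS](mulr1 (rc h * tau)); exact: linearZ.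
  move=> Dn; rewrite -lB -/D -[L](mulKf h0) -[_ *: _]/(_ * _) -mulrBr normrM normfV.
  rewrite ler_pdivrMl ?normr_gt0 // /L -lZ -opprB normrN -lB.
  apply: le_trans (lnm _) _; apply: le_trans Dn _.
  rewrite nmM nm_rc mulrAC ler_pdivrMr // mulrCA -mulrA.
  by rewrite ler_wpM2l ?normr_ge0 // ler_wpM2l ?(ltW e0) // lerDl ler01.
have dv : derivable (fun t : R => l (g (rc t * tau))) s (1 : R) by apply/cvg_ex; exists L.
split; first exact: dv.
exact: (cvg_lim (@norm_hausdorff _ _) cv).
Qed.

Lemma radial_bound m (H : 'I_m -> 'I_m -> C -> C) (tau : C) :
  (forall i k t, differentiable (H i k) t) ->
  exists2 M : R, 0 <= M & forall i k (s : R), 0 <= s <= 1 -> nm (H i k (rc s * tau)) <= M.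
Proof.
move=> dH; have bd i k : exists M : R, forall s : R, 0 <= s <= 1 -> nm (H i k (rc s * tau)) <= M.
  have cf : continuous (fun s : R => nm (H i k (rc s * tau))).
    move=> s; have c1 : {for s, continuous (fun s : R => rc s * tau)}.
      by apply: continuousM; [exact: rc_continuous|exact: cvg_cst].
    have c2 : {for s, continuous (fun s : R => H i k (rc s * tau))}.
      apply: continuous_comp c1 _; exact: differentiable_continuous.
    have c3 : {for s, continuous (fun s : R => `|H i k (rc s * tau)|)}.
      exact: continuous_comp c2 (@norm_continuous _ _ _).
    exact: continuous_comp c3 (@re_continuous _ _).
  have [c _ cP] := EVT_max (@ler01 R) (continuous_subspaceT cf).
  by exists (nm (H i k (rc c * tau))) => s sI; apply: cP; rewrite in_itv.
have [M MP] := choice (fun x : 'I_m * 'I_m => bd x.1 x.2).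
exists (\sum_i \sum_k `|M (i, k)|); first by apply: sumr_ge0 => i _; apply: sumr_ge0.
move=> i k s sI; apply: le_trans (MP (i, k) s sI) _; apply: le_trans (ler_norm _) _.
rewrite (bigD1 i) //= (bigD1 k) //= -addrA lerDl addr_ge0 //; first exact: sumr_ge0.
by apply: sumr_ge0 => j _; apply: sumr_ge0.
Qed.

(** The real and imaginary parts of the [F k] along s -> s tau fall under [singular_gronwall] on [0,
    1). The singular point [tau] itself is reached by continuity, since [F k] is differentiable
    there. *)
Lemma radial_vanish m (F : 'I_m -> C -> C) (H : 'I_m -> 'I_m -> C -> C) (tau : C) :
  (forall k t, differentiable (F k) t) -> (forall i k t, differentiable (H i k) t) ->
  (forall k, F k 0 = 0) ->
  (forall k (s : R), (1 - rc s) * (tau * 'd (F k) (rc s * tau) 1) =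
     \sum_i F i (rc s * tau) * H i k (rc s * tau)) ->
  forall k, F k tau = 0.
Proof.
move=> dF dH F0 ode k; have [M M0 MP] := radial_bound tau dH.
have bound l i (s : R) : (forall z : C, `|l z| <= nm z) -> (forall (x : R) (z : C), l (rc x * z) = x * l z) ->
    0 <= s <= 1 -> `|(1 - s) * l (tau * 'd (F i) (rc s * tau) 1)| <=
    M * \sum_j (`|re (F j (rc s * tau))| + `|im (F j (rc s * tau))|).
  move=> lnm lZ sI; rewrite -lZ rcB; apply: le_trans (lnm _) _; rewrite ode.
  apply: le_trans (nm_sum _) _; rewrite mulr_sumr; apply: ler_sum => j _.
  rewrite nmM mulrC; apply: ler_pM; rewrite ?nm_ge0 //; [exact: MP|exact: nm_le_re_im].
have rZ (x : R) (z : C) : re (rc x * z) = x * re z by rewrite reM re_rc im_rc mul0r subr0.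
have iZ (x : R) (z : C) : im (rc x * z) = x * im z by rewrite imM re_rc im_rc mul0r addr0.
have rB (z w : C) : re (z - w) = re z - re w by rewrite reD reN.
have iB (z w : C) : im (z - w) = im z - im w by rewrite imD imN.
have z0 (s : R) : 0 <= s < 1 -> F k (rc s * tau) = 0.
  move=> sI; have [] := singular_gronwall M0
      (fun i t => is_derive_line rB rZ (@re_le_nm R) (dF i (rc t * tau)))
      (fun i t => is_derive_line iB iZ (@im_le_nm R) (dF i (rc t * tau))) _ _
      (fun i t => bound _ i t (@re_le_nm R) rZ)
      (fun i t => bound _ i t (@im_le_nm R) iZ) k sI.
  - by move=> i; rewrite rc0 mul0r F0.
  - by move=> i; rewrite rc0 mul0r F0.
  - by move=> h1 h2; exact: (@complex_ext R _ 0).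
apply/eqP; rewrite -nm_eq0; apply/eqP/le_anti; rewrite nm_ge0 andbT.
apply/ler_addgt0Pr => e e0; rewrite add0r.
have : {for 1%R, continuous (fun s : R => F k (rc s * tau))}.
  apply: continuous_comp; last exact: differentiable_continuous.
  by apply: continuousM; [exact: rc_continuous|exact: cvg_cst].
move=> /cvg_nmP/(_ _ e0)/nbhs_ballP[d /= d0 dP].
pose s := Num.max 0 (1 - d / 2).
have s01 : 0 <= s < 1 by rewrite le_max lexx /= gt_max ltr01 ltrBlDr ltrDl divr_gt0.
have := dP s; rewrite z0 // rc1 mul1r sub0r nmN => h; apply/ltW/h.
rewrite /ball /= ger0_norm ?subr_ge0; last by case/andP: s01 => _ /ltW.
rewrite ltrBlDl -ltrBlDr lt_max; apply/orP; right; lra.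
Qed.

End RadialDerivative.

Section Blowup.
Context {R : realType}.
Local Notation C := (Cplx R).

(* (1 - lam t) Y(t) - phi vanishes at 0 and satisfies a linear system with a
   regular singularity at 1 / lam, hence it vanishes on the whole segment. *)
Lemma quadratic_blowup m (b : 'I_m -> 'I_m -> 'I_m -> C) (Y : 'I_m -> C -> C)
    (phi : 'I_m -> C) (lam : C) : lam != 0 ->
  (forall k t, differentiable (Y k) t) ->
  (forall k t, 'd (Y k) t 1 = \sum_i \sum_j Y i t * Y j t * b i j k) ->
  (forall k, \sum_i \sum_j phi i * phi j * b i j k = lam * phi k) ->
  (forall k, Y k 0 = phi k) -> forall k, phi k = 0.
Proof.
move=> lam0 dY ode phiE Y0 k.
pose q (t : C) : C := 1 + - lam * t.
pose F k t := q t * Y k t + - phi k.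
(* Since q Y = F + phi, multiplying lam^-1 F' by q gives -(F + phi) plus lam^-1 times the quadratic
   form at F + phi. The part of that form quadratic in phi is lam phi and cancels -phi, so each
   remaining term contains some [F i]. The second factor F goes into the coefficient [H] as a known
   function, which makes the system linear. *)
pose H i k t : C := - (i == k)%:R +
  lam^-1 * (\sum_j b i j k * (F j t + phi j) + \sum_j phi j * b j i k).
have dq t : differentiable q t /\ 'd q t 1 = - lam.
  have d1 := diff_mul (diff_const (- lam) t).1 (diff_id t).1.
  have [d2 d3] := diff_add (diff_const (1 : C) t).1 d1.1; split; first exact: d2.
  apply: etrans (d3 1) _; apply: etrans (congr2 +%R ((diff_const (1 : C) t).2 1) (d1.2 1)) _.
  apply: etrans (congr2 (fun x y => 0 + (x * _ + _ * y)) ((diff_const (- lam) t).2 1) ((diff_id t).2 1)) _.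
  ring.
have dF i t : differentiable (F i) t /\ 'd (F i) t 1 = - lam * Y i t + q t * 'd (Y i) t 1.
  have d1 := diff_mul (dq t).1 (dY i t).
  have [d2 d3] := diff_add d1.1 (diff_const (- phi i) t).1; split; first exact: d2.
  apply: etrans (d3 1) _; apply: etrans (congr2 +%R (d1.2 1) ((diff_const (- phi i) t).2 1)) _.
  by apply: etrans (congr1 (fun x => x * _ + _ + 0) (dq t).2) _; rewrite addr0.
have dH i j t : differentiable (H i j) t.
  have e1 l := diff_add (dF l t).1 (diff_const (phi l) t).1.
  have e2 l := diff_mul (diff_const (b i l j) t).1 (e1 l).1.
  have e3 := diff_sum (fun l => (e2 l).1).
  have e4 := diff_add e3.1 (diff_const (\sum_l phi l * b l i j) t).1.
  have e5 := diff_mul (diff_const lam^-1 t).1 e4.1.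
  exact: (diff_add (diff_const (- (i == j)%:R : C) t).1 e5.1).1.
have F0 i : F i 0 = 0 by rewrite /F /q Y0 mulr0 addr0 mul1r subrr.
have : F k lam^-1 = 0.
  apply: (radial_vanish (fun i t => (dF i t).1) dH F0) => l s.
  set t := rc s * lam^-1; have qt : q t = 1 - rc s by rewrite /q /t mulrCA mulNr mulfV // mulrN1.
  rewrite -qt; have [_ dFl] := dF l t.
  apply: etrans (congr1 (fun x => q t * (lam^-1 * x)) dFl) _; rewrite ode.
  have FE i : q t * Y i t = F i t + phi i by rewrite /F addrNK.
  have -> : q t * (lam^-1 * (- lam * Y l t + q t * \sum_i \sum_j Y i t * Y j t * b i j l)) =
      - (q t * Y l t) + lam^-1 * \sum_i \sum_j (q t * Y i t) * (q t * Y j t) * b i j l.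
    have -> : \sum_i \sum_j (q t * Y i t) * (q t * Y j t) * b i j l =
        q t * (q t * \sum_i \sum_j Y i t * Y j t * b i j l).
      rewrite !mulr_sumr; apply: eq_bigr => i _; rewrite !mulr_sumr; apply: eq_bigr => j _; ring.
    rewrite [lam^-1 * (_ + _)]mulrDr mulNr mulrN mulKf //; ring.
  transitivity (- F l t + lam^-1 * (\sum_i F i t * (\sum_j b i j l * (F j t + phi j) + \sum_j phi j * b j i l))).
    have -> : \sum_i \sum_j (q t * Y i t) * (q t * Y j t) * b i j l =
        \sum_i F i t * (\sum_j b i j l * (F j t + phi j) + \sum_j phi j * b j i l) + lam * phi l.
      rewrite -phiE; under [in RHS]eq_bigr => i _ do rewrite mulrDr.
      rewrite big_split /=; under [X in _ + X + _]eq_bigr => i _ do rewrite mulr_sumr.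
      rewrite [X in _ + X + _]exchange_big /= -!big_split; apply: eq_bigr => i _ /=.
      rewrite mulr_sumr -!big_split; apply: eq_bigr => j _ /=; rewrite !FE; ring.
    by rewrite mulrDr (mulKf lam0) FE; ring.
  rewrite mulr_sumr -[- F l t]mulN1r; under [in RHS]eq_bigr => i _ do rewrite /H mulrDr.
  rewrite big_split /=; congr (_ + _); last by apply: eq_bigr => i _; rewrite mulrCA.
  rewrite (bigD1 l) //= eqxx big1 ?addr0; last by move=> i /negPf ->; rewrite oppr0 mulr0.
  by rewrite mulrN1 mulN1r.
(* [q] vanishes at [lam^-1], so F takes the value -phi there. *)
rewrite /F /q mulNr mulfV // subrr mul0r add0r => /eqP; rewrite oppr_eq0 => /eqP.
by [].
Qed.

End Blowup.

(** * Incompleteness of the metric *)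

Section Incomplete.
Context {R : realType} {n : nat} {G : complexLieGroupType R n}.
Local Notation C := (Cplx R).
Local Notation E := 'rV[C]_n.
Local Notation br := (@lie_group_bracket R n G).
Context (S : 'M[C]_n) (ST : S^T = S) (Su : S \in unitmx).
Local Notation ek := (delta_mx 0).

(** The rows [ek k *m invmx S] form the basis dual to the standard one with respect to [S]. *)
Lemma dual_expansion (v : E) :
  v = \sum_k mxform S v (ek k) *: (ek k *m invmx S).
Proof.
have pick k : mxform S v (ek k) = (v *m S) 0 k.
  by rewrite /mxform trmx_delta -colE mxE.
rewrite -[LHS](mulmxK Su) [X in X *m _]row_sum_delta mulmx_suml.
by apply: eq_bigr => k _; rewrite pick scalemxAl.
Qed.

(** Puts the right side of the Euler-Arnold equation in the form that [quadratic_blowup] expects: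
    quadratic, with constant coefficients, in the coordinates S(v, e_k). *)
Lemma mxform_bracketE (v w : E) : mxform S v (br v w) =
  \sum_i \sum_j mxform S v (ek i) * mxform S v (ek j) *
    mxform S (ek i *m invmx S) (br (ek j *m invmx S) w).
Proof.
pose B k (u : E) := mxform S (ek k *m invmx S) (br u w).
have Bl k (a : C) u u' : B k (a *: u + u') = a * B k u + B k u'.
  rewrite /B bracket_linearl mxformDr; congr (_ + _).
  by rewrite /mxform linearZ -scalemxAr mxE.
have Bs k : B k v = \sum_j mxform S v (ek j) * B k (ek j *m invmx S).
  pose B' : {linear E -> C} := HB.pack (B k) (GRing.isLinear.Build _ _ _ _ (B k) (Bl k)).
  rewrite -[LHS]/(B' v) {1}[v]dual_expansion linear_sum.
  by apply: eq_bigr => j _; rewrite linearZ.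
have -> : mxform S v (br v w) = \sum_i mxform S v (ek i) * B i v.
  rewrite {1}[v]dual_expansion /mxform !mulmx_suml summxE.
  by apply: eq_bigr => i _; rewrite -!scalemxAl mxE.
apply: eq_bigr => i _; rewrite Bs mulr_sumr; apply: eq_bigr => j _.
by rewrite mulrA.
Qed.

Lemma xi_init (gam : C -> G) (x : E) : gam 0 = 1%g -> velocity gam 0 = x -> xi gam 0 = x.
Proof.
rewrite /xi => -> ->.
by have := theta_Xf x (@c1_atlas R n G) c1_dom; rewrite Xf_1.
Qed.

(** Completeness would give a geodesic on all of C starting at 1 with velocity [x]. The functions
    S(xi, e_k) are then entire, and [quadratic_blowup] forces S(x, e_k) = 0 for every k, against
    nondegeneracy of [S] and x != 0. *)
Theorem li_incomplete (x : E) (lam : C) : x != 0 -> lam != 0 ->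
  (forall w, mxform S x (br x w) = lam * mxform S x w) ->
  incomplete_metric (li_metric ST Su : holo_metric G).
Proof.
move=> x0 lam0 eig /(_ 1%g x)[gam [geo g0 v0]].
have xi0 := xi_init g0 v0.
have ea k t := euler_arnold geo t (ek k).
have phi0 : forall k, mxform S x (ek k) = 0.
  apply: (quadratic_blowup lam0 (fun k t => (ea k t).1)
    (b := fun i j k => mxform S (ek i *m invmx S) (br (ek j *m invmx S) (ek k)))).
  - by move=> k t; apply: etrans (ea k t).2 _; exact: mxform_bracketE.
  - by move=> k; rewrite -mxform_bracketE.
  - by move=> k; rewrite xi0.
move/eqP: x0; apply; apply: (mxform_nondeg Su) => w.
by rewrite mxform_sumr big1 // => k _; rewrite phi0 mulr0.
Qed.

End Incomplete.

Theorem corollary9p2 (R : realType) (n : nat) (G : complexLieGroupType R n)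
  (ssG : semisimple G) :
  exists g : holo_metric G, left_invariant g /\ incomplete_metric g.
Proof.
have [x [lam [S [x0 lam0 ST Su eig]]]] := semisimple_form ssG.
exists (li_metric ST Su); split; first exact: li_left_invariant.
exact: li_incomplete x0 lam0 eig.
Qed.
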